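(* Let $M\in\widetilde{\mathcal A}$, let $I\in\mathcal I_{\widetilde{\mathcal A}}$ and let $P=\nu^{-1}(I)$. Then the following equations hold in the quantum torus $\mathcal T_\Lambda$: $$(q^{\langle \mathbf p,\mathbf m\rangle}-1)X_{P[1]}X_M=q^{\frac12\Lambda(\mathbf m^\ast,\mathbf p^\ast)}\Big(\sum_{[F],[P'],\,P'\ncong P}|{}_{P'}\operatorname{Hom}_{\widetilde{\mathcal A}}(P,M)_F|\,X_{F\oplus P'[1]}+q^{-\frac12\langle\mathbf m,\mathbf i\rangle}\sum_{[G],[I'],\,I'\ncong I}|{}_{G}\operatorname{Hom}_{\widetilde{\mathcal A}}(M,I)_{I'}|\,X_{G\oplus I'[-1]}\Big)$$ and $$(q^{\langle \mathbf m,\mathbf i\rangle}-1)X_MX_{I[-1]}=q^{\frac12\Lambda(\mathbf i^\ast,\mathbf m^\ast)}\Big(q^{-\frac12\langle\mathbf p,\mathbf m\rangle}\sum_{[F],[P'],\,P'\ncong P}|{}_{P'}\operatorname{Hom}_{\widetilde{\mathcal A}}(P,M)_F|\,X_{F\oplus P'[1]}+\sum_{[G],[I'],\,I'\ncong I}|{}_{G}\operatorname{Hom}_{\widetilde{\mathcal A}}(M,I)_{I'}|\,X_{G\oplus I'[-1]}\Big).$$ Here the sums run over isomorphism classes of objects $F,P',G,I'$ of $\widetilde{\mathcal A}$ (only finitely many terms are nonzero, and in these $P'$ is projective and $I'$ is injective).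
   Context: Let $k=\mathbb F_q$ be a finite field and $v=\sqrt q$ (so $q^{1/2}=v$). Let $Q$ be an acyclic valued quiver with vertex set $\{1,\dots,n\}$ and valuations $d_i\in\mathbb N^+$; let $m\ge n$ and let $\widetilde Q$ be a valued quiver obtained from $Q$ by attaching additional vertices $n+1,\dots,m$ with valuations $d_{n+1},\dots,d_m$. Let $\widetilde{\mathfrak S}$ be the $k$-species associated to $\widetilde Q$, identified with its tensor algebra (a finite dimensional hereditary $k$-algebra). $\widetilde{\mathcal A}$ is the category of finite dimensional left $\widetilde{\mathfrak S}$-modules, and $\mathcal P_{\widetilde{\mathcal A}}$, $\mathcal I_{\widetilde{\mathcal A}}$ are its subcategories of projective and injective objects. $S_i$ is the $i$-th simple module, $\mathcal D_i=\operatorname{End}(S_i)$, $\dim_k\mathcal D_i=d_i$. Define $m\times m$ matrices $R=(r_{ij})$, $R'=(r'_{ij})$ by $r_{ij}=\dim_{\mathcal D_i}\operatorname{Ext}^1_{\widetilde{\mathfrak S}}(S_j,S_i)$ and $r'_{ij}=\dim_{\mathcal D_i^{op}}\operatorname{Ext}^1_{\widetilde{\mathfrak S}}(S_i,S_j)$, and set $B=R'-R$, $E=I_m-R'$, $E'=I_m-R$, with $I_m$ the identity matrix. Standing assumption: $\Lambda$ is a skew-symmetric integral $m\times m$ matrix with $\Lambda(-B)=\operatorname{diag}(d_1,\dots,d_m)$. For $\alpha,\beta\in\mathbb Z^m$ (column vectors) write $\Lambda(\alpha,\beta)=\alpha^T\Lambda\beta$, ${}^\ast\alpha=E\alpha$,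 $\alpha^\ast=E'\alpha$. The dimension vector in $\mathbb Z^m$ of a module is denoted by the corresponding lowercase boldface letter ($\mathbf m$ for $M$, $\mathbf i$ for $I$, $\mathbf p$ for $P$, etc.). $\langle\cdot,\cdot\rangle$ is the Euler form on $\mathbb Z^m$: $\langle\mathbf x,\mathbf y\rangle=\dim_k\operatorname{Hom}_{\widetilde{\mathcal A}}(X,Y)-\dim_k\operatorname{Ext}^1_{\widetilde{\mathcal A}}(X,Y)$. $\nu:\mathcal P_{\widetilde{\mathcal A}}\to\mathcal I_{\widetilde{\mathcal A}}$ is the Nakayama functor. For $M,N,X,Y\in\widetilde{\mathcal A}$, ${}_X\operatorname{Hom}_{\widetilde{\mathcal A}}(M,N)_Y=\{f:M\to N\mid \operatorname{Ker}f\cong X,\ \operatorname{Coker}f\cong Y\}$. The quantum torus $\mathcal T_\Lambda$ is the $\mathbb Z[v,v^{-1}]$-algebra with basis $\{X^\alpha\mid\alpha\in\mathbb Z^m\}$ and multiplication $X^\alpha X^\beta=v^{\Lambda(\alpha,\beta)}X^{\alpha+\beta}$. For $M\in\widetilde{\mathcal A}$, $I\in\mathcal I_{\widetilde{\mathcal A}}$, $P\in\mathcal P_{\widetilde{\mathcal A}}$ (shifts taken in $D^b(\widetilde{\mathcal A})$), the quantum cluster character is $$X_{I[-1]\oplus M\oplus P[1]}=\sum_{\mathbf e}v^{\langle\mathbf p-\mathbf e,\mathbf m-\mathbf e-\mathbf i\rangle}|\mathrm{Gr}_{\mathbf e}M|\,X^{(\mathbf p-\mathbf e)^\ast-{}^\ast(\mathbf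 m-\mathbf e-\mathbf i)}\in\mathcal T_\Lambda,$$ where $\mathrm{Gr}_{\mathbf e}M$ is the set of submodules of $M$ with dimension vector $\mathbf e$; any of $I,M,P$ may be zero. *)

(* Defs.v *)
From HB Require Import structures.
From mathcomp Require Import all_boot all_order all_algebra all_field.
From mathcomp Require Import finmap ring.
From mathcomp Require Import boolp classical_sets fsbigop monalg.

Set Implicit Arguments.
Unset Strict Implicit.
Unset Printing Implicit Defensive.

Import GRing.Theory Num.Theory.
Local Open Scope classical_set_scope.
Local Open Scope ring_scope.

Section Laurent.
Variable k : finFieldType.

Definition vroot : algC := sqrtC (#|k|%:R).

(* Z[v, 1/v], v = vroot. *)
Definition laurent_pred : {pred algC} := fun x =>
  `[< exists (p : {poly int}) (n : nat),
        x = (map_poly intr p).[vroot] / vroot ^+ n >].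

Lemma vroot_neq0 : vroot != 0.
Proof. by rewrite sqrtC_eq0 pnatr_eq0 -lt0n; apply/card_gt0P; exists 0. Qed.

Fact laurent_subring : subring_closed laurent_pred.
Proof.
split=> [|x y|x y].
- by apply/asboolP; exists 1, 0%N; rewrite rmorph1 hornerC expr0 divr1.
- move=> /asboolP[p [n ->]] /asboolP[r [l ->]]; apply/asboolP.
  exists (p * 'X^l - r * 'X^n), (n + l)%N.
  rewrite rmorphB !rmorphM /= !map_polyXn !hornerE -mulNr exprD.
  by rewrite addf_div ?expf_neq0 ?vroot_neq0 // mulNr.
- move=> /asboolP[p [n ->]] /asboolP[r [l ->]]; apply/asboolP.
  by exists (p * r), (n + l)%N; rewrite rmorphM /= hornerM exprD -mulf_div.
Qed.

HB.instance Definition _ :=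
  GRing.isSubringClosed.Build algC laurent_pred laurent_subring.

Record laurent := Laurent { laurent_val :> algC; _ : laurent_val \in laurent_pred }.
HB.instance Definition _ := [isSub for laurent_val].
HB.instance Definition _ := [Choice of laurent by <:].
HB.instance Definition _ := [SubChoice_isSubComNzRing of laurent by <:].

Fact vpow_subproof (z : int) : vroot ^ z \in laurent_pred.
Proof.
apply/asboolP; case: z => n.
  by exists 'X^n, 0%N; rewrite map_polyXn hornerXn expr0 divr1.
by exists 1, n.+1; rewrite rmorph1 hornerC mul1r.
Qed.

(* v ^ z; a power q ^ z is vpow (2 * z), and q ^ (z / 2) is vpow z. *)
Definition vpow (z : int) : laurent := Laurent (vpow_subproof z).

Lemma vpow0 : vpow 0 = 1.
Proof. exact/val_inj. Qed.

Lemma vpowD y z : vpow (y + z) = vpow y * vpow z.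
Proof. by apply/val_inj; rewrite /= expfzDr ?vroot_neq0. Qed.

End Laurent.

Definition lam m (L : 'M[int]_m) (a b : 'cV[int]_m) : int := (a^T *m L *m b) 0 0.

Lemma lamDl m (L : 'M[int]_m) a b c : lam L (a + b) c = lam L a c + lam L b c.
Proof. by rewrite /lam linearD /= !mulmxDl mxE. Qed.

Lemma lamDr m (L : 'M[int]_m) a b c : lam L c (a + b) = lam L c a + lam L c b.
Proof. by rewrite /lam mulmxDr mxE. Qed.

Lemma malg_scaleU (R : nzRingType) (K : choiceType) (c d : R) (a : K) :
  c *: << d *g a >> = << c * d *g a >> :> {malg R[K]}.
Proof. by apply/malgP=> b; rewrite mcoeffZ !mcoeffU mulrnAr. Qed.

Definition qtorus (k : finFieldType) m (L : 'M[int]_m) : Type :=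
  {malg (laurent k)['cV[int]_m]}.

Section QuantumTorus.
Variables (k : finFieldType) (m : nat) (L : 'M[int]_m).
Local Notation T := (qtorus k L).
Local Notation Z := (laurent k).

HB.instance Definition _ := GRing.Lmodule.on T.

Definition qX (a : 'cV[int]_m) : T := << a >>.

Lemma scaleqU (c d : Z) a : c *: (<< d *g a >> : T) = << c * d *g a >>.
Proof. exact: malg_scaleU. Qed.

Definition qmul (f g : T) : T :=
  \sum_(a <- msupp f) \sum_(b <- msupp g)
     << f@_a * g@_b * vpow k (lam L a b) *g a + b >>.

Lemma qmulw (d1 d2 : {fset 'cV[int]_m}) (f g : T) :
  (msupp f `<=` d1 -> msupp g `<=` d2 ->
   qmul f g = \sum_(a <- d1) \sum_(b <- d2)
                << f@_a * g@_b * vpow k (lam L a b) *g a + b >>)%fset.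
Proof.
move=> le1 le2; rewrite /qmul (big_fset_incl _ le1) /=.
  apply/eq_bigr=> a _; apply/big_fset_incl => // b _ /mcoeff_outdom ->.
  by rewrite mulr0 mul0r monalgU0.
move=> a _ /mcoeff_outdom fa.
by rewrite big1 // => b _; rewrite fa !mul0r monalgU0.
Qed.

Lemma qmulUU (c d : Z) a b :
  qmul << c *g a >> << d *g b >> = << c * d * vpow k (lam L a b) *g a + b >>.
Proof. by rewrite (qmulw msuppU_le msuppU_le) !big_seq_fset1 !mcoeffUU. Qed.

Lemma qmulDl : left_distributive qmul +%R.
Proof.
move=> f1 f2 g; rewrite (qmulw (msuppD_le _ _) (fsubset_refl _)).
rewrite (qmulw (fsubsetUl _ (msupp f2)) (fsubset_refl (msupp g))).
rewrite (qmulw (fsubsetUr (msupp f1) _) (fsubset_refl (msupp g))).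
rewrite -big_split /=; apply/eq_bigr=> a _.
rewrite -big_split /=; apply/eq_bigr=> b _.
by rewrite mcoeffD !mulrDl monalgUD.
Qed.

Lemma qmulDr : right_distributive qmul +%R.
Proof.
move=> g f1 f2; rewrite (qmulw (fsubset_refl _) (msuppD_le _ _)).
rewrite (qmulw (fsubset_refl (msupp g)) (fsubsetUl _ (msupp f2))).
rewrite (qmulw (fsubset_refl (msupp g)) (fsubsetUr (msupp f1) _)).
rewrite -big_split /=; apply/eq_bigr=> a _.
rewrite -big_split /=; apply/eq_bigr=> b _.
by rewrite mcoeffD mulrDr mulrDl monalgUD.
Qed.

Lemma qmul0l : left_zero 0 qmul.
Proof. by move=> g; rewrite /qmul msupp0 big_seq_fset0. Qed.

Lemma qmul0r : right_zero 0 qmul.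
Proof.
by move=> g; rewrite /qmul big1 // => a _; rewrite msupp0 big_seq_fset0.
Qed.

Lemma qmul_suml I (r : seq I) (F : I -> T) g :
  qmul (\sum_(i <- r) F i) g = \sum_(i <- r) qmul (F i) g.
Proof. exact: (big_morph (qmul^~ g) (fun _ _ => qmulDl _ _ _) (qmul0l g)). Qed.

Lemma qmul_sumr I (r : seq I) (F : I -> T) g :
  qmul g (\sum_(i <- r) F i) = \sum_(i <- r) qmul g (F i).
Proof. exact: (big_morph (qmul g) (fun _ _ => qmulDr _ _ _) (qmul0r g)). Qed.

Lemma qtorus_ind (P : T -> Prop) :
  (forall c a, P << c *g a >>) -> (forall f g, P f -> P g -> P (f + g)) ->
  P 0 -> forall f, P f.
Proof. by move=> PU PD P0 f; rewrite [f]monalgE; elim/big_ind: _. Qed.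

Lemma assoc_ext (V : zmodType) (op : V -> V -> V) (P : V -> Prop) :
  left_distributive op +%R -> right_distributive op +%R ->
  left_zero 0 op -> right_zero 0 op ->
  (forall Q : V -> Prop, (forall x, P x -> Q x) ->
     (forall x y, Q x -> Q y -> Q (x + y)) -> Q 0 -> forall x, Q x) ->
  (forall x y z, P x -> P y -> P z -> op x (op y z) = op (op x y) z) ->
  associative op.
Proof.
move=> Dl Dr Zl Zr ind PA x y z.
elim/ind: x => [x Px|x x' Ix Ix'|]; [|by rewrite !Dl Ix Ix'|by rewrite !Zl].
elim/ind: y => [y Py|y y' Iy Iy'|]; [|by rewrite !(Dl, Dr) Iy Iy'|by rewrite Zl Zr Zl].
by elim/ind: z => [z Pz|z z' Iz Iz'|]; [exact: PA|rewrite !Dr Iz Iz'|rewrite !Zr].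
Qed.

Lemma qmulA : associative qmul.
Proof.
apply: (@assoc_ext T qmul (fun f => exists c a, f = << c *g a >>)
  qmulDl qmulDr qmul0l qmul0r) => [Q QU QD Q0|f g h].
  by apply: qtorus_ind => // c a; apply: QU; exists c, a.
move=> [c [a ->]] [d [b ->]] [e [l ->]].
rewrite (qmulUU d e b l) (qmulUU c d a b) (qmulUU c _ a) (qmulUU _ e (a + b)).
by rewrite addrA lamDl lamDr !vpowD; congr << _ *g _ >>; ring.
Qed.

Lemma qmul1l : left_id (qX 0) qmul.
Proof.
move=> f; elim/qtorus_ind: f => [c a|f f' If If'|]; last exact: qmul0r.
  by rewrite qmulUU /lam trmx0 !mul0mx mxE vpow0 mulr1 mul1r add0r.
by rewrite qmulDr If If'.
Qed.

Lemma qmul1r : right_id (qX 0) qmul.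
Proof.
move=> f; elim/qtorus_ind: f => [c a|f f' If If'|]; last exact: qmul0l.
  by rewrite qmulUU /lam !mulmx0 mxE vpow0 !mulr1 addr0.
by rewrite qmulDl If If'.
Qed.

Lemma qone_neq0 : qX 0 != 0.
Proof. by rewrite /qX monalgU_eq0 oner_eq0. Qed.

HB.instance Definition _ := GRing.Zmodule_isNzRing.Build T
  qmulA qmul1l qmul1r qmulDl qmulDr qone_neq0.

Lemma scale_ext (R : nzRingType) (V : lmodType R) (op : V -> V -> V)
    (P : V -> Prop) (c : R) :
  left_distributive op +%R -> right_distributive op +%R ->
  left_zero 0 op -> right_zero 0 op ->
  (forall Q : V -> Prop, (forall x, P x -> Q x) ->
     (forall x y, Q x -> Q y -> Q (x + y)) -> Q 0 -> forall x, Q x) ->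
  (forall x y, P x -> P y -> c *: op x y = op (c *: x) y
                          /\ c *: op x y = op x (c *: y)) ->
  forall x y, c *: op x y = op (c *: x) y /\ c *: op x y = op x (c *: y).
Proof.
move=> Dl Dr Zl Zr ind PA x y.
elim/ind: x => [x Px|x x' [I1 I2] [J1 J2]|]; last by rewrite !(Zl, scaler0).
  elim/ind: y => [y Py|y y' [I1 I2] [J1 J2]|]; first exact: PA.
    by rewrite !Dr !scalerDr !Dr -I1 -J1 -I2 -J2.
  by rewrite !(Zr, scaler0).
by rewrite Dl !scalerDr !Dl -I1 -J1 -I2 -J2.
Qed.

Lemma qscaleA (c : Z) (f g : T) :
  c *: qmul f g = qmul (c *: f) g /\ c *: qmul f g = qmul f (c *: g).
Proof.
move: f g; apply: (@scale_ext _ T qmul (fun f => exists c a, f = << c *g a >>)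
  c qmulDl qmulDr qmul0l qmul0r) => [Q QU QD Q0|f g].
  by apply: qtorus_ind => // d a; apply: QU; exists d, a.
move=> [d [a ->]] [e [b ->]].
have E := etrans (congr1 ( *:%R c) (qmulUU d e a b)) (scaleqU c _ (a + b)).
have El := etrans (congr1 (qmul^~ _) (scaleqU c d a)) (qmulUU (c * d) e a b).
have Er := etrans (congr1 (qmul _) (scaleqU c e b)) (qmulUU d (c * e) a b).
split; [apply: etrans E (etrans _ (esym El))|apply: etrans E (etrans _ (esym Er))].
  by congr << _ *g _ >>; ring.
by congr << _ *g _ >>; ring.
Qed.

HB.instance Definition _ :=
  GRing.Lmodule_isLalgebra.Build Z T (fun c f g => (qscaleA c f g).1).
HB.instance Definition _ :=
  GRing.Lalgebra_isAlgebra.Build Z T (fun c f g => (qscaleA c f g).2).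

Lemma qXM a b : qX a * qX b = vpow k (lam L a b) *: qX (a + b).
Proof. by rewrite [LHS]qmulUU /qX scaleqU !mulr1 mul1r. Qed.

End QuantumTorus.

Record valued_quiver (m : nat) := ValuedQuiver {
  valuation : 'I_m -> nat;
  arrows : 'I_m -> 'I_m -> nat;
  valuation_gt0 : forall i, (0 < valuation i)%N }.

Definition acyclic m (Q : valued_quiver m) : Prop :=
  forall s : seq 'I_m, s != [::] -> ~~ cycle (fun i j => 0 < arrows Q i j)%N s.

(* Q is the full valued subquiver of Qt on the first n vertices. *)
Definition attached n m (le_nm : (n <= m)%N)
    (Q : valued_quiver n) (Qt : valued_quiver m) : Prop :=
  (forall i, valuation Qt (widen_ord le_nm i) = valuation Q i) /\
  (forall i j, arrows Qt (widen_ord le_nm i) (widen_ord le_nm j) = arrows Q i j).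

(* sp_arr i j is a sp_div j - sp_div i - bimodule: it carries the arrows from
   i to j, and acts by maps sp_arr i j (x) V_i -> V_j on left modules. *)
Record species (k : fieldType) (m : nat) := Species {
  sp_div : 'I_m -> falgType k;
  sp_arr : 'I_m -> 'I_m -> vectType k;
  sp_l : forall i j, sp_div j -> sp_arr i j -> sp_arr i j;
  sp_r : forall i j, sp_arr i j -> sp_div i -> sp_arr i j;
  sp_divP : forall i (a : sp_div i), a != 0 -> a \is a GRing.unit;
  sp_l1 : forall i j (x : sp_arr i j), sp_l 1 x = x;
  sp_lM : forall i j a b (x : sp_arr i j), sp_l (a * b) x = sp_l a (sp_l b x);
  sp_lPl : forall i j (c : k) a b (x : sp_arr i j),
    sp_l (c *: a + b) x = c *: sp_l a x + sp_l b x;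
  sp_lPr : forall i j (c : k) a (x y : sp_arr i j),
    sp_l a (c *: x + y) = c *: sp_l a x + sp_l a y;
  sp_r1 : forall i j (x : sp_arr i j), sp_r x 1 = x;
  sp_rM : forall i j a b (x : sp_arr i j), sp_r x (a * b) = sp_r (sp_r x a) b;
  sp_rPl : forall i j (c : k) a (x y : sp_arr i j),
    sp_r (c *: x + y) a = c *: sp_r x a + sp_r y a;
  sp_rPr : forall i j (c : k) a b (x : sp_arr i j),
    sp_r x (c *: a + b) = c *: sp_r x a + sp_r x b;
  sp_lr : forall i j a b (x : sp_arr i j), sp_l a (sp_r x b) = sp_r (sp_l a x) b }.

(* Over a finite field with subfields F_d of degree d, one arrow i -> j
   contributes F_(d_j) (x)_(F_g) F_(d_i), g = gcd(d_i, d_j), of dimension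
   lcm(d_i, d_j); every bimodule has dimension a multiple of this lcm. *)
Definition species_of (k : fieldType) m (Q : valued_quiver m) (S : species k m)
    : Prop :=
  (forall i, \dim {: sp_div S i} = valuation Q i) /\
  (forall i j, \dim {: sp_arr S i j} =
     (arrows Q i j * lcmn (valuation Q i) (valuation Q j))%N).

(* An algebra map from prod_i sp_div i to C, given by its components, together
   with a compatible bimodule map from the sum of the sp_arr i j to C. *)
Record species_map (k : fieldType) m (S : species k m) (C : algType k) :=
  SpeciesMap {
    sm_div : forall i, {linear sp_div S i -> C};
    sm_arr : forall i j, {linear sp_arr S i j -> C};
    sm_divM : forall i a b, sm_div i (a * b) = sm_div i a * sm_div i b;
    sm_orth : forall i j a b, i != j -> sm_div i a * sm_div j b = 0;
    sm_sum1 : \sum_i sm_div i 1 = 1;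
    sm_l : forall i j a x, sm_arr i j (sp_l a x) = sm_div j a * sm_arr i j x;
    sm_r : forall i j a x, sm_arr i j (sp_r x a) = sm_arr i j x * sm_div i a }.

Definition sm_factors (k : fieldType) m (S : species k m) (A C : algType k)
    (f : species_map S A) (g : species_map S C) (phi : {lrmorphism A -> C})
    : Prop :=
  (forall i a, phi (sm_div f i a) = sm_div g i a) /\
  (forall i j x, phi (sm_arr f i j x) = sm_arr g i j x).

(* The tensor algebra of S, given by its universal property; being an falgType
   it is finite-dimensional. *)
Record tensor_algebra (k : fieldType) m (S : species k m) := TensorAlgebra {
  ta_alg :> falgType k;
  ta_map : species_map S ta_alg;
  ta_univ : forall (C : algType k) (g : species_map S C),
    exists2 phi : {lrmorphism ta_alg -> C}, sm_factors ta_map g phi &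
      forall psi : {lrmorphism ta_alg -> C}, sm_factors ta_map g psi ->
        phi =1 psi }.

(* A left A-module structure on the space of column vectors. *)
Record fdmod (k : fieldType) (A : algType k) := FdMod {
  mdim : nat;
  mact : {lrmorphism A -> 'M[k]_mdim} }.

HB.instance Definition _ (k : fieldType) (A : algType k) := gen_eqMixin (fdmod A).
HB.instance Definition _ (k : fieldType) (A : algType k) :=
  gen_choiceMixin (fdmod A).

Section Modules.
Variables (k : fieldType) (A : algType k).
Implicit Types X Y M N P I : fdmod A.

Definition is_hom X Y (f : 'M[k]_(mdim Y, mdim X)) : Prop :=
  forall a, f *m mact X a = mact Y a *m f.

Definition iso X Y : Prop :=
  exists (f : 'M[k]_(mdim Y, mdim X)) (g : 'M[k]_(mdim X, mdim Y)),
    [/\ is_hom f, is_hom g, g *m f = 1%:M & f *m g = 1%:M].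

(* A module chosen in each isomorphism class, and the set of these choices. *)
Definition isorep X : fdmod A := xget X [set Y | iso X Y].
Definition iso_classes : set (fdmod A) := [set X | isorep X = X].

Definition monic X Y (f : 'M[k]_(mdim Y, mdim X)) : Prop :=
  is_hom f /\ injective (fun x : 'cV_(mdim X) => f *m x).

Definition epic X Y (f : 'M[k]_(mdim Y, mdim X)) : Prop :=
  is_hom f /\ forall y : 'cV_(mdim Y), exists x : 'cV_(mdim X), f *m x = y.

Definition ker_iso M N (f : 'M[k]_(mdim N, mdim M)) X : Prop :=
  exists2 i : 'M[k]_(mdim M, mdim X), monic i &
    forall x : 'cV_(mdim M), f *m x = 0 <-> exists y, i *m y = x.

Definition coker_iso M N (f : 'M[k]_(mdim N, mdim M)) Y : Prop :=
  exists2 p : 'M[k]_(mdim Y, mdim N), epic p &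
    forall y : 'cV_(mdim N), p *m y = 0 <-> exists x, f *m x = y.

Definition projective P : Prop :=
  forall X Y (g : 'M[k]_(mdim Y, mdim X)) (h : 'M[k]_(mdim Y, mdim P)),
    epic g -> is_hom h ->
    exists2 l : 'M[k]_(mdim X, mdim P), is_hom l & g *m l = h.

Definition injective_mod I : Prop :=
  forall X Y (g : 'M[k]_(mdim Y, mdim X)) (h : 'M[k]_(mdim I, mdim X)),
    monic g -> is_hom h ->
    exists2 l : 'M[k]_(mdim I, mdim Y), is_hom l & l *m g = h.

Definition stable M (U : set 'cV[k]_(mdim M)) : Prop :=
  [/\ U 0, forall x y, U x -> U y -> U (x + y) &
      forall a x, U x -> U (mact M a *m x)].

Definition simple_mod M : Prop :=
  (0 < mdim M)%N /\
  forall U : set 'cV[k]_(mdim M), stable U -> U = [set 0] \/ U = setT.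

End Modules.

Arguments iso_classes {k} A.

(* The rank of Z / B over a ring K of scalars acting on it. *)
Definition rank_over (E : Type) (V : zmodType) (K : set E) (act : E -> V -> V)
    (Z B : set V) : nat :=
  xget 0%N [set r : nat | exists2 w : 'I_r -> V, (forall l, Z (w l)) &
    forall z, Z z -> exists! c : {ffun 'I_r -> E},
      (forall l, K (c l)) /\ B (z - \sum_l act (c l) (w l))].

Section HomExt.
Variables (k : fieldType) (A : falgType k).
Implicit Types X Y : fdmod A.

Definition homdim X Y : nat :=
  rank_over setT *:%R [set f : 'M[k]_(mdim Y, mdim X) | is_hom f] [set 0].

(* Ext^1(X, Y) = ext_cocycle / ext_coboundary: a cocycle d is the extension
   of X by Y on the column space k^(dim Y + dim X) on which a acts by the block
   matrix (mact Y a, d a; 0, mact X a), and Baer sum is addition.  An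
   equivalence of extensions is conjugation by a block matrix (1, h; 0, 1). *)
Definition ext_cocycle X Y : set 'Hom(A, 'M[k]_(mdim Y, mdim X)) :=
  [set d | forall a b, d (a * b) = mact Y a *m d b + d a *m mact X b].

Definition ext_coboundary X Y : set 'Hom(A, 'M[k]_(mdim Y, mdim X)) :=
  [set d | exists h : 'M[k]_(mdim Y, mdim X),
     forall a, d a = mact Y a *m h - h *m mact X a].

Definition extdim X Y : nat :=
  rank_over setT *:%R (@ext_cocycle X Y) (@ext_coboundary X Y).

(* The ranks over End Y and over the opposite of End X. *)
Definition extdim_left X Y : nat :=
  rank_over [set f : 'M[k]_(mdim Y) | @is_hom k A Y Y f]
    (fun f (d : 'Hom(A, 'M[k]_(mdim Y, mdim X))) => linfun (fun a => f *m d a))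
    (@ext_cocycle X Y) (@ext_coboundary X Y).

Definition extdim_right X Y : nat :=
  rank_over [set f : 'M[k]_(mdim X) | @is_hom k A X X f]
    (fun f (d : 'Hom(A, 'M[k]_(mdim Y, mdim X))) => linfun (fun a => d a *m f))
    (@ext_cocycle X Y) (@ext_coboundary X Y).

End HomExt.

Section Nakayama.
Variables (k : fieldType) (A : falgType k) (P : fdmod A).

Definition regdef (a : A) (f : 'Hom('cV[k]_(mdim P), A)) :
    'Hom('cV[k]_(mdim P), A) :=
  (f \o linfun (mulmx (mact P a)))%VF - (amull a \o f)%VF.

Lemma regdefE a f x : regdef a f x = f (mact P a *m x) - a * f x.
Proof. by rewrite /regdef add_lfunE opp_lfunE !comp_lfunE !lfunE. Qed.

Fact regdef_linear a : linear (regdef a).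
Proof.
move=> c f g; apply/lfunP=> x.
apply: etrans (esym (add_lfunE (c *: regdef a f) (regdef a g) x)).
rewrite (scale_lfunE c (regdef a f) x) !regdefE !add_lfunE !scale_lfunE.
by rewrite scalerBr mulrDr opprD addrACA scalerAr.
Qed.

HB.instance Definition _ a := GRing.isLinear.Build k
  'Hom('cV[k]_(mdim P), A) 'Hom('cV[k]_(mdim P), A) _ (regdef a) (regdef_linear a).

(* Hom_A(P, A), see hom_regP. *)
Definition hom_reg : {vspace 'Hom('cV[k]_(mdim P), A)} :=
  (\bigcap_(i < \dim {: A}) lker (linfun (regdef (vbasis {: A})`_i)))%VS.

Lemma hom_regP (f : 'Hom('cV[k]_(mdim P), A)) :
  reflect (forall a x, f (mact P a *m x) = a * f x) (f \in hom_reg).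
Proof.
apply: (iffP idP) => [fH a x|fH]; last first.
  rewrite memvE; apply/subv_bigcapP=> i _; rewrite -memvE memv_ker lfunE /=.
  by apply/eqP/lfunP=> x; rewrite regdefE fH subrr zero_lfunE.
have B i : f (mact P (vbasis {: A})`_i *m x) = (vbasis {: A})`_i * f x
           \/ (\dim {: A} <= i)%N.
  have [|lt_i] := leqP (\dim {: A}) i; [by right|left].
  move: fH; rewrite memvE => /subv_bigcapP/(_ (Ordinal lt_i) isT).
  by rewrite -memvE memv_ker lfunE => /eqP/lfunP/(_ x); rewrite regdefE zero_lfunE
    => /eqP; rewrite subr_eq0 => /eqP.
rewrite [in LHS](coord_vbasis (memvf a)) [in RHS](coord_vbasis (memvf a)).
rewrite linear_sum mulmx_suml linear_sum mulr_suml; apply: eq_bigr => i _.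
rewrite linearZ -scalemxAl linearZ -scalerAl; congr (_ *: _).
by case: (B i) => //; rewrite leqNgt ltn_ord.
Qed.

Lemma hom_regM (f : 'Hom('cV[k]_(mdim P), A)) a : f \in hom_reg -> (amulr a \o f)%VF \in hom_reg.
Proof.
move=> /hom_regP fH; apply/hom_regP=> b x.
by rewrite !comp_lfunE fH !lfunE /= mulrA.
Qed.

(* Hom_A(P, A) is a right A-module by (f a)(x) = f(x) a.  The (i, j) entry is
   the j-th coordinate of b_i a, where the b_i form a basis of Hom_A(P, A); on
   the columns (xi (b_i))_i, for xi in the dual of Hom_A(P, A), this matrix acts
   by (a xi)(f) = xi (f a). *)
Definition nu_act (a : A) : 'M[k]_(\dim hom_reg) :=
  \matrix_(i, j) coord (vbasis hom_reg) j (amulr a \o (vbasis hom_reg)`_i)%VF.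

Fact nu_act_linear : linear nu_act.
Proof.
move=> c a b; apply/matrixP=> i j; rewrite !mxE.
rewrite (_ : (amulr _ \o _)%VF =
  c *: (amulr a \o (vbasis hom_reg)`_i)%VF + (amulr b \o (vbasis hom_reg)`_i)%VF).
  by rewrite linearP.
apply/lfunP=> x; rewrite !(add_lfunE, scale_lfunE, comp_lfunE, lfunE) /=.
by rewrite mulrDr -scalerAr.
Qed.

Fact nu_act_monoid : monoid_morphism nu_act.
Proof.
have bH i : (i < \dim hom_reg)%N -> (vbasis hom_reg)`_i \in hom_reg.
  by move=> lt_i; apply/vbasis_mem/mem_nth; rewrite size_tuple.
split=> [|a b]; apply/matrixP=> i j; rewrite !mxE.
  rewrite (_ : (amulr _ \o _)%VF = (vbasis hom_reg)`_i).
    by rewrite coord_free ?(basis_free (vbasisP _)) // eq_sym.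
  by apply/lfunP=> x; rewrite comp_lfunE lfunE /= mulr1.
under eq_bigr do rewrite !mxE.
rewrite (_ : (amulr (a * b) \o _)%VF =
  (amulr b \o (amulr a \o (vbasis hom_reg)`_i))%VF); last first.
  by apply/lfunP=> x; rewrite !comp_lfunE !lfunE /= mulrA.
rewrite [in LHS](coord_vbasis (hom_regM a (bH i (ltn_ord i)))).
rewrite (big_morph _ (comp_lfunDr (amulr b)) (comp_lfun0r _ _)) linear_sum.
by apply: eq_bigr => l _; rewrite -comp_lfunZr linearZ.
Qed.

HB.instance Definition _ := GRing.isLinear.Build k A 'M[k]_(\dim hom_reg) _
  nu_act nu_act_linear.
HB.instance Definition _ := GRing.isMonoidMorphism.Build A 'M[k]_(\dim hom_reg)
  nu_act nu_act_monoid.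

(* D Hom_A(P, A), with D = Hom_k(-, k) *)
Definition nakayama : fdmod A := FdMod nu_act.

End Nakayama.

Section ClusterCharacter.
Variables (k : finFieldType) (m : nat) (S : species k m) (T : tensor_algebra S).
Implicit Types (M N X Y P I : fdmod T) (x y : 'cV[int]_m).

(* The i-th entry is the rank over sp_div S i of e_i U, e_i = sm_div i 1. *)
Definition dimvec_sub M (U : set 'cV[k]_(mdim M)) : 'cV[int]_m :=
  \col_i (rank_over setT (fun a u => mact M (sm_div (ta_map T) i a) *m u)
            ((fun u => mact M (sm_div (ta_map T) i 1) *m u) @` U) [set 0])%:Z.

Definition dimvec M : 'cV[int]_m := @dimvec_sub M setT.

(* S_i: the simple module M with e_i M <> 0 *)
Definition vertex_simple (i : 'I_m) M : Prop :=
  simple_mod M /\ mact M (sm_div (ta_map T) i 1) <> 0.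

(* The Gram matrix of the Euler form; being characterized on dimension vectors
   of modules, which span Z^m, it is unique. *)
Definition euler_mx : 'M[int]_m :=
  xget 0 [set b | forall X Y,
    ((dimvec X)^T *m b *m dimvec Y) 0 0 = (homdim X Y)%:Z - (extdim X Y)%:Z].

Definition euler x y : int := (x^T *m euler_mx *m y) 0 0.

Definition Rmx (s : 'I_m -> fdmod T) : 'M[int]_m :=
  \matrix_(i, j) (extdim_left (s j) (s i))%:Z.

Definition R'mx (s : 'I_m -> fdmod T) : 'M[int]_m :=
  \matrix_(i, j) (extdim_right (s i) (s j))%:Z.

Definition Gr M (e : 'cV[int]_m) : nat :=
  #|[pred U : {set 'cV[k]_(mdim M)} |
      `[< stable [set u | u \in U] /\ dimvec_sub [set u | u \in U] = e >]]|.

Definition hom_ker_coker X M N Y : nat :=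
  #|[pred f : 'M[k]_(mdim N, mdim M) |
      `[< [/\ is_hom f, ker_iso f X & coker_iso f Y] >]]|.

Fact zero_act_linear : linear (fun _ : T => 0 : 'M[k]_0).
Proof. by move=> c a b; rewrite scaler0 addr0. Qed.

Fact zero_act_monoid : monoid_morphism (fun _ : T => 0 : 'M[k]_0).
Proof. by split=> [|a b]; apply/matrixP; case. Qed.

Definition zero_act (_ : T) : 'M[k]_0 := 0.
HB.instance Definition _ :=
  GRing.isLinear.Build k T 'M[k]_0 _ zero_act zero_act_linear.
HB.instance Definition _ :=
  GRing.isMonoidMorphism.Build T 'M[k]_0 zero_act zero_act_monoid.

Definition zero_mod : fdmod T := FdMod zero_act.

Section Torus.
Variables (s : 'I_m -> fdmod T) (L : 'M[int]_m).

Definition lstar x : 'cV[int]_m := (1%:M - R'mx s) *m x.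
Definition rstar x : 'cV[int]_m := (1%:M - Rmx s) *m x.

(* X_(I[-1] + M + P[1]) *)
Definition qcc I M P : qtorus k L :=
  \sum_(e \in classical_sets.setT)
    (vpow k (euler (dimvec P - e) (dimvec M - e - dimvec I)) * (Gr M e)%:R) *:
      qX k L (rstar (dimvec P - e) - lstar (dimvec M - e - dimvec I)).

Definition sum_shift P M : qtorus k L :=
  \sum_(FP \in iso_classes T `*` (iso_classes T `&` [set P' | ~ iso P' P]))
    (hom_ker_coker FP.2 P M FP.1)%:R *: qcc zero_mod FP.1 FP.2.

Definition sum_unshift M I : qtorus k L :=
  \sum_(GI \in iso_classes T `*` (iso_classes T `&` [set I' | ~ iso I' I]))
    (hom_ker_coker GI.1 M I GI.2)%:R *: qcc GI.2 GI.1 zero_mod.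

End Torus.

End ClusterCharacter.

(* Main.v *)
(* Everything is counted through dimensions.

   Since T is the tensor algebra of S, a derivation of T is determined by its
   values on prod_i D_i and on the arrows; averaging over the finite groups D_i^*
   makes it vanish on prod_i D_i up to an inner derivation, and this gives
     hom(X, Y) - ext(X, Y) = sum_i d_i x_i y_i - sum_(i, j) dim(S_ij) x_i y_j.
   Acyclicity forces dimvec S_i to be the i-th unit vector, so the Gram matrix b
   of the Euler form satisfies b = D E and b^T = D E', D = diag(d_i).

   For P projective and I = nu P one has <p, x> = <x, i>, hence p^* = ^*i.  In
   sum_shift, the summand of f : P -> M is a sum over the submodules of
   coker f, that is over the submodules U of M containing im f; exchanging the
   sums, U occurs |Hom(P, U)| - 1 = q^<p, u> - 1 times.  Dually, in sum_unshift
   U occurs |Hom(M/U, I)| - 1 = q^<m - u, i> - 1 times.  Both equations then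
   hold term by term in U, by Lambda(p^*, B w) = - <p, w>. *)
Require Import Defs.
From HB Require Import structures.
From mathcomp Require Import all_boot all_order all_algebra all_field.
From mathcomp Require Import finmap ring.
From mathcomp Require Import boolp classical_sets fsbigop monalg.

Set Implicit Arguments.
Unset Strict Implicit.
Unset Printing Implicit Defensive.

Import GRing.Theory Num.Theory.
Local Open Scope classical_set_scope.
Local Open Scope ring_scope.

(** * Dimensions of linear sets, ranks over division algebras *)

Section LinearSets.
Variable k : fieldType.

(** Dimension vectors, the entries of R and R', and the numbers hom and ext are all ranks picked by
    a choice operator, so nothing is known of them until a basis is shown to exist and its length to
    be forced. [rank_overE] settles all cases at once: rank times the k-dimension of the scalars is
    a k-dimension. Ranks are therefore compared only after multiplication by a positive dimension,
    where rank-nullity is available. The Gram matrix of the Euler form is chosen as well; an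
    explicit matrix shows that the choice does not fall back on its default.

    The terms match because p^* = ^*i gives U the same monomial in the product and in both sums,
    which leaves an identity between powers of v. With a = <p, m>, b = <p, u> and c = <u, m - u>,
    the first equation rests on v^(a-b-c) (v^(2b) - 1) + v^(-a) v^(b-c) (v^(2(a-b)) - 1) = v^(b-a-c)
    (v^(2a) - 1), where the two terms v^(a-b-c) cancel; the half power of q in front of one of the
    sums is what makes them equal. The duality <p, x> = <x, i> is obtained from modules only for
    simple x and then extended by linearity, since u and m - u enter as mere vectors. *)

Definition lin_closed (V : lmodType k) (Z : set V) : Prop :=
  Z 0 /\ forall c x y, Z x -> Z y -> Z (c *: x + y).

(** Homomorphisms, cocycles and submodules are given as sets of type Prop; this gives access to the
    dimension theory of subspaces. For linear sets the default is never reached, by [vspP]. *)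
Definition vspace_of_set (V : vectType k) (Z : set V) : {vspace V} :=
  xget 0%VS [set U : {vspace V} | forall v, v \in U <-> Z v].

Definition sdim (V : vectType k) (Z : set V) : nat := \dim (vspace_of_set Z).

Lemma lin_closedN (V : lmodType k) (Z : set V) x : lin_closed Z -> Z x -> Z (- x).
Proof. by case=> Z0 ZP Zx; rewrite -[- x]addr0 -scaleN1r; apply: ZP. Qed.

Lemma lin_closedD (V : lmodType k) (Z : set V) x y :
  lin_closed Z -> Z x -> Z y -> Z (x + y).
Proof. by case=> Z0 ZP Zx Zy; rewrite -[x]scale1r; apply: ZP. Qed.

Lemma lin_closedB (V : lmodType k) (Z : set V) x y :
  lin_closed Z -> Z x -> Z y -> Z (x - y).
Proof. by move=> ZP Zx Zy; apply: lin_closedD => //; apply: lin_closedN. Qed.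

Lemma lin_closedZ (V : lmodType k) (Z : set V) c x :
  lin_closed Z -> Z x -> Z (c *: x).
Proof. by case=> Z0 ZP Zx; rewrite -[_ *: _]addr0; apply: ZP. Qed.

Lemma lin_closed_sum (V : lmodType k) (Z : set V) I (r : seq I) (P : pred I) F :
  lin_closed Z -> (forall i, P i -> Z (F i)) -> Z (\sum_(i <- r | P i) F i).
Proof.
by move=> ZP ZF; elim/big_ind: _ => // [|x y]; [case: ZP|apply: lin_closedD].
Qed.

Lemma lin_closedT (V : lmodType k) : lin_closed [set: V]. Proof. by []. Qed.

Lemma lin_closed0 (V : lmodType k) : lin_closed [set 0 : V].
Proof. by split=> // c x y -> ->; rewrite scaler0 addr0. Qed.

Lemma lin_closed_vs (V : vectType k) (U : {vspace V}) : lin_closed [set v | v \in U].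
Proof. by split=> [|c x y] /=; rewrite ?mem0v // => xU yU; rewrite memvD ?memvZ. Qed.

(** A subspace contained in Z but different from Z can be enlarged by a line inside Z, and the
    dimension of V bounds the number of enlargements. *)
Lemma vspP (V : vectType k) (Z : set V) v : lin_closed Z -> v \in vspace_of_set Z <-> Z v.
Proof.
move=> Zcl; have [Z0 ZP] := Zcl; rewrite /vspace_of_set; case: xgetP => [U _ ->|nU] //.
suff: exists U : {vspace V}, forall v, v \in U <-> Z v by case=> U /nU.
suff step n : (exists U : {vspace V}, forall v, v \in U <-> Z v) \/
    exists2 U : {vspace V}, (forall v, v \in U -> Z v) & (n <= \dim U)%N.
  case: (step (\dim {: V}).+1) => // -[U _]; rewrite leqNgt.
  by rewrite ltnS dimvS // subvf.
elim: n => [|n [|[U UZ le_nU]]]; [right|by left|].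
  by exists 0%VS => // w; rewrite memv0 => /eqP->.
have [|/existsNP[w /not_implyP[Zw wU]]] := pselect (forall v, Z v -> v \in U).
  by left; exists U => w; split; auto.
right; exists (U + <[w]>)%VS => [x /memv_addP[u uU [y /vlineP[c ->] ->]]|].
  by rewrite addrC; apply: ZP => //; apply: UZ.
rewrite dimv_disjoint_sum ?dim_vline.
  by case: eqP wU => [->|_ _]; [rewrite mem0v|rewrite addn1].
apply/eqP; rewrite -subv0; apply/subvP=> x /memv_capP[xU /vlineP[c xE]].
have [c0|c0] := eqVneq c 0; first by rewrite xE c0 scale0r mem0v.
by case: wU; rewrite -[w](scalerK c0) -xE memvZ.
Qed.

Lemma vsp_vs (V : vectType k) (U : {vspace V}) : vspace_of_set [set v | v \in U] = U.
Proof.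
by apply/vspaceP => v; apply/idP/idP => /(vspP _ (lin_closed_vs U)).
Qed.

Lemma sdim_vs (V : vectType k) (U : {vspace V}) : sdim [set v | v \in U] = \dim U.
Proof. by rewrite /sdim vsp_vs. Qed.

Lemma sdimT (V : vectType k) : sdim [set: V] = \dim {: V}.
Proof.
by rewrite -sdim_vs; congr sdim; apply/seteqP; split=> v //= _; rewrite memvf.
Qed.

Lemma sdim0 (V : vectType k) : sdim [set 0 : V] = 0%N.
Proof.
rewrite -[RHS](dimv0 V) -sdim_vs; congr sdim.
by apply/seteqP; split=> v /=; rewrite memv0 => /eqP.
Qed.

Lemma sdim_le (V : vectType k) (Z Z' : set V) :
  lin_closed Z -> lin_closed Z' -> Z `<=` Z' -> (sdim Z <= sdim Z')%N.
Proof.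
move=> Zc Zc' ZZ'; apply/dimvS/subvP => v /(vspP _ Zc)/ZZ' Zv.
exact/(vspP _ Zc').
Qed.

Lemma sdim_eq (V : vectType k) (Z Z' : set V) :
  lin_closed Z -> lin_closed Z' -> Z `<=` Z' -> (sdim Z' <= sdim Z)%N -> Z = Z'.
Proof.
move=> Zc Zc' ZZ' le; apply/seteqP; split=> // v /(vspP _ Zc') Zv.
apply/(vspP _ Zc); suff -> : vspace_of_set Z = vspace_of_set Z' by [].
apply/eqP; rewrite eqEdim; apply/andP; split => //.
by apply/subvP => u /(vspP _ Zc)/ZZ' Zu; apply/(vspP _ Zc').
Qed.

Lemma sdim_eq0 (V : vectType k) (Z : set V) :
  lin_closed Z -> sdim Z = 0%N -> Z = [set 0].
Proof.
move=> Zc Z0; apply/esym/(sdim_eq (lin_closed0 V) Zc); last by rewrite Z0.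
by move=> v ->; case: Zc.
Qed.

Lemma lin_closed_im (V W : lmodType k) (f : V -> W) (Z : set V) :
  linear f -> lin_closed Z -> lin_closed (f @` Z).
Proof.
move=> fL Zc; have f0 : f 0 = 0.
  by have := fL (-1) 0 0; rewrite scaler0 addr0 scaleN1r addNr.
split=> [|c _ _ [x Zx <-] [y Zy <-]]; first by exists 0 => //; case: Zc.
by exists (c *: x + y); [case: Zc => _; apply|rewrite fL].
Qed.

Lemma lin_closed_ker (V W : lmodType k) (f : V -> W) (Z : set V) :
  linear f -> lin_closed Z -> lin_closed [set v | Z v /\ f v = 0].
Proof.
move=> fL Zc; have f0 : f 0 = 0.
  by have := fL (-1) 0 0; rewrite scaler0 addr0 scaleN1r addNr.
split=> [|c x y [Zx fx] [Zy fy]]; split => //; first by case: Zc.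
  by case: Zc => _; apply.
by rewrite fL fx fy scaler0 addr0.
Qed.

Lemma linearP_lfun (V W : vectType k) (f : V -> W) :
  linear f -> exists F : 'Hom(V, W), F =1 f.
Proof.
move=> fL; pose fM := GRing.isLinear.Build k V W _ f fL.
pose g : {linear V -> W} := HB.pack f fM.
by exists (linfun g) => v; rewrite lfunE.
Qed.

Lemma sdim_ker_im (V W : vectType k) (f : V -> W) (Z : set V) :
  linear f -> lin_closed Z ->
  (sdim [set v | Z v /\ f v = 0%R] + sdim (f @` Z))%N = sdim Z.
Proof.
move=> fL Zc; have [F FE] := linearP_lfun fL.
rewrite -[RHS](limg_ker_dim F (vspace_of_set Z)); congr (_ + _)%N.
  rewrite -sdim_vs; congr sdim; apply/seteqP; split=> v /=.
    by case=> Zv fv; rewrite memv_cap memv_ker FE fv eqxx andbT; apply/vspP.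
  by move=> /memv_capP[/(vspP _ Zc)Zv]; rewrite memv_ker FE => /eqP.
rewrite -sdim_vs; congr sdim; apply/seteqP; split=> v /=.
  by case=> x Zx <-; rewrite -FE memv_img //; apply/vspP.
by move=> /memv_imgP[x /(vspP _ Zc)Zx ->]; exists x; rewrite ?FE.
Qed.

Lemma sdim_inj (V W : vectType k) (f : V -> W) (Z : set V) :
  linear f -> lin_closed Z -> (forall v, Z v -> f v = 0 -> v = 0) ->
  sdim (f @` Z) = sdim Z.
Proof.
move=> fL Zc fI; rewrite -[RHS](sdim_ker_im fL Zc).
rewrite (_ : [set v | _] = [set 0]) ?sdim0 //.
apply/seteqP; split=> v /=; first by case; apply: fI.
move=> ->; split; first by case: Zc.
by have := fL (-1) 0 0; rewrite scaler0 addr0 scaleN1r addNr.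
Qed.

Lemma sdim_im_le (V W : vectType k) (f : V -> W) (Z : set V) (Z' : set W) :
  linear f -> lin_closed Z -> lin_closed Z' -> (forall v, Z v -> f v = 0 -> v = 0) ->
  (forall v, Z v -> Z' (f v)) -> (sdim Z <= sdim Z')%N.
Proof.
move=> fL Zc Zc' fI fZ; rewrite -(sdim_inj fL Zc fI).
by apply: sdim_le => // [|_ [v Zv <-]]; [apply: lin_closed_im|apply: fZ].
Qed.

End LinearSets.

(** * Ranks of quotients Z / B over division rings of scalars *)

Section RankOver.
Variables (k : fieldType) (E V : vectType k).
Variables (K : set E) (act : E -> V -> V) (Z : set V).
Hypotheses (Kc : lin_closed K) (Zc : lin_closed Z).
Hypothesis actl : forall v, linear (act^~ v).
Hypothesis actr : forall a, linear (act a).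
Hypothesis ZK : forall a z, K a -> Z z -> Z (act a z).
(** Products, units and inverses are required only through their action on Z. This covers
    endomorphism rings inside matrix spaces, their opposites, and algebras whose unit is the
    identity on Z but not on V. *)
Hypothesis actM : forall a b, K a -> K b ->
  exists2 c, K c & forall z, Z z -> act a (act b z) = act c z.
Hypothesis act1 : exists2 u, K u & forall z, Z z -> act u z = z.
Hypothesis actV : forall a, K a -> a <> 0 ->
  exists2 b, K b & forall z, Z z -> act b (act a z) = z.

Definition rank_submod (B : set V) :=
  [/\ lin_closed B, B `<=` Z & forall a z, K a -> B z -> B (act a z)].

Definition rank_basis (B : set V) r (w : 'I_r -> V) :=
  (forall l, Z (w l)) /\ forall z, Z z -> exists! c : {ffun 'I_r -> E},
    (forall l, K (c l)) /\ B (z - \sum_l act (c l) (w l)).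

Definition add_line (B : set V) z := [set v | exists2 a, K a & B (v - act a z)].

Let act0l v : act 0 v = 0.
Proof. by have := actl v (-1) 0 0; rewrite scaler0 addr0 scaleN1r addNr. Qed.

Let act0r a : act a 0 = 0.
Proof. by have := actr a (-1) 0 0; rewrite scaler0 addr0 scaleN1r addNr. Qed.

Let actB a b v : act (a - b) v = act a v - act b v.
Proof. by rewrite addrC -scaleN1r actl scaleN1r addrC. Qed.

Let actrB a u v : act a (u - v) = act a u - act a v.
Proof. by rewrite addrC -scaleN1r actr scaleN1r addrC. Qed.

Lemma add_line_submod B z : rank_submod B -> Z z -> rank_submod (add_line B z).
Proof.
move=> [Bc BZ BK] Zz; have [K0 KP] := Kc; have [B0 BP] := Bc; split.
- split=> [|c x y [a Ka Ba] [b Kb Bb]].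
    by exists 0; rewrite ?act0l ?subr0.
  exists (c *: a + b); first exact: KP.
  by rewrite actl opprD addrACA -scalerBr; apply: BP.
- move=> v [a Ka /BZ Zv]; rewrite -[v](subrK (act a z)).
  by apply: lin_closedD => //; apply: ZK.
- move=> a v Ka [b Kb Bb]; have [c Kc' cE] := actM Ka Kb.
  by exists c; rewrite -?cE // -actrB; apply: BK.
Qed.

Lemma sdim_add_line B z : rank_submod B -> Z z ->
  (forall a, K a -> B (act a z) -> a = 0) ->
  sdim (add_line B z) = (sdim B + sdim K)%N.
Proof.
move=> sB Zz zI; have [Bc BZ BK] := sB; have [Lc LZ LK] := add_line_submod sB Zz.
have aL : linear (act^~ z) by apply: actl.
rewrite -(sdim_inj aL Kc); last first.
  by move=> a Ka az; apply: zI; rewrite ?az //; case: Bc.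
rewrite /sdim -dimv_disjoint_sum.
  congr (\dim _); apply/vspaceP => v; apply/idP/idP.
    move=> /(vspP _ Lc)[a Ka Ba]; rewrite -[v](subrK (act a z)) memv_add //.
      exact/vspP.
    by apply/vspP; [apply: lin_closed_im|exists a].
  move=> /memv_addP[b /(vspP _ Bc)Bb [y]].
  move=> /(vspP _ (lin_closed_im aL Kc))[a Ka <-] ->.
  by apply/vspP => //; exists a; rewrite ?addrK.
apply/eqP; rewrite -subv0; apply/subvP=> x /memv_capP[/(vspP _ Bc)xB].
move=> /(vspP _ (lin_closed_im aL Kc))[a Ka xE].
by rewrite -xE (zI a) ?xE // -[act 0 z]/(act 0 z) act0l mem0v.
Qed.

(** Coefficients modulo B consist of a coefficient of the first vector and coefficients modulo the
    enlarged set; the first one is unique because no nonzero scalar sends [w ord0] into B. *)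
Lemma rank_basisS B r (w : 'I_r.+1 -> V) : rank_submod B -> Z (w ord0) ->
  (forall a, K a -> B (act a (w ord0)) -> a = 0) ->
  rank_basis B w <-> rank_basis (add_line B (w ord0)) (fun l => w (lift ord0 l)).
Proof.
move=> [Bc BZ BK] Zw wI.
pose join (a : E) (c : {ffun 'I_r -> E}) : {ffun 'I_r.+1 -> E} :=
  [ffun l => if unlift ord0 l is Some j then c j else a].
have join0 a c : join a c ord0 = a by rewrite ffunE unlift_none.
have joinS a c l : join a c (lift ord0 l) = c l by rewrite ffunE liftK.
have joinE (c : {ffun 'I_r.+1 -> E}) : c = join (c ord0) [ffun l => c (lift ord0 l)].
  apply/ffunP=> l; rewrite [RHS]ffunE.
  by case: unliftP => [j ->|->]; rewrite ?ffunE.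
have sumE z (c : {ffun 'I_r.+1 -> E}) : z - \sum_l act (c l) (w l) =
    z - \sum_l act (c (lift ord0 l)) (w (lift ord0 l)) - act (c ord0) (w ord0).
  by rewrite big_ord_recl opprD addrA addrAC.
split=> -[Zwl wP]; split=> //.
- move=> z Zz; have [c [[Kc' Bc'] cU]] := wP z Zz.
  exists [ffun l => c (lift ord0 l)]; split.
    split=> [l|]; rewrite ?ffunE //; exists (c ord0) => //.
    under eq_bigr do rewrite ffunE.
    by rewrite -sumE.
  move=> d [Kd [a Ka Ba]]; rewrite (cU (join a d)).
    by apply/ffunP=> l; rewrite ffunE joinS.
  split=> [l|]; first by rewrite ffunE; case: unlift.
  by rewrite sumE join0; under eq_bigr do rewrite joinS.
- by move=> l; case: (unliftP ord0 l) => [j ->|->].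
- move=> z Zz; have [c [[Kc' [a Ka Ba]] cU]] := wP z Zz.
  exists (join a c); split.
    split=> [l|]; first by rewrite ffunE; case: unlift.
    by rewrite sumE join0; under eq_bigr do rewrite joinS.
  move=> d [Kd Bd]; rewrite [d]joinE.
  have cE : c = [ffun l => d (lift ord0 l)].
    apply: cU; split=> [l|]; rewrite ?ffunE //; exists (d ord0) => //.
    by under eq_bigr do rewrite ffunE; rewrite -sumE.
  congr join => //.
  apply/eqP; rewrite -subr_eq0; apply/eqP; apply: wI.
    exact: lin_closedB.
  rewrite sumE in Bd.
  have {}Ba : B (z - \sum_l act (d (lift ord0 l)) (w (lift ord0 l)) - act a (w ord0)).
    by move: Ba; rewrite cE; under eq_bigr do rewrite ffunE.
  have := lin_closedB Bc Bd Ba; rewrite actB.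
  by rewrite opprB addrC addrA subrK.
Qed.

(** Each basis vector moved into B enlarges it by a copy of K; once all are moved, B has become Z.
    Hence every basis has the same length. *)
Lemma rank_basis_dim B r (w : 'I_r -> V) : rank_submod B -> rank_basis B w ->
  (sdim K * r + sdim B)%N = sdim Z.
Proof.
elim: r B w => [|r IHr] B w sB wB; have [Bc BZ BK] := sB.
  rewrite muln0 add0n; congr sdim; apply/seteqP; split=> // z Zz.
  by case: wB => _ /(_ z Zz)[c [[_]]]; rewrite big_ord0 subr0.
have Zw : Z (w ord0) by case: wB.
(* The vector 0 has the coefficients 0, and also, modulo B, the coefficient a on the first vector
   and 0 elsewhere; uniqueness gives a = 0. *)
have wI a : K a -> B (act a (w ord0)) -> a = 0.
  move=> Ka Ba; case: wB => _ /(_ 0 _)[]; first by case: Zc.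
  move=> c [_ cU].
  have c0 : c = [ffun=> 0].
    apply: cU; split=> [l|]; first by rewrite ffunE; case: Kc.
    by rewrite big1 ?subr0; [case: Bc|move=> l _; rewrite ffunE].
  suff : c = [ffun l => if l == ord0 then a else 0].
    by rewrite c0 => /ffunP/(_ ord0); rewrite !ffunE.
  apply: cU; split=> [l|].
    by rewrite ffunE; case: ifP => // _; case: Kc.
  rewrite (bigD1 ord0) //= big1 ?addr0 ?ffunE ?sub0r //; last first.
    by move=> l /negPf l0; rewrite ffunE l0 act0l.
  exact: lin_closedN.
have /(rank_basisS sB Zw wI) wB' := wB.
rewrite -(IHr _ _ (add_line_submod sB Zw) wB') (sdim_add_line sB Zw wI).
by rewrite mulnSr -addnA (addnC (sdim K)).
Qed.

(** A vector z outside B is independent modulo B, since a nonzero scalar sending it into B could be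
    inverted. Adding its line to B lowers the codimension. *)
Lemma rank_basis_exists B : rank_submod B -> exists r, exists w : 'I_r -> V, rank_basis B w.
Proof.
have [n] := ubnP (sdim Z - sdim B); elim: n B => // n IHn B le_n sB.
have [Bc BZ BK] := sB.
have [ZB|/existsNP[z /not_implyP[Zz nBz]]] := pselect (forall v, Z v -> B v).
  exists 0%N, (fun=> 0); split=> [|z Zz]; first by case.
  exists [ffun=> 0]; split=> [|c _]; last by apply/ffunP=> -[].
  by split=> [[]//|]; rewrite big_ord0 subr0; apply: ZB.
have zI a : K a -> B (act a z) -> a = 0.
  move=> Ka Ba; apply/eqP/negPn/negP => /eqP /(actV Ka)[b Kb bE].
  by apply: nBz; rewrite -(bE z Zz); apply: BK.
have sL := add_line_submod sB Zz.
have [|r [w wB]] := IHn (add_line B z) _ sL; last first.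
  pose w' (l : 'I_r.+1) := if unlift ord0 l is Some j then w j else z.
  exists r.+1, w'; apply/rank_basisS => //; rewrite /w' ?unlift_none //.
  by under eq_fun do rewrite liftK.
have lt : (sdim B < sdim Z)%N.
  rewrite ltnNge; apply/negP => le; apply: nBz.
  by rewrite (sdim_eq Bc Zc BZ le).
rewrite (sdim_add_line sB Zz zI) subnDA.
(* The codimension must drop strictly: if K were zero, the scalar acting as the identity would be 0,
   and z = 0 would lie in B. *)
have K0 : (0 < sdim K)%N.
  rewrite lt0n; apply/negP=> /eqP /(sdim_eq0 Kc) KE.
  have [u] := act1; rewrite KE => /= -> /(_ z Zz); rewrite act0l => z0.
  by case: nBz; rewrite -z0; case: Bc.
by rewrite ltnS in le_n; apply: leq_trans le_n; rewrite ltn_subrL K0 subn_gt0.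
Qed.

Lemma rank_overE B : rank_submod B ->
  (sdim K * rank_over K act Z B + sdim B)%N = sdim Z.
Proof.
move=> sB; rewrite /rank_over; case: xgetP => [r _ [w Zw wP]|noB].
  exact: (rank_basis_dim sB (conj Zw wP)).
have [r [w [Zw wP]]] := rank_basis_exists sB.
by case: (noB r); exists w.
Qed.

End RankOver.

(** * Modules *)

Lemma mulmx_ext (R : pzSemiRingType) m n (A B : 'M[R]_(m, n)) :
  (forall x : 'cV_n, A *m x = B *m x) -> A = B.
Proof.
by move=> AB; apply/matrixP=> i j; have /colP/(_ i) := AB (delta_mx j 0);
  rewrite -!colE !mxE.
Qed.

Lemma lin_mulmx_col (R : comNzRingType) m n (f : 'cV[R]_n -> 'cV[R]_m) :
  linear f -> exists F : 'M_(m, n), forall x, F *m x = f x.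
Proof.
move=> fL; pose fM := GRing.isLinear.Build R _ _ _ f fL.
pose g : {linear 'cV[R]_n -> 'cV[R]_m} := HB.pack f fM.
exists (\matrix_(i, j) g (delta_mx j 0) i 0) => x.
rewrite -[f x]/(g x) {2}[x]matrix_sum_delta linear_sum.
apply/colP=> i; rewrite !mxE summxE; apply: eq_bigr => j _.
by rewrite big_ord1 linearZ !mxE mulrC.
Qed.

Section VectModules.
Import VectorInternalTheory.
Variables (k : fieldType) (A : algType k).

(** Objects of [fdmod] live on column spaces, so a representation on an abstract space is
    transported along its coordinates. These are rows, whence the transposes. *)
Lemma vect_module (V : vectType k) (rho : A -> V -> V) :
  (forall v, linear (rho^~ v)) -> (forall a, linear (rho a)) ->
  (forall v, rho 1 v = v) -> (forall a b v, rho (a * b) v = rho a (rho b v)) ->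
  exists (N : fdmod A) (c : V -> 'cV[k]_(mdim N)) (c' : 'cV[k]_(mdim N) -> V),
    [/\ linear c, linear c', cancel c c', cancel c' c &
        forall a v, c (rho a v) = mact N a *m c v].
Proof.
move=> rl rr r1 rM.
pose c (v : V) : 'cV[k]_(dim V) := (v2r v)^T.
pose c' (x : 'cV[k]_(dim V)) : V := r2v x^T.
have cL : linear c by move=> b u v; rewrite /c !linearP.
have cL' : linear c' by move=> b u v; rewrite /c' !linearP.
have cK : cancel c c' by move=> v; rewrite /c /c' trmxK v2rK.
have cK' : cancel c' c by move=> v; rewrite /c /c' r2vK trmxK.
have /choice[mat matE] a : exists F : 'M_(dim V), forall x, F *m x = c (rho a (c' x)).
  by apply: lin_mulmx_col => b x y; rewrite cL' rr cL.
have mL : linear mat.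
  move=> b a a'; apply: mulmx_ext => x.
  by rewrite mulmxDl -scalemxAl !matE rl cL.
have mM : monoid_morphism mat.
  split=> [|a b]; apply: mulmx_ext => x; first by rewrite matE r1 cK' mul1mx.
  by rewrite -mulmxA !matE cK rM.
pose fL := GRing.isLinear.Build k A 'M[k]_(dim V) _ mat mL.
pose fM := GRing.isMonoidMorphism.Build A 'M[k]_(dim V) mat mM.
pose g : {lrmorphism A -> 'M[k]_(dim V)} := HB.pack mat fL fM.
by exists (FdMod g), c, c'; split=> // a v; rewrite /= matE cK.
Qed.

Implicit Types X Y M N : fdmod A.

Lemma is_homP X Y (f : 'M[k]_(mdim Y, mdim X)) :
  is_hom f <-> forall a (x : 'cV_(mdim X)), f *m (mact X a *m x) = mact Y a *m (f *m x).
Proof.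
split=> fH a; first by move=> x; rewrite mulmxA fH mulmxA.
by apply: mulmx_ext => x; rewrite -!mulmxA.
Qed.

Lemma hom_mul X Y Z (g : 'M[k]_(mdim Z, mdim Y)) (f : 'M[k]_(mdim Y, mdim X)) :
  is_hom g -> is_hom f -> @is_hom _ _ X Z (g *m f).
Proof. by move=> gH fH a; rewrite -mulmxA fH mulmxA gH mulmxA. Qed.

Lemma hom_id X : @is_hom _ _ X X 1%:M.
Proof. by move=> a; rewrite mul1mx mulmx1. Qed.

Lemma lin_closed_hom X Y : lin_closed [set f : 'M[k]_(mdim Y, mdim X) | is_hom f].
Proof.
split=> [a|c f g fH gH a] /=; first by rewrite mul0mx mulmx0.
by rewrite mulmxDl mulmxDr -scalemxAl -scalemxAr fH gH.
Qed.

Lemma mact1 M : mact M 1 = 1%:M. Proof. by rewrite rmorph1. Qed.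

Lemma mactM M a b : mact M (a * b) = mact M a *m mact M b.
Proof. by rewrite rmorphM. Qed.

Lemma mactD M a b : mact M (a + b) = mact M a + mact M b.
Proof. by rewrite linearD. Qed.

Lemma mactZ M c a : mact M (c *: a) = c *: mact M a.
Proof. by rewrite linearZ. Qed.

Lemma stable_lin M (U : set 'cV[k]_(mdim M)) : stable U -> lin_closed U.
Proof.
case=> U0 UD Ua; split=> // c x y Ux Uy; apply: UD => //.
by have := Ua c%:A x Ux; rewrite linearZ /= mact1 -scalemxAl mul1mx.
Qed.

Lemma stable_im M N (f : 'M[k]_(mdim N, mdim M)) (U : set 'cV[k]_(mdim M)) :
  is_hom f -> stable U -> @stable _ _ N ((fun x => f *m x) @` U).
Proof.
move=> /is_homP fH [U0 UD Ua]; split.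
- by exists 0; rewrite ?mulmx0.
- by move=> _ _ [x Ux <-] [y Uy <-]; exists (x + y); rewrite ?mulmxDr //; apply: UD.
- by move=> a _ [x Ux <-]; exists (mact M a *m x); [apply: Ua|apply: fH].
Qed.

Lemma stable_ker M N (f : 'M[k]_(mdim N, mdim M)) (U : set 'cV[k]_(mdim M)) :
  is_hom f -> stable U -> @stable _ _ M [set u | U u /\ f *m u = 0].
Proof.
move=> /is_homP fH [U0 UD Ua]; split.
- by split=> //; rewrite mulmx0.
- by move=> x y [Ux fx] [Uy fy]; split; [apply: UD|rewrite mulmxDr fx fy addr0].
- by move=> a x [Ux fx]; split; [apply: Ua|rewrite fH fx mulmx0].
Qed.

Lemma stable_preim M N (f : 'M[k]_(mdim N, mdim M)) (U : set 'cV[k]_(mdim N)) :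
  is_hom f -> stable U -> @stable _ _ M [set u | U (f *m u)].
Proof.
move=> /is_homP fH [U0 UD Ua]; split=> /=.
- by rewrite mulmx0.
- by move=> x y Ux Uy; rewrite mulmxDr; apply: UD.
- by move=> a x Ux; rewrite fH; apply: Ua.
Qed.

Lemma stableT M : @stable _ _ M setT. Proof. by []. Qed.

Lemma mulmx_linear m n (F : 'M[k]_(m, n)) p : linear (fun x : 'M_(n, p) => F *m x).
Proof. by move=> c x y; rewrite mulmxDr -scalemxAr. Qed.

Lemma submodule_exists M (U : set 'cV[k]_(mdim M)) : stable U ->
  exists (N : fdmod A) (i : 'M[k]_(mdim M, mdim N)), Defs.monic i /\
    (forall x : 'cV_(mdim M), U x <-> exists y, i *m y = x).
Proof.
move=> Us; have Uc := stable_lin Us; have [U0 UD Ua] := Us; pose W := vspace_of_set U.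
have WP v : v \in W <-> U v by apply: vspP.
have WA a (v : subvs_of W) : mact M a *m vsval v \in W.
  by apply/WP/Ua/WP/subvsP.
pose rho a (v : subvs_of W) := vsproj W (mact M a *m vsval v).
have rE a v : vsval (rho a v) = mact M a *m vsval v by rewrite vsprojK.
have [|||| N [c [c' [cL cL' cK cK' cA]]]] := @vect_module (subvs_of W) rho.
- by move=> v b a a'; apply: val_inj; rewrite /= rE !linearP /= !rE mulmxDl -scalemxAl.
- by move=> a b u v; apply: val_inj; rewrite /= rE !linearP /= !rE.
- by move=> v; apply: val_inj; rewrite /= rE mact1 mul1mx.
- by move=> a b v; apply: val_inj; rewrite /= !rE mactM mulmxA.
have [i iE] : exists i : 'M_(mdim M, mdim N), forall x, i *m x = vsval (c' x).
  by apply: lin_mulmx_col => b x y; rewrite cL' linearP.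
exists N, i; split; last first.
  move=> x; split=> [/WP xW|[y <-]]; last by rewrite iE; apply/WP/subvsP.
  by exists (c (vsproj W x)); rewrite iE cK vsprojK.
split=> [|x y]; last first.
  by rewrite !iE => /val_inj /(can_inj cK').
apply/is_homP=> a x; rewrite !iE -rE; congr vsval.
by rewrite -{1}[x]cK' -cA cK.
Qed.

(** The quotient M / U is realised on a linear complement of U, with projection q; an element a acts
    on it by v |-> q (a v). *)
Lemma quotient_exists M (U : set 'cV[k]_(mdim M)) : stable U ->
  exists (N : fdmod A) (p : 'M[k]_(mdim N, mdim M)), epic p /\
    (forall x : 'cV_(mdim M), U x <-> p *m x = 0).
Proof.
move=> Us; have Uc := stable_lin Us; have [U0 UD Ua] := Us; pose W := vspace_of_set U.
have WP v : v \in W <-> U v by apply: vspP.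
pose C := (W^C)%VS; pose q v : subvs_of C := vsproj C (v - projv W v).
have qE v : vsval (q v) = v - projv W v by rewrite vsprojK ?memv_projC.
have qL : linear q.
  move=> b u v; rewrite -[RHS]linearP; congr vsproj.
  by rewrite linearP opprD addrACA scalerBr.
have q0 v : q v = 0 <-> v \in W.
  split=> [/(congr1 vsval)|vW].
    by rewrite qE linear0 => /eqP; rewrite subr_eq0 => /eqP ->; apply: memv_proj.
  by apply: val_inj; rewrite /= qE projv_id ?subrr ?linear0.
have qB u v : q (u - v) = q u - q v.
  by rewrite addrC -scaleN1r qL scaleN1r addrC.
have qW u v : u - v \in W -> q u = q v.
  by move=> /q0; rewrite qB => /eqP; rewrite subr_eq0 => /eqP.
have qv v : q (vsval v) = v.
  apply: val_inj; rewrite /= qE; suff -> : projv W (vsval v) = 0 by rewrite subr0.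
  have : projv W (vsval v) \in (W :&: W^C)%VS.
    rewrite memv_cap memv_proj /= -[projv _ _](subrK (vsval v)) memvD ?subvsP //.
    by rewrite -opprB memvN memv_projC.
  by rewrite capv_compl memv0 => /eqP.
pose rho a (v : subvs_of C) := q (mact M a *m vsval v).
(* q is compatible with the actions: v and q v differ by an element of U, which a keeps in U. The
   module laws of the quotient follow from this. *)
have rq a v : rho a (q v) = q (mact M a *m v).
  apply: qW; rewrite -mulmxBr; apply/WP/Ua/WP.
  by rewrite qE addrC addKr memvN memv_proj.
have [|||| N [c [c' [cL cL' cK cK' cA]]]] := @vect_module (subvs_of C) rho.
- by move=> v b a a'; rewrite /rho linearP mulmxDl -scalemxAl qL.
- by move=> a b u v; rewrite -[RHS]qL; congr q; rewrite [vsval _]linearP mulmxDr -scalemxAr.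
- by move=> v; rewrite /rho mact1 mul1mx qv.
- by move=> a b v; rewrite [rho b v]/rho rq mulmxA -mactM.
have [p pE] : exists p : 'M_(mdim N, mdim M), forall x, p *m x = c (q x).
  by apply: lin_mulmx_col => b x y; rewrite qL cL.
have c0 : c 0 = 0 by have := cL (-1) 0 0; rewrite scaler0 addr0 scaleN1r addNr.
exists N, p; split; last first.
  move=> x; rewrite pE; split=> [/WP /q0 ->//|].
  by rewrite -c0 => /(can_inj cK)/q0/WP.
split; first by apply/is_homP=> a x; rewrite !pE -cA rq.
by move=> y; exists (vsval (c' y)); rewrite pE qv cK'.
Qed.

End VectModules.

Lemma rank_over_scalar (k : fieldType) (V : vectType k) (Z B : set V) :
  lin_closed Z -> lin_closed B -> B `<=` Z ->
  (rank_over setT *:%R Z B + sdim B)%N = sdim Z.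
Proof.
move=> Zc Bc BZ.
have <- : (sdim [set: k^o] * rank_over setT *:%R Z B + sdim B)%N = sdim Z.
  apply: (@rank_overE k k^o V setT *:%R) => //.
  - by move=> v c a b; rewrite scalerDl scalerA.
  - by move=> a c u v; rewrite scalerDr !scalerA mulrC.
  - by move=> a z _; apply: lin_closedZ.
  - by move=> a b _ _; exists (a * b) => // z _; rewrite scalerA.
  - by exists 1 => // z _; rewrite scale1r.
  - move=> a _ /eqP a0; exists a^-1 => // z _.
    by rewrite scalerK.
  - by split=> // a z _; apply: lin_closedZ.
by rewrite sdimT dimvf mul1n.
Qed.

(** * Hom and Ext as dimensions; vanishing of Ext *)

Section HomExtDims.
Variables (k : fieldType) (A : falgType k).
Implicit Types X Y : fdmod A.

Lemma homdimE X Y : homdim X Y = sdim [set f : 'M[k]_(mdim Y, mdim X) | is_hom f].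
Proof.
rewrite /homdim -(@rank_over_scalar k _ _ [set 0]) ?sdim0 ?addn0 //.
- exact: lin_closed_hom.
- exact: lin_closed0.
- by move=> _ ->; case: (lin_closed_hom X Y).
Qed.

Lemma lin_closed_cocycle X Y : lin_closed (@ext_cocycle k A X Y).
Proof.
split=> [a b|c d d' dP dP' a b]; first by rewrite !lfunE /= mulmx0 mul0mx addr0.
rewrite !(add_lfunE, scale_lfunE) dP dP' scalerDr addrACA mulmxDr mulmxDl.
by rewrite -!scalemxAr -!scalemxAl.
Qed.

Lemma lin_closed_coboundary X Y : lin_closed (@ext_coboundary k A X Y).
Proof.
split=> [|c d d' [h hE] [h' hE']].
  by exists 0 => a; rewrite lfunE /= mulmx0 mul0mx subr0.
exists (c *: h + h') => a; rewrite !(add_lfunE, scale_lfunE) hE hE'.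
by rewrite mulmxDr mulmxDl -scalemxAr -scalemxAl scalerBr opprD addrACA.
Qed.

Lemma coboundary_cocycle X Y : @ext_coboundary k A X Y `<=` @ext_cocycle k A X Y.
Proof.
move=> d [h hE] a b; rewrite !hE !mactM mulmxBr mulmxBl !mulmxA.
by rewrite addrA subrK.
Qed.

Lemma extdimE X Y : (extdim X Y + sdim (@ext_coboundary k A X Y))%N =
  sdim (@ext_cocycle k A X Y).
Proof.
apply: rank_over_scalar; [exact: lin_closed_cocycle|exact: lin_closed_coboundary|].
exact: coboundary_cocycle.
Qed.

Lemma extdim_eq0 X Y :
  @ext_cocycle k A X Y `<=` @ext_coboundary k A X Y -> extdim X Y = 0%N.
Proof.
move=> ZB; apply/eqP; rewrite -(eqn_add2r (sdim (@ext_coboundary k A X Y))) extdimE.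
rewrite add0n; apply/eqP; congr sdim; apply/seteqP; split=> //.
exact: coboundary_cocycle.
Qed.

Section Extension.
Variables (X Y : fdmod A) (d : 'Hom(A, 'M[k]_(mdim Y, mdim X))).
Hypothesis dZ : ext_cocycle d.

Let emx a : 'M[k]_(mdim Y + mdim X) := block_mx (mact Y a) (d a) 0 (mact X a).

Let emx_linear : linear emx.
Proof.
move=> c a b; rewrite /emx scale_block_mx add_block_mx !linearP.
by rewrite scaler0 addr0.
Qed.

Let emx_monoid : monoid_morphism emx.
Proof.
(* The cocycle condition at (1, 1) reads d 1 = d 1 + d 1. *)
have d1 : d 1 = 0.
  have := dZ 1 1; rewrite mulr1 !mact1 mul1mx mulmx1 => /eqP.
  by rewrite -subr_eq0 opprD addNKr oppr_eq0 => /eqP.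
split=> [|a b]; first by rewrite /emx !mact1 d1 -scalar_mx_block.
by rewrite -[RHS]/(emx a *m emx b) /emx mulmx_block !mactM !mulmx0 !mul0mx !addr0 add0r dZ.
Qed.

Lemma extension_exists : exists g : {lrmorphism A -> 'M[k]_(mdim Y + mdim X)},
  forall a, g a = block_mx (mact Y a) (d a) 0 (mact X a).
Proof.
pose fL := GRing.isLinear.Build k A _ _ emx emx_linear.
pose fM := GRing.isMonoidMorphism.Build A _ emx emx_monoid.
pose g : {lrmorphism A -> 'M[k]_(mdim Y + mdim X)} := HB.pack emx fL fM.
by exists g.
Qed.

End Extension.

(** The extension of P by Y attached to a cocycle d splits. Its section has the form (h; 1), and the
    linearity of this section says that d is the coboundary of - h. *)
Lemma extdim_proj P Y : projective P -> extdim P Y = 0%N.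
Proof.
move=> Pproj; apply: extdim_eq0 => d dZ.
have [g gf] := extension_exists dZ.
have gE a : mact (FdMod g) a = block_mx (mact Y a) (d a) 0 (mact P a).
  exact: gf.
have [||l lH lE] := Pproj (FdMod g) P (row_mx 0 1%:M) 1%:M.
- split=> [a|y]; first by rewrite gE mul_row_block mul_mx_row !(mul0mx, mul1mx, mulmx0, mulmx1) !add0r.
  by exists (col_mx 0 y); rewrite mul_row_col mul0mx mul1mx add0r.
- exact: hom_id.
pose h := usubmx l; have lE' : l = col_mx h 1%:M.
  by rewrite -[l]vsubmxK; congr col_mx; rewrite -lE -[in RHS](vsubmxK l)
    mul_row_col mul0mx mul1mx add0r.
exists (- h) => a; have := lH a; rewrite gE lE' mul_block_col mul_col_mx.
rewrite !mulmx1 => /eq_col_mx[hE _].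
by rewrite mulNmx mulmxN opprK hE addKr.
Qed.

(** The extension has a retraction (1, h) onto I, whose linearity says that d is the coboundary of
    h. *)
Lemma extdim_inj X I : injective_mod I -> extdim X I = 0%N.
Proof.
move=> Iinj; apply: extdim_eq0 => d dZ.
have [g gf] := extension_exists dZ.
have gE a : mact (FdMod g) a = block_mx (mact I a) (d a) 0 (mact X a).
  exact: gf.
have [||l lH lE] := Iinj I (FdMod g) (col_mx 1%:M 0) 1%:M.
- split=> [a|x y]; last by rewrite !mul_col_mx !mul1mx => /eq_col_mx[].
  by rewrite gE mul_block_col mul_col_mx !(mul0mx, mul1mx, mulmx0, mulmx1) !addr0.
- exact: hom_id.
pose h := rsubmx l; have lE' : l = row_mx 1%:M h.
  by rewrite -[l]hsubmxK; congr row_mx; rewrite -lE -[in RHS](hsubmxK l)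
    mul_row_col mulmx0 mulmx1 addr0.
exists h => a; have := lH a; rewrite gE lE' mul_row_block mul_mx_row.
rewrite !mulmx1 !mul1mx => /eq_row_mx[_ <-].
by rewrite addrK.
Qed.

End HomExtDims.

(** * Dimension vectors and their additivity *)

Section DimVec.
Variables (k : finFieldType) (m : nat) (S : species k m) (T : tensor_algebra S).
Implicit Types M N X Y : fdmod T.

Definition dact M i (a : sp_div S i) : 'M[k]_(mdim M) := mact M (sm_div (ta_map T) i a).

Lemma dactM M i a b : @dact M i (a * b) = dact M a *m dact M b.
Proof. by rewrite /dact sm_divM mactM. Qed.

Lemma dact_linear M i : linear (@dact M i).
Proof. by move=> c a b; rewrite /dact !linearP. Qed.

Lemma dact_orth M i j a b : i != j -> @dact M i a *m @dact M j b = 0.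
Proof. by move=> ij; rewrite /dact -mactM sm_orth // linear0. Qed.

Lemma dact_sum1 M : \sum_i @dact M i 1 = 1%:M.
Proof. by rewrite -(mact1 M) -(sm_sum1 (ta_map T)) linear_sum. Qed.

Lemma hom_dact X Y f i a : @is_hom _ _ X Y f -> f *m @dact X i a = dact Y a *m f.
Proof. by move=> fH; apply: fH. Qed.

Definition vertex_part M i (U : set 'cV[k]_(mdim M)) : set 'cV[k]_(mdim M) :=
  (fun u => @dact M i 1 *m u) @` U.

Lemma lin_closed_comp M i (U : set 'cV[k]_(mdim M)) : lin_closed U -> lin_closed (@vertex_part M i U).
Proof. by apply: lin_closed_im => c x y; rewrite mulmxDr -scalemxAr. Qed.

Lemma sp_div_gt0 i : (0 < \dim {: sp_div S i})%N.
Proof. exact: adim_gt0. Qed.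

(** e_i U is a vector space over the division algebra D_i, with unit acting by e_i; [rank_overE]
    then trades the chosen rank for a k-dimension. *)
Lemma dimvec_subE M i (U : set 'cV[k]_(mdim M)) : stable U ->
  (\dim {: sp_div S i})%:Z * dimvec_sub U i 0 = (sdim (@vertex_part M i U))%:Z.
Proof.
move=> Us; have Uc := stable_lin Us; rewrite mxE -PoszM -sdimT; congr Posz.
apply: (etrans (esym (addn0 _))).
rewrite -[X in (_ + X)%N](sdim0 'cV[k]_(mdim M)).
have UD j a u : U u -> U (@dact M j a *m u) by case: Us => _ _; apply.
have cE z : @vertex_part M i U z -> @dact M i 1 *m z = z.
  by case=> u _ <-; rewrite mulmxA -dactM mulr1.
have cU z : @vertex_part M i U z -> U z by case=> u Uu <-; apply: UD.
apply: (@rank_overE k _ _ setT (fun a u => @dact M i a *m u)) => //.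
- exact: lin_closed_comp.
- by move=> v c a b; rewrite dact_linear mulmxDl -scalemxAl.
- by move=> a c u v; rewrite mulmxDr -scalemxAr.
- move=> a z _ zU; exists (dact M a *m z); first exact/UD/cU.
  by rewrite mulmxA -dactM mul1r.
- by move=> a b _ _; exists (a * b) => // z _; rewrite dactM mulmxA.
- by exists 1.
- move=> a _ /eqP/sp_divP aU; exists a^-1 => // z zU.
  by rewrite mulmxA -dactM mulVr // cE.
- split=> [|_ ->|a _ _ ->]; [exact: lin_closed0|by case: (lin_closed_comp i Uc)|].
  by rewrite mulmx0.
Qed.

(** After multiplication by d_i this is rank-nullity for f on e_i U: as f commutes with e_i, the
    kernel and the image of this restriction are the i-th parts of the kernel and the image of f on
    U. *)
Lemma dimvec_exact M N (f : 'M[k]_(mdim N, mdim M)) (U : set 'cV[k]_(mdim M)) :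
  is_hom f -> stable U ->
  dimvec_sub U = dimvec_sub [set u | U u /\ f *m u = 0] +
    @dimvec_sub _ _ _ T N ((fun u => f *m u) @` U).
Proof.
move=> fH Us; apply/colP=> i.
have di0 : (\dim {: sp_div S i})%:Z != 0 by rewrite eqz_nat -lt0n sp_div_gt0.
apply: (mulfI di0); rewrite dimvec_subE // !mxE.
have := dimvec_subE i (stable_ker fH Us); have := dimvec_subE i (stable_im fH Us).
rewrite !mxE mulrDr => -> ->; rewrite -PoszD; congr Posz.
rewrite -(sdim_ker_im (@mulmx_linear _ _ _ f 1) (lin_closed_comp i (stable_lin Us))).
congr (_ + _)%N; congr sdim; apply/seteqP; split=> v.
- case=> [[u Uu <-] fu]; exists (dact M (1 : sp_div S i) *m u); last first.
    by rewrite mulmxA -dactM mulr1.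
  by split=> //; case: Us => _ _; apply.
- case=> u [Uu fu] <-; split; first by exists u.
  by rewrite mulmxA (hom_dact _ fH) -mulmxA fu mulmx0.
- case=> _ [u Uu <-] <-; exists (f *m u); first by exists u.
  by rewrite !mulmxA (hom_dact _ fH).
- case=> _ [u Uu <-] <-; exists (dact M (1 : sp_div S i) *m u); first by exists u.
  by rewrite !mulmxA (hom_dact _ fH).
Qed.

Lemma dimvec_sub0 M : dimvec_sub [set 0 : 'cV[k]_(mdim M)] = 0 :> 'cV[int]_m.
Proof.
have s0 : @stable _ _ M [set 0].
  split=> //= [x y -> ->|a x ->]; by rewrite ?addr0 ?mulmx0.
apply/colP=> i.
have di0 : (\dim {: sp_div S i})%:Z != 0 by rewrite eqz_nat -lt0n sp_div_gt0.
apply: (mulfI di0); rewrite dimvec_subE // !mxE mulr0; congr Posz.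
rewrite -[RHS](sdim0 'cV[k]_(mdim M)); congr sdim.
apply/seteqP; split=> v; first by case=> _ -> <-; rewrite mulmx0.
by move=> ->; exists 0; rewrite ?mulmx0.
Qed.

Lemma dimvec_monic M N (i : 'M[k]_(mdim M, mdim N)) (U : set 'cV[k]_(mdim N)) :
  Defs.monic i -> stable U ->
  @dimvec_sub _ _ _ T M ((fun u => i *m u) @` U) = dimvec_sub U.
Proof.
case=> iH iI Us; rewrite [RHS](dimvec_exact iH Us) [X in X + _](_ : _ = 0) ?add0r //.
rewrite -[RHS](dimvec_sub0 N); congr dimvec_sub; apply/seteqP; split=> u /=.
  by case=> _; rewrite -[X in _ = X](mulmx0 _ i) => /iI.
by move=> ->; split; [case: Us|rewrite mulmx0].
Qed.

Lemma dimvec_zero_mod : dimvec (zero_mod T) = 0.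
Proof.
rewrite /dimvec -[RHS](dimvec_sub0 (zero_mod T)); congr dimvec_sub.
by apply/seteqP; split=> // x _ /=; apply/colP; case.
Qed.

End DimVec.

(** * Dimension of a space of maps linear over a division algebra *)

Section DivHom.
Variables (k : fieldType) (D : falgType k).
Hypothesis DV : forall a : D, a != 0 -> a \is a GRing.unit.
Variables (U W : vectType k) (rho : D -> U -> U) (sigma : D -> W -> W).
Hypotheses (rl : forall u, linear (rho^~ u)) (rr : forall a, linear (rho a)).
Hypotheses (sl : forall w, linear (sigma^~ w)) (sr : forall a, linear (sigma a)).
Hypothesis rM : forall a b u, rho (a * b) u = rho a (rho b u).
Hypothesis sM : forall a b w, sigma (a * b) w = sigma a (sigma b w).
Variable W' : set W.
Hypotheses (Wc : lin_closed W') (Ws : forall a w, W' w -> W' (sigma a w)).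
Hypothesis W1 : forall w, W' w -> sigma 1 w = w.

(** This is Hom_D(1 U, W'), where the unit of D may act on U as a proper idempotent. Its elements
    are stored as maps on all of U, and the condition on [rho 1] makes them vanish on the complement
    (1 - [rho 1]) U. *)
Definition div_hom : set 'Hom(U, W) := [set h : 'Hom(U, W) |
  [/\ forall a u, h (rho a u) = sigma a (h u), forall u, h (rho 1 u) = h u &
      forall u, W' (h u)]].

Lemma lin_closed_div_hom : lin_closed div_hom.
Proof.
have s0 a : sigma a 0 = 0.
  by have := sr a (-1) 0 0; rewrite scaler0 addr0 scaleN1r addNr.
split=> [|c f g [fa f1 fW] [ga g1 gW]]; split=> *; rewrite !(zero_lfunE, add_lfunE, scale_lfunE) ?s0 //.
- by case: Wc.
- by rewrite fa ga sr.
- by rewrite f1 g1.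
- by case: Wc => _; apply.
Qed.

(** A D-linear map is given by arbitrary images in W' of the r vectors of a D-basis of 1 U, so the
    dimension is r dim W'; the factor dim D turns r into the dimension of 1 U. *)
Lemma sdim_div_hom :
  (\dim {: D} * sdim div_hom)%N = (sdim (rho 1%R @` setT) * sdim W')%N.
Proof.
pose U' := rho 1 @` setT.
have r0 u : rho 0 u = 0.
  by have := rl u (-1) 0 0; rewrite scaler0 addr0 scaleN1r addNr.
have s0 u : sigma 0 u = 0.
  by have := sl u (-1) 0 0; rewrite scaler0 addr0 scaleN1r addNr.
have U'c : lin_closed U' by apply: lin_closed_im.
have U'1 u : U' u -> rho 1 u = u by case=> v _ <-; rewrite -rM mulr1.
have U's a u : U' u -> U' (rho a u).
  by move=> _; exists (rho a u); rewrite // -rM mul1r.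
have actM (a b : D) : setT a -> setT b ->
    exists2 c, [set: D] c & forall u, U' u -> rho a (rho b u) = rho c u.
  by exists (a * b) => // u _; rewrite rM.
have act1 : exists2 c, [set: D] c & forall u, U' u -> rho c u = u by exists 1.
have actV (a : D) : setT a -> a <> 0 ->
    exists2 b, [set: D] b & forall u, U' u -> rho b (rho a u) = u.
  move=> _ /eqP/DV aU; exists a^-1 => // u /U'1 uE.
  by rewrite -rM mulVr.
have sB : rank_submod setT rho U' [set 0].
  split=> [|_ ->|a _ _ ->]; [exact: lin_closed0|by case: U'c|].
  by have := rr a (-1) 0 0; rewrite scaler0 addr0 scaleN1r addNr.
have U'sK (a : D) u : setT a -> U' u -> U' (rho a u) by move=> _; apply: U's.
have [r [w wB]] := rank_basis_exists (lin_closedT D) U'c rl rr U'sK actM act1 actV sB.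
have := rank_basis_dim (lin_closedT D) U'c rl rr U'sK actM sB wB.
rewrite sdimT sdim0 addn0 => <-; case: wB => Uw wP.
rewrite -mulnA; congr (_ * _)%N.
(* c u is the family of coordinates of [rho 1 u] in the D-basis; uniqueness makes it linear and
   compatible with D. *)
have /choice[c cP] u : exists c : {ffun 'I_r -> D}, rho 1 u = \sum_l rho (c l) (w l) /\
    forall c' : {ffun 'I_r -> D}, rho 1 u = \sum_l rho (c' l) (w l) -> c' = c.
  have [|c [[_ cE] cU]] := wP (rho 1 u); first by exists u.
  exists c; split; first by apply/eqP; rewrite -subr_eq0; apply/eqP.
  by move=> c' c'E; apply/esym/cU; split; rewrite /= // c'E subrr.
have cE u : rho 1 u = \sum_l rho (c u l) (w l) by case: (cP u).
have cU u (c' : {ffun 'I_r -> D}) : rho 1 u = \sum_l rho (c' l) (w l) -> c' = c u.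
  by case: (cP u) => _; apply.
have cL : linear c.
  move=> b u v; apply/esym/cU; rewrite rr !cE scaler_sumr -big_split /=.
  by apply: eq_bigr => l _; rewrite !ffunE rl.
have cA a u : c (rho a u) = [ffun l => a * c u l].
  apply/esym/cU; rewrite -rM mul1r -[a in LHS]mulr1 rM cE.
  have raL : {morph rho a : x y / x + y}.
    by move=> x y; have := rr a 1 x y; rewrite !scale1r.
  have ra0 : rho a 0 = 0.
    by have := rr a (-1) 0 0; rewrite scaler0 addr0 scaleN1r addNr.
  rewrite (big_morph (rho a) raL ra0).
  by apply: eq_bigr => l _; rewrite ffunE rM.
have cw l : c (w l) = [ffun j => if j == l then 1 else 0].
  apply/esym/cU; rewrite (bigD1 l) //= big1 ?ffunE ?eqxx ?addr0 // => j /negPf jl.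
  by rewrite ffunE jl r0.
(* The space of families of images (y l) in W'; [psi y] is the D-linear extension of such a
   family. *)
pose Y : vectType k := {ffun 'I_r -> subvs_of (vspace_of_set W')}.
pose psi (y : Y) (u : U) : W := \sum_l sigma (c u l) (vsval (y l)).
have psiL y : linear (psi y).
  move=> b u v; rewrite /psi cL scaler_sumr -big_split.
  by apply: eq_bigr => l _; rewrite !ffunE sl.
have /choice[Psi PsiE] y : exists F : 'Hom(U, W), F =1 psi y.
  exact: linearP_lfun.
have PsiL : linear Psi.
  move=> b y z; apply/lfunP=> u; rewrite add_lfunE scale_lfunE !PsiE /psi.
  rewrite scaler_sumr -big_split; apply: eq_bigr => l _.
  by rewrite !ffunE linearP sr.
have yW (y : Y) l : W' (vsval (y l)) by apply/(vspP _ Wc)/subvsP.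
have psiw y l : psi y (w l) = vsval (y l).
  rewrite /psi (bigD1 l) //= big1 ?addr0 cw ?ffunE ?eqxx ?W1 //.
  by move=> j /negPf jl; rewrite ffunE jl s0.
rewrite (_ : div_hom = Psi @` setT); last first.
  apply/seteqP; split=> [h [ha h1 hW]|_ [y _ <-]].
    exists ([ffun l => vsproj (vspace_of_set W') (h (w l))] : Y) => //.
    apply/lfunP=> u; rewrite PsiE /psi -h1 cE linear_sum.
    apply: eq_bigr => l _; rewrite ffunE vsprojK; first by rewrite [RHS]ha.
    exact/(vspP _ Wc).
  split=> [a u|u|u]; rewrite !PsiE /psi.
  - rewrite cA.
    have raL : {morph sigma a : x y / x + y}.
      by move=> x z; have := sr a 1 x z; rewrite !scale1r.
    have ra0 : sigma a 0 = 0.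
      by have := sr a (-1) 0 0; rewrite scaler0 addr0 scaleN1r addNr.
    rewrite (big_morph (sigma a) raL ra0).
    by apply: eq_bigr => l _; rewrite ffunE sM.
  - by rewrite cA; apply: eq_bigr => l _; rewrite ffunE mul1r.
  - by apply: lin_closed_sum => // l _; apply: Ws.
rewrite sdim_inj ?sdimT ?dimvf //.
  by rewrite /dim /= card_ord.
move=> y _ y0; apply/ffunP=> l; apply: val_inj; rewrite /= -psiw -PsiE y0.
by rewrite !ffunE lfunE.
Qed.

End DivHom.

(** * Derivations of the tensor algebra *)

Section Generation.
Variables (k : fieldType) (m : nat) (S : species k m) (T : tensor_algebra S).

(** Z is a subalgebra through which the canonical species map factors. The induced algebra map from
    T to Z, followed by the inclusion, equals the identity by the uniqueness half of the universal
    property, so Z is all of T. *)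
Lemma tensor_algebra_generated (Z : set T) :
  lin_closed Z -> Z 1 -> (forall a b, Z a -> Z b -> Z (a * b)) ->
  (forall i a, Z (sm_div (ta_map T) i a)) ->
  (forall i j x, Z (sm_arr (ta_map T) i j x)) -> forall a, Z a.
Proof.
move=> Zc Z1 ZM Zd Za; pose U := vspace_of_set Z.
have UP v : v \in U <-> Z v by apply: vspP.
have U1 : 1 \in U by apply/UP.
have UA : is_aspace U.
  rewrite /is_aspace has_algid1 //=; apply/prodvP=> u v /UP uZ /UP vZ.
  by apply/UP/ZM.
pose A : {aspace T} := ASpace UA.
have A1 : vsval (1 : subvs_of A) = 1 by apply/eqP; rewrite algid_eq1.
have vM (u v : subvs_of A) : vsval (u * v) = vsval u * vsval v by [].
pose gd i : {linear sp_div S i -> subvs_of A} := vsproj A \o sm_div (ta_map T) i.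
pose ga i j : {linear sp_arr S i j -> subvs_of A} := vsproj A \o sm_arr (ta_map T) i j.
have Kd i a : vsval (gd i a) = sm_div (ta_map T) i a.
  by rewrite vsprojK //; apply/UP.
have Ka i j x : vsval (ga i j x) = sm_arr (ta_map T) i j x.
  by rewrite vsprojK //; apply/UP.
have gM i a b : gd i (a * b) = gd i a * gd i b.
  by apply: subvs_inj; rewrite vM !Kd sm_divM.
have gO i j a b : i != j -> gd i a * gd j b = 0.
  by move=> ij; apply: subvs_inj; rewrite vM !Kd sm_orth ?linear0.
have g1 : \sum_i gd i 1 = 1.
  apply: subvs_inj; rewrite A1 -(sm_sum1 (ta_map T)) linear_sum.
  by apply: eq_bigr => i _; apply: Kd.
have gl i j a x : ga i j (sp_l a x) = gd j a * ga i j x.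
  by apply: subvs_inj; rewrite vM !Kd !Ka sm_l.
have gr i j a x : ga i j (sp_r x a) = ga i j x * gd i a.
  by apply: subvs_inj; rewrite vM !Kd !Ka sm_r.
have [phi [phid phia] _] := ta_univ T (SpeciesMap gM gO g1 gl gr).
have [psi _ psiU] := ta_univ T (ta_map T).
pose f a := vsval (phi a).
have fL : linear f by move=> c a b; rewrite /f !linearP.
have fM : monoid_morphism f.
  by split=> [|a b]; rewrite /f ?rmorph1 // rmorphM vM.
pose fl := GRing.isLinear.Build k T T _ f fL.
pose fm := GRing.isMonoidMorphism.Build T T f fM.
pose F : {lrmorphism T -> T} := HB.pack f fl fm.
have FE : psi =1 F.
  apply: psiU; split=> [i a|i j x]; rewrite -[F _]/(vsval (phi _)).
    by rewrite phid; apply: Kd.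
  by rewrite phia; apply: Ka.
have IE : psi =1 [the {lrmorphism T -> T} of idfun] by apply: psiU.
by move=> a; apply/UP; rewrite -[a]/(idfun a) -IE FE; apply: subvsP.
Qed.

End Generation.

(* The trivial extension of A by the bimodule Hom_k(X, Y): a section of the
   first projection is an algebra map exactly when its second component is a
   derivation. *)
Definition triv_ext (k : fieldType) (A : falgType k) (X Y : fdmod A) : Type :=
  (A * 'M[k]_(mdim Y, mdim X))%type.

Section TrivExt.
Variables (k : fieldType) (A : falgType k) (X Y : fdmod A).
Local Notation R := (triv_ext X Y).

HB.instance Definition _ := GRing.Lmodule.on R.

Definition te_mul (a b : R) : R := (a.1 * b.1, mact Y a.1 *m b.2 + a.2 *m mact X b.1).
Definition te_one : R := (1, 0).

Fact te_mulA : associative te_mul.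
Proof.
move=> a b c; rewrite /te_mul /= mulrA; congr (_, _).
by rewrite !mactM mulmxDr mulmxDl !mulmxA addrA.
Qed.

Fact te_mul1l : left_id te_one te_mul.
Proof. by case=> a u; rewrite /te_mul /= mul1r mact1 mul1mx mul0mx addr0. Qed.

Fact te_mul1r : right_id te_one te_mul.
Proof. by case=> a u; rewrite /te_mul /= mulr1 mact1 mulmx1 mulmx0 add0r. Qed.

Fact te_mulDl : left_distributive te_mul +%R.
Proof.
move=> a b c; congr (_, _); rewrite /= ?mulrDl // mactD /= !mulmxDl.
by rewrite addrACA.
Qed.

Fact te_mulDr : right_distributive te_mul +%R.
Proof.
move=> a b c; congr (_, _); rewrite /= ?mulrDr // mactD /= !mulmxDr.
by rewrite addrACA.
Qed.

Fact te_one_neq0 : te_one != 0.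
Proof. by apply/eqP=> -[/eqP]; rewrite oner_eq0. Qed.

HB.instance Definition _ := GRing.Zmodule_isNzRing.Build R
  te_mulA te_mul1l te_mul1r te_mulDl te_mulDr te_one_neq0.

Fact te_scaleAl (c : k) (a b : R) : c *: (a * b) = (c *: a) * b.
Proof.
congr (_, _); rewrite /= ?scalerAl // mactZ /= -!scalemxAl.
by rewrite scalerDr.
Qed.

HB.instance Definition _ := GRing.Lmodule_isLalgebra.Build k R te_scaleAl.

Fact te_scaleAr (c : k) (a b : R) : c *: (a * b) = a * (c *: b).
Proof.
congr (_, _); rewrite /= ?scalerAr // mactZ /= -!scalemxAr.
by rewrite scalerDr.
Qed.

HB.instance Definition _ := GRing.Lalgebra_isAlgebra.Build k R te_scaleAr.

End TrivExt.

Section Derivations.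
Variables (k : finFieldType) (m : nat) (S : species k m) (T : tensor_algebra S).
Variables X Y : fdmod T.

(** By the Leibniz rule, the elements at which two derivations agree are closed under products, so
    agreement on generators suffices. *)
Lemma cocycle_ext (d d' : 'Hom(T, 'M[k]_(mdim Y, mdim X))) :
  ext_cocycle d -> ext_cocycle d' ->
  (forall i a, d (sm_div (ta_map T) i a) = d' (sm_div (ta_map T) i a)) ->
  (forall i j x, d (sm_arr (ta_map T) i j x) = d' (sm_arr (ta_map T) i j x)) ->
  d = d'.
Proof.
move=> dZ dZ' ed ea.
have one0 (e : 'Hom(T, 'M[k]_(mdim Y, mdim X))) : ext_cocycle e -> e 1 = 0.
  move=> eZ; have := eZ 1 1; rewrite mulr1 !mact1 mul1mx mulmx1 => /eqP.
  by rewrite -subr_eq0 opprD addNKr oppr_eq0 => /eqP.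
apply/lfunP; apply: (@tensor_algebra_generated _ _ _ T [set a | d a = d' a]) => //=.
- split=> [|c a b] /=; first by rewrite !linear0.
  by rewrite !linearP => /= -> ->.
- by rewrite !one0.
- by move=> a b; rewrite dZ dZ' => -> ->.
Qed.

Variable phi : forall i j, 'Hom(sp_arr S i j, 'M[k]_(mdim Y, mdim X)).
Hypothesis phil : forall i j a x, phi i j (sp_l a x) = @dact _ _ _ T Y j a *m phi i j x.
Hypothesis phir : forall i j a x, phi i j (sp_r x a) = phi i j x *m @dact _ _ _ T X i a.

(** Sending a generator to the pair of itself and its prescribed value is a species map into the
    trivial extension. The second component of the induced algebra map is the required
    derivation. *)
Lemma cocycle_exists : exists d : 'Hom(T, 'M[k]_(mdim Y, mdim X)),
  [/\ ext_cocycle d, forall i a, d (sm_div (ta_map T) i a) = 0 &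
      forall i j x, d (sm_arr (ta_map T) i j x) = phi i j x].
Proof.
pose R := triv_ext X Y.
pose gd0 i a : R := (sm_div (ta_map T) i a, 0).
pose ga0 i j x : R := (sm_arr (ta_map T) i j x, phi i j x).
have gdL i : linear (gd0 i).
  by move=> c a b; congr (_, _); rewrite ?linearP //= scaler0 addr0.
have gaL i j : linear (ga0 i j).
  by move=> c a b; congr (_, _); rewrite linearP.
pose gd i : {linear sp_div S i -> R} :=
  HB.pack (gd0 i) (GRing.isLinear.Build k _ _ _ (gd0 i) (gdL i)).
pose ga i j : {linear sp_arr S i j -> R} :=
  HB.pack (ga0 i j) (GRing.isLinear.Build k _ _ _ (ga0 i j) (gaL i j)).
have gM i a b : gd i (a * b) = gd i a * gd i b.
  by congr (_, _); rewrite /= ?sm_divM // mulmx0 mul0mx addr0.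
have gO i j a b : i != j -> gd i a * gd j b = 0.
  by move=> ij; congr (_, _); rewrite /= ?sm_orth // mulmx0 mul0mx addr0.
have g1 : \sum_i gd i 1 = 1.
  have -> : \sum_i gd i 1 = (\sum_i sm_div (ta_map T) i 1, \sum_(i < m) 0) :> R.
    by elim/big_rec3: _ => // i a b c _ ->.
  by rewrite sm_sum1 big1.
have gl i j a x : ga i j (sp_l a x) = gd j a * ga i j x.
  by congr (_, _); rewrite /= ?sm_l // mul0mx addr0 phil.
have gr i j a x : ga i j (sp_r x a) = ga i j x * gd i a.
  by congr (_, _); rewrite /= ?sm_r // mulmx0 add0r phir.
have [P [Pd Pa] _] := ta_univ T (SpeciesMap gM gO g1 gl gr).
(* Multiplicativity of P becomes the Leibniz rule for its second component once the first component
   is the identity, which need only be checked on generators. *)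
have P1 a : (P a).1 = a.
  apply: (@tensor_algebra_generated _ _ _ T [set a | (P a).1 = a]) => //=.
  - split=> [|c x y] /=; first by rewrite linear0.
    by rewrite linearP => /= -> ->.
  - by rewrite rmorph1.
  - by move=> x y; rewrite rmorphM => /= -> ->.
  - by move=> i x; rewrite Pd.
  - by move=> i j x; rewrite Pa.
have dL : linear (fun a => (P a).2) by move=> c a b; rewrite linearP.
have [d dE] := linearP_lfun dL.
exists d; split=> [a b|i a|i j x]; rewrite !dE ?Pd ?Pa //.
by rewrite rmorphM /= !P1.
Qed.

End Derivations.

(** * The Euler form *)

(** Z is the direct sum of the [Z_ i]: the components f i are jointly injective, and each value can
    be lifted with all other components zero. *)
Lemma sdim_separated (k : fieldType) (V : vectType k) (I : finType)
    (W : I -> vectType k) (f : forall i, V -> W i) (Z : set V) (Z_ : forall i, set (W i)) :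
  (forall i, linear (f i)) -> lin_closed Z -> (forall i, lin_closed (Z_ i)) ->
  (forall i z, Z z -> Z_ i (f i z)) ->
  (forall z, Z z -> (forall i, f i z = 0) -> z = 0) ->
  (forall i y, Z_ i y -> exists z, [/\ Z z, f i z = y & forall j, j != i -> f j z = 0]) ->
  sdim Z = (\sum_i sdim (Z_ i))%N.
Proof.
move=> fL Zc Z_c fZ sep lift.
have f0 i : f i 0 = 0 by have := fL i (-1) 0 0; rewrite scaler0 addr0 scaleN1r addNr.
(* The elements supported on r. Adjoining i to r, the kernel of f i is the previous space and its
   image is all of [Z_ i]. *)
pose Zr (r : seq I) := [set z | Z z /\ forall i, i \notin r -> f i z = 0].
have Zrc r : lin_closed (Zr r).
  split=> [|c x y [Zx fx] [Zy fy]]; first by split=> //; case: Zc.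
  split=> [|i ri]; first by case: Zc => _; apply.
  by rewrite fL fx // fy // scaler0 addr0.
suff step (r : seq I) : uniq r -> sdim (Zr r) = (\sum_(i <- r) sdim (Z_ i))%N.
  rewrite -step ?index_enum_uniq //; congr sdim; apply/seteqP; split=> [z Zz|z []] //.
  by split=> // i; rewrite mem_index_enum.
elim: r => [_|i r IHr /= /andP[ir ur]].
  rewrite big_nil -(sdim0 V); congr sdim; apply/seteqP; split=> z.
    by case=> Zz fz; apply: sep => // i; apply: fz.
  by move=> ->; split=> //; case: Zc.
rewrite big_cons -IHr // addnC -(sdim_ker_im (fL i) (Zrc (i :: r))).
congr (_ + _)%N; congr sdim; apply/seteqP; split=> [z|z].
- case=> -[Zz fz] fi; split=> // j jr.
  by have [->//|ji] := eqVneq j i; apply: fz; rewrite inE (negPf ji).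
- case=> Zz fz; split; last exact: fz.
  by split=> // j; rewrite inE negb_or => /andP[_]; apply: fz.
- by case=> y [Zy _] <-; apply: fZ.
- move=> /lift[y [Zy fy fj]]; exists y => //; split=> // j.
  by rewrite inE negb_or => /andP[ji _]; apply: fj.
Qed.

(** Translation by 1 permutes D, so the sum of all elements of D equals itself plus #|D| times 1. It
    follows that D has - 1 nonzero elements when counted in k. *)
Lemma finvect_sum1 (k : finFieldType) (D : falgType k) :
  (#|finvect_type D|)%:R = 0 :> k.
Proof.
have D0 : (1 : D) *+ #|finvect_type D| = 0.
  pose s := \sum_(x : finvect_type D) (x : D).
  have : s = \sum_(x : finvect_type D) ((x : D) + 1).
    rewrite /s (reindex_inj (h := fun x : finvect_type D => (x : D) + 1)) //.
    by move=> x y /addIr.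
  rewrite big_split /= sumr_const => /eqP.
  by rewrite -[X in X == _]addr0 eq_sym (inj_eq (addrI _)) => /eqP.
apply/eqP; have /eqP := D0; rewrite -scaler_nat scaler_eq0.
by rewrite oner_eq0 orbF.
Qed.

Section EulerForm.
Variables (k : finFieldType) (m : nat) (S : species k m) (T : tensor_algebra S).
Implicit Types X Y : fdmod T.

Definition div_linear X Y : set 'M[k]_(mdim Y, mdim X) :=
  [set h | forall i (a : sp_div S i), h *m dact X a = dact Y a *m h].

Definition div_cocycle X Y : set 'Hom(T, 'M[k]_(mdim Y, mdim X)) :=
  [set d | ext_cocycle d /\ forall i a, d (sm_div (ta_map T) i a) = 0].

Definition inner_derivation X Y (h : 'M[k]_(mdim Y, mdim X)) : 'Hom(T, 'M[k]_(mdim Y, mdim X)) :=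
  linfun (fun a => mact Y a *m h - h *m mact X a).

Lemma innerE X Y h a : @inner_derivation X Y h a = mact Y a *m h - h *m mact X a.
Proof.
have fL : linear (fun a => mact Y a *m h - h *m mact X a).
  move=> c b b'; rewrite !mactD !mactZ mulmxDl mulmxDr -scalemxAl -scalemxAr.
  by rewrite scalerBr opprD addrACA.
pose f : {linear T -> 'M[k]_(mdim Y, mdim X)} :=
  HB.pack (fun a => mact Y a *m h - h *m mact X a) (GRing.isLinear.Build k _ _ _ _ fL).
exact: (lfunE f).
Qed.

Lemma inner_linear X Y : linear (@inner_derivation X Y).
Proof.
move=> c h h'; apply/lfunP=> a; rewrite add_lfunE scale_lfunE !innerE.
by rewrite mulmxDr mulmxDl -scalemxAl -scalemxAr scalerBr opprD addrACA.
Qed.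

Lemma lin_closed_div_linear X Y : lin_closed (@div_linear X Y).
Proof.
split=> [i a|c g h gD hD i a]; first by rewrite mul0mx mulmx0.
by rewrite mulmxDr mulmxDl -scalemxAl -scalemxAr gD hD.
Qed.

Lemma lin_closed_div_cocycle X Y : lin_closed (@div_cocycle X Y).
Proof.
have cc := lin_closed_cocycle X Y.
split=> [|c g h [gZ g0] [hZ h0]]; split.
- by case: cc.
- by move=> i a; rewrite lfunE.
- by case: cc => _; apply.
- by move=> i a; rewrite add_lfunE scale_lfunE g0 h0 scaler0 addr0.
Qed.

(* The primitive of d on the separable algebra prod_i D_i is obtained by
   averaging over the finite groups D_i^*, of order - 1 in k. *)
Lemma cocycle_inner_on_div X Y (d : 'Hom(T, 'M[k]_(mdim Y, mdim X))) :
  ext_cocycle d -> exists h, forall i a,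
    d (sm_div (ta_map T) i a) = @inner_derivation X Y h (sm_div (ta_map T) i a).
Proof.
move=> dZ; pose del i (a : sp_div S i) := d (sm_div (ta_map T) i a).
have delM i (a b : sp_div S i) : del i (a * b) = dact Y a *m del i b + del i a *m dact X b.
  by rewrite /del sm_divM dZ.
have delO i j (a : sp_div S i) (b : sp_div S j) : i != j ->
    dact Y a *m del j b = - (del i a *m dact X b).
  move=> ij; have := dZ (sm_div (ta_map T) i a) (sm_div (ta_map T) j b).
  by rewrite sm_orth // linear0 => /esym/eqP; rewrite addr_eq0 => /eqP.
(* The term x = 0 vanishes, as the inverse of 0 is 0; the sum thus runs over D_j^*. It stands for
   the average up to sign, the sign being that of the order - 1. *)
pose hh j := \sum_(x : finvect_type (sp_div S j)) del j x *m @dact _ _ _ _ X j (x : sp_div S j)^-1.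
exists (\sum_j hh j) => i b; rewrite innerE -/(dact Y b) -/(dact X b) -/(del i b).
have xxV j (M : 'M_(mdim Y, mdim X)) :
   \sum_(x : finvect_type (sp_div S j)) M *m @dact _ _ _ _ X j (x : sp_div S j) *m
      @dact _ _ _ _ X j (x : sp_div S j)^-1 = - (M *m @dact _ _ _ _ X j 1).
  under eq_bigr do rewrite -mulmxA -dactM.
  rewrite (bigD1 (0 : finvect_type (sp_div S j))) //= mul0r.
  have -> : @dact _ _ _ _ X j 0 = 0 by rewrite /dact !linear0.
  rewrite mulmx0 add0r (eq_bigr (fun=> M *m @dact _ _ _ _ X j 1)); last first.
    by move=> x x0; rewrite mulrV // sp_divP.
  rewrite sumr_const cardC1 -scaler_nat -subn1 natrB ?finvect_sum1 ?sub0r ?scaleN1r //.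
  by apply/card_gt0P; exists (0 : finvect_type (sp_div S j)).
have hb j : j != i -> hh j *m dact X b = 0.
  move=> ji; rewrite mulmx_suml big1 // => x _.
  by rewrite -mulmxA dact_orth // mulmx0.
have bh j : j != i -> dact Y b *m hh j = del i b *m @dact _ _ _ _ X j 1.
  move=> ji; rewrite mulmx_sumr -[RHS]opprK -xxV -sumrN.
  by apply: eq_bigr => x _; rewrite mulmxA delO 1?eq_sym // mulNmx.
have bhi : dact Y b *m hh i = hh i *m dact X b + del i b *m @dact _ _ _ _ X i 1.
  have [->|b0] := eqVneq b 0.
    have d0 M : @dact _ _ _ T M i 0 = 0 by rewrite /dact !linear0.
    by rewrite !d0 /del !linear0 !mul0mx ?mulmx0 addr0.
  rewrite -[X in _ + X]opprK -xxV mulmx_sumr.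
  (* The Leibniz rule replaces b d(x) by d(b x) - d(b) x. Reindexing by the permutation x |-> b x
     then moves b to the right of the sum. *)
  rewrite (eq_bigr (fun x : finvect_type (sp_div S i) =>
      del i (b * (x : sp_div S i)) *m @dact _ _ _ _ X i (x : sp_div S i)^-1 -
      del i b *m @dact _ _ _ _ X i (x : sp_div S i) *m @dact _ _ _ _ X i (x : sp_div S i)^-1)).
    rewrite big_split /= sumrN; congr (_ - _).
    rewrite mulmx_suml [RHS](reindex_inj (h := fun x : finvect_type (sp_div S i) => b * (x : sp_div S i))) /=.
      apply: eq_bigr => x _; rewrite -mulmxA -dactM.
      have bU := sp_divP b0; have [->|x0] := eqVneq (x : sp_div S i) 0.
        by rewrite mulr0 !invr0 mul0r.
      by rewrite invrM ?sp_divP // mulrVK.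
    by move=> x y; apply: mulrI; apply: sp_divP.
  by move=> x _; rewrite delM mulmxDl addrK mulmxA.
rewrite mulmx_sumr mulmx_suml (bigD1 i) //= [X in _ - X](bigD1 i) //=.
rewrite [X in _ - (_ + X)]big1 // addr0 bhi (eq_bigr _ bh).
rewrite addrAC [X in X + _]addrAC subrr add0r -mulmx_sumr -mulmxDr.
by have := dact_sum1 X; rewrite (bigD1 i) //= => ->; rewrite mulmx1.
Qed.

(** Taking inner derivations maps [div_linear] onto the coboundaries vanishing on the D_i, with
    kernel Hom(X, Y); and cocycles modulo coboundaries can be computed with those vanishing on the
    D_i. The equation compares the two counts. *)
Lemma hom_ext_div X Y : (homdim X Y + sdim (@div_cocycle X Y) =
  extdim X Y + sdim (@div_linear X Y))%N.
Proof.
pose cob := @ext_coboundary k T X Y; pose coc := @ext_cocycle k T X Y.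
have cobc : lin_closed cob by apply: lin_closed_coboundary.
have cocc : lin_closed coc by apply: lin_closed_cocycle.
have dcc := lin_closed_div_cocycle X Y; have dlc := lin_closed_div_linear X Y.
have iL := @inner_linear X Y.
have cobE h : cob (inner_derivation h) by exists h => a; rewrite innerE.
(* The inner derivation of h vanishes on the D_i exactly when h is linear over them, and vanishes on
   T exactly when h is a homomorphism. *)
have E1 : sdim (@div_linear X Y) = (homdim X Y + sdim (cob `&` @div_cocycle X Y))%N.
  rewrite -(sdim_ker_im iL dlc) homdimE; congr (_ + _)%N; congr sdim.
    apply/seteqP; split=> h.
      case=> _ /lfunP h0 a; have /eqP := h0 a.
      by rewrite innerE lfunE /= subr_eq0 => /eqP.
    move=> hH; split=> [i a|]; first exact: hH.
    by apply/lfunP=> a; rewrite innerE hH subrr lfunE.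
  apply/seteqP; split=> [_ [h hD <-]|d [[h hE] [dZ d0]]].
    split=> //; split; first exact/coboundary_cocycle/cobE.
    by move=> i a; rewrite innerE [_ *m mact X _]hD subrr.
  exists h; last by apply/lfunP=> a; rewrite innerE hE.
  by move=> i a; apply/esym/eqP; rewrite -subr_eq0 -[_ - _]hE d0.
(* The cocycles are the sum of the coboundaries and of [div_cocycle], by the averaging argument. *)
have E2 : (sdim coc + sdim (cob `&` @div_cocycle X Y) =
    sdim cob + sdim (@div_cocycle X Y))%N.
  rewrite /sdim -[RHS]dimv_sum_cap; congr addn; congr dimv; apply/vspaceP=> d; apply/idP/idP.
  - move=> /(vspP _ cocc) dZ; have [h hE] := cocycle_inner_on_div dZ.
    rewrite -[d](subrK (inner_derivation h)) addrC memv_add //; first exact/vspP.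
    apply/vspP => //; split; first by apply: (lin_closedB cocc) => //; apply: coboundary_cocycle; apply: cobE.
    by move=> i a; rewrite add_lfunE opp_lfunE hE subrr.
  - move=> /memv_addP[d1 /(vspP _ cobc)d1B [d2 /(vspP _ dcc)[d2Z _] ->]].
    by apply/vspP => //; apply: (lin_closedD cocc) => //; apply: coboundary_cocycle.
  - move=> /vspP dI; have [|dB dD] := dI _.
      split=> [|c x y [xB xD] [yB yD]]; first by split; [case: cobc|case: dcc].
      by split; [case: cobc => _; apply|case: dcc => _; apply].
    by rewrite memv_cap; apply/andP; split; apply/vspP.
  - move=> /memv_capP[/(vspP _ cobc)dB /(vspP _ dcc)dD]; apply/vspP => //.
    split=> [|c x y [xB xD] [yB yD]]; first by split; [case: cobc|case: dcc].
    by split; [case: cobc => _; apply|case: dcc => _; apply].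
have E3 := extdimE X Y; rewrite -/cob -/coc in E3.
apply/eqP; rewrite -(eqn_add2l (sdim cob)) E1 [(_ + (extdim _ _ + _))%N]addnA.
by rewrite [(sdim cob + extdim _ _)%N]addnC E3 addnCA -E2 addnCA.
Qed.

End EulerForm.

Section EulerFormula.
Variables (k : finFieldType) (m : nat) (S : species k m) (T : tensor_algebra S).
Implicit Types X Y M : fdmod T.

Definition vertex_rank M i : nat := absz (dimvec M i 0).

Lemma vertex_rankE M i : dimvec M i 0 = (vertex_rank M i)%:Z.
Proof. by rewrite /vertex_rank mxE. Qed.

Lemma sdim_comp M i : sdim (@vertex_part _ _ _ _ M i setT) = (\dim {: sp_div S i} * vertex_rank M i)%N.
Proof. by apply/eqP; rewrite -eqz_nat PoszM -vertex_rankE dimvec_subE. Qed.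

Lemma comp_id M i x : @vertex_part _ _ _ _ M i setT x -> @dact _ _ _ _ M i 1 *m x = x.
Proof. by case=> u _ <-; rewrite mulmxA -dactM mulr1. Qed.

Lemma comp_dact M i a x : @vertex_part _ _ _ _ M i setT (@dact _ _ _ _ M i a *m x).
Proof. by exists (@dact _ _ _ _ M i a *m x); rewrite // mulmxA -dactM mul1r. Qed.

Lemma dact_comp0 M i j a x : i != j -> @vertex_part _ _ _ _ M j setT x -> @dact _ _ _ _ M i a *m x = 0.
Proof. by move=> ij [u _ <-]; rewrite mulmxA dact_orth // mul0mx. Qed.

Lemma dactl_linear M i (x : 'cV[k]_(mdim M)) : linear (fun a => @dact _ _ _ _ M i a *m x).
Proof. by move=> c a b; rewrite dact_linear mulmxDl -scalemxAl. Qed.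

Lemma stable_comp M i : forall a w, @vertex_part _ _ _ _ M i setT w ->
  @vertex_part _ _ _ _ M i setT (@dact _ _ _ _ M i a *m w).
Proof. by move=> a w _; apply: comp_dact. Qed.

Definition colmap m1 n1 (F : 'M[k]_(m1, n1)) : 'Hom('cV[k]_n1, 'cV[k]_m1) := linfun (mulmx F).

Lemma colmapE m1 n1 (F : 'M[k]_(m1, n1)) x : colmap F x = F *m x.
Proof. exact: lfunE. Qed.

(** Hom_(D_i)(e_i X, e_i Y), in the form of [div_hom]. *)
Definition comp_hom X Y i : set 'Hom('cV[k]_(mdim X), 'cV[k]_(mdim Y)) :=
  div_hom (fun a x => @dact _ _ _ _ X i a *m x) (fun a x => @dact _ _ _ _ Y i a *m x)
    (@vertex_part _ _ _ _ Y i setT).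
Arguments comp_hom : clear implicits.

Lemma lin_closed_comp_hom X Y i : lin_closed (comp_hom X Y i).
Proof.
apply: lin_closed_div_hom => [a|]; first exact: mulmx_linear.
exact/lin_closed_comp/lin_closedT.
Qed.

Lemma sdim_comp_hom X Y i :
  sdim (comp_hom X Y i) = (\dim {: sp_div S i} * (vertex_rank X i * vertex_rank Y i))%N.
Proof.
apply/eqP; rewrite -(eqn_pmul2l (sp_div_gt0 S i)); apply/eqP.
rewrite (sdim_div_hom (@sp_divP _ _ S i)) -/(vertex_part i setT) ?sdim_comp.
- by rewrite mulnACA -mulnA.
- exact: dactl_linear.
- by move=> a; apply: mulmx_linear.
- exact: dactl_linear.
- by move=> a; apply: mulmx_linear.
- by move=> a b u; rewrite dactM mulmxA.
- by move=> a b u; rewrite dactM mulmxA.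
- exact/lin_closed_comp/lin_closedT.
- exact: stable_comp.
- exact: comp_id.
Qed.

(** A map linear over prod_i D_i is a family of D_i-linear maps from e_i X to e_i Y, obtained by
    composing with the idempotents e_i. *)
Lemma sdim_div_linear X Y : sdim (@div_linear _ _ _ T X Y) =
  (\sum_i \dim {: sp_div S i} * (vertex_rank X i * vertex_rank Y i))%N.
Proof.
under eq_bigr do rewrite -sdim_comp_hom.
apply: (@sdim_separated _ _ _ _ (fun i h => colmap (h *m @dact _ _ _ _ X i 1))).
- move=> i c g h; apply/lfunP=> x; rewrite add_lfunE scale_lfunE !colmapE.
  by rewrite mulmxDl -scalemxAl mulmxDl -scalemxAl.
- exact: lin_closed_div_linear.
- by move=> i; apply: lin_closed_comp_hom.
- move=> i h hD; split=> [a u|u|u]; rewrite !colmapE.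
  + by rewrite !mulmxA -hD -!(mulmxA h) -!dactM mul1r mulr1.
  + by rewrite !mulmxA -!(mulmxA h) -!dactM mulr1.
  + by rewrite hD -mulmxA; apply: comp_dact.
- move=> h hD h0; rewrite -[h]mulmx1 -(dact_sum1 X) mulmx_sumr big1 // => i _.
  by apply: mulmx_ext => x; rewrite -colmapE h0 lfunE mul0mx.
- move=> i y [ya y1 yW]; have [H HE0] := lin_mulmx_col (linearP y).
  have HE x : H *m x = y x by apply: HE0.
  exists H; split.
  + move=> j a; apply: mulmx_ext => x; rewrite -!mulmxA !HE.
    have [ji|ji] := eqVneq j i; first by subst j; apply: ya.
    rewrite -y1 mulmxA dact_orth 1?eq_sym // mul0mx linear0.
    by rewrite (dact_comp0 _ ji).
  + by apply/lfunP=> x; rewrite colmapE -mulmxA HE y1.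
  + move=> j ji; apply/lfunP=> x; rewrite colmapE -mulmxA HE lfunE /=.
    by rewrite -y1 mulmxA dact_orth 1?eq_sym // mul0mx linear0.
Qed.

(** The left D_i-structure on Hom(S_ij, V) induced by the right action on S_ij. *)
Definition arr_act (V : vectType k) i j (a : sp_div S i) (psi : 'Hom(sp_arr S i j, V)) :
    'Hom(sp_arr S i j, V) := linfun (fun x => psi (sp_r x a)).

Lemma arr_actE (V : vectType k) i j a (psi : 'Hom(sp_arr S i j, V)) x :
  arr_act a psi x = psi (sp_r x a).
Proof.
have fL : linear (fun x => psi (sp_r x a)) by move=> c u v; rewrite sp_rPl linearP.
exact: (lfunE (HB.pack_for {linear sp_arr S i j -> V} (fun x => psi (sp_r x a))
  (GRing.isLinear.Build k _ _ _ _ fL))).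
Qed.

Definition arr_hom Y i j : set 'Hom(sp_arr S i j, 'cV[k]_(mdim Y)) :=
  div_hom (fun a x => sp_l a x) (fun a y => @dact _ _ _ _ Y j a *m y)
    (@vertex_part _ _ _ _ Y j setT).
Arguments arr_hom : clear implicits.

Lemma lin_closed_arr_hom Y i j : lin_closed (arr_hom Y i j).
Proof.
apply: lin_closed_div_hom => [a|]; first exact: mulmx_linear.
exact/lin_closed_comp/lin_closedT.
Qed.

Lemma sdim_arr_hom Y i j :
  sdim (arr_hom Y i j) = (\dim {: sp_arr S i j} * vertex_rank Y j)%N.
Proof.
apply/eqP; rewrite -(eqn_pmul2l (sp_div_gt0 S j)); apply/eqP.
rewrite (sdim_div_hom (@sp_divP _ _ S j)) -/(vertex_part j setT) ?sdim_comp.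
- rewrite mulnCA; congr (_ * (_ * _))%N; rewrite -sdimT; congr sdim.
  by apply/seteqP; split=> // x _; exists x => //; apply: sp_l1.
- by move=> u c a b; apply: sp_lPl.
- by move=> a c x y; apply: sp_lPr.
- exact: dactl_linear.
- by move=> a; apply: mulmx_linear.
- by move=> a b u; apply: sp_lM.
- by move=> a b u; rewrite dactM mulmxA.
- exact/lin_closed_comp/lin_closedT.
- exact: stable_comp.
- exact: comp_id.
Qed.

(** Hom_(D_i)(e_i X, Hom_(D_j)(S_ij, e_j Y)), the adjoint form of Hom_(D_j)(S_ij (x) e_i X, e_j Y)
    with the tensor product over D_i. It avoids constructing tensor products, and two uses of
    [sdim_div_hom] give its dimension. *)
Definition arr_hom2 X Y i j : set 'Hom('cV[k]_(mdim X), 'Hom(sp_arr S i j, 'cV[k]_(mdim Y))) :=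
  div_hom (fun a x => @dact _ _ _ _ X i a *m x) (fun a psi => arr_act a psi) (arr_hom Y i j).
Arguments arr_hom2 : clear implicits.

Lemma arr_act_linear (V : vectType k) i j (a : sp_div S i) :
  linear (@arr_act V i j a).
Proof.
by move=> c f g; apply/lfunP=> x; rewrite add_lfunE scale_lfunE !arr_actE add_lfunE scale_lfunE.
Qed.

Lemma lin_closed_arr_hom2 X Y i j : lin_closed (arr_hom2 X Y i j).
Proof.
apply: lin_closed_div_hom => [a|]; first exact: arr_act_linear.
exact/lin_closed_arr_hom.
Qed.

Lemma sdim_arr_hom2 X Y i j :
  sdim (arr_hom2 X Y i j) = (vertex_rank X i * \dim {: sp_arr S i j} * vertex_rank Y j)%N.
Proof.
apply/eqP; rewrite -(eqn_pmul2l (sp_div_gt0 S i)); apply/eqP.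
rewrite (sdim_div_hom (@sp_divP _ _ S i)) -/(vertex_part i setT) ?sdim_comp.
- by rewrite sdim_arr_hom !mulnA.
- exact: dactl_linear.
- by move=> a; apply: mulmx_linear.
- move=> f c a b; apply/lfunP=> x; rewrite add_lfunE scale_lfunE !arr_actE.
  by rewrite sp_rPr linearP.
- by move=> a; apply: arr_act_linear.
- by move=> a b u; rewrite dactM mulmxA.
- by move=> a b f; apply/lfunP=> x; rewrite !arr_actE sp_rM.
- exact: lin_closed_arr_hom.
- move=> a f [fa f1 fW]; split=> [b x|x|x]; rewrite !arr_actE.
  + by rewrite -sp_lr fa.
  + by rewrite sp_l1.
  + exact: fW.
- by move=> f _; apply/lfunP=> x; rewrite arr_actE sp_r1.
Qed.

Definition cocycle_arr X Y i j (d : 'Hom(T, 'M[k]_(mdim Y, mdim X))) :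
    'Hom('cV[k]_(mdim X), 'Hom(sp_arr S i j, 'cV[k]_(mdim Y))) :=
  linfun (fun v => linfun (fun x => d (sm_arr (ta_map T) i j x) *m v)).

Lemma cocycle_arrE X Y i j d v x :
  @cocycle_arr X Y i j d v x = d (sm_arr (ta_map T) i j x) *m v.
Proof.
pose f v : 'Hom(sp_arr S i j, 'cV[k]_(mdim Y)) :=
  linfun (fun x => d (sm_arr (ta_map T) i j x) *m v).
have fE u y : f u y = d (sm_arr (ta_map T) i j y) *m u.
  have fL : linear (fun x => d (sm_arr (ta_map T) i j x) *m u).
    by move=> c a b; rewrite !linearP mulmxDl -scalemxAl.
  exact: (lfunE (HB.pack_for {linear sp_arr S i j -> 'cV[k]_(mdim Y)} (fun x => d (sm_arr (ta_map T) i j x) *m u)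
    (GRing.isLinear.Build k _ _ _ _ fL))).
have fL : linear f.
  move=> c u w; apply/lfunP=> y; rewrite add_lfunE scale_lfunE !fE.
  by rewrite mulmxDr -scalemxAr.
rewrite -fE; congr (fun_of_lfun _ _).
exact: (lfunE (HB.pack_for {linear 'cV[k]_(mdim X) -> 'Hom(sp_arr S i j, 'cV[k]_(mdim Y))} f
    (GRing.isLinear.Build k _ _ _ _ fL))).
Qed.

(** A derivation vanishing on the D_i restricts to a bimodule map on each S_ij. It is determined by
    these restrictions, and by [cocycle_exists] they can be prescribed independently. *)
Lemma sdim_div_cocycle X Y : sdim (@div_cocycle _ _ _ T X Y) =
  (\sum_(p : 'I_m * 'I_m) vertex_rank X p.1 * \dim {: sp_arr S p.1 p.2} * vertex_rank Y p.2)%N.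
Proof.
under eq_bigr do rewrite -sdim_arr_hom2.
apply: (@sdim_separated _ _ _ _ (fun p d => @cocycle_arr X Y p.1 p.2 d)).
- move=> p c g h; apply/lfunP=> v; rewrite add_lfunE scale_lfunE; apply/lfunP=> x.
  rewrite add_lfunE scale_lfunE !cocycle_arrE add_lfunE scale_lfunE.
  by rewrite mulmxDl -scalemxAl.
- exact: lin_closed_div_cocycle.
- by move=> p; apply: lin_closed_arr_hom2.
- move=> [i j] d [dZ d0] /=.
  have dl a x : d (sm_arr (ta_map T) i j (sp_l a x)) = dact Y a *m d (sm_arr (ta_map T) i j x).
    by rewrite sm_l dZ d0 mul0mx addr0.
  have dr a x : d (sm_arr (ta_map T) i j (sp_r x a)) = d (sm_arr (ta_map T) i j x) *m dact X a.
    by rewrite sm_r dZ d0 mulmx0 add0r.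
  split=> [a u|u|u].
  + by apply/lfunP=> x; rewrite arr_actE !cocycle_arrE dr mulmxA.
  + by apply/lfunP=> x; rewrite !cocycle_arrE mulmxA -dr sp_r1.
  + split=> [a x|x|x]; rewrite !cocycle_arrE.
    * by rewrite dl mulmxA.
    * by rewrite sp_l1.
    * by rewrite -[x]sp_l1 dl -mulmxA; apply: comp_dact.
- move=> d [dZ d0] dp; apply: (@cocycle_ext _ _ _ T X Y) => //.
  + by case: (lin_closed_cocycle X Y).
  + by move=> i a; rewrite d0 lfunE.
  + move=> i j x; rewrite [RHS]lfunE /=; apply: mulmx_ext => v.
    by rewrite -cocycle_arrE (dp (i, j)) lfunE /= lfunE mul0mx.
- move=> [i0 j0] F [Fa F1 FW]; set p := (i0, j0).
  have HP x : linear (fun v => F v x) by move=> c u v; rewrite linearP add_lfunE scale_lfunE.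
  have /choice[H HE] x := lin_mulmx_col (HP x).
  have HL : linear H.
    by move=> c x y; apply: mulmx_ext => v; rewrite HE linearP mulmxDl -scalemxAl !HE.
  have [G GE] := linearP_lfun HL.
  pose W (q : 'I_m * 'I_m) := 'Hom(sp_arr S q.1 q.2, 'M[k]_(mdim Y, mdim X)).
  (* The family of bimodule maps equal to G on the arrows of the pair p and to 0 on all others; the
     update is dependent because the source varies with the pair. *)
  pose phi := @dfwith _ W (fun q => 0) p G.
  have phip : phi p = G by apply: dfwith_in.
  have phiq q : p != q -> phi q = 0 by move=> pq; apply: dfwith_out.
  have GFE x v : G x *m v = F v x by rewrite GE HE.
  have phil q a x : phi q (sp_l a x) = @dact _ _ _ T Y q.2 a *m phi q x.
    move: a x; rewrite /phi; case: (dfwithP _ _ q) => [|r _] a x.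
      apply: mulmx_ext => v; rewrite -mulmxA !GFE.
      by have [-> _ _] := FW v.
    by rewrite !lfunE /= mulmx0.
  have phir q a x : phi q (sp_r x a) = phi q x *m @dact _ _ _ T X q.1 a.
    move: a x; rewrite /phi; case: (dfwithP _ _ q) => [|r _] a x.
      by apply: mulmx_ext => v; rewrite -mulmxA !GFE Fa arr_actE.
    by rewrite !lfunE /= mul0mx.
  have [d [dZ d0 da]] := cocycle_exists (fun i j => phil (i, j)) (fun i j => phir (i, j)).
  exists d; split=> //.
    apply/lfunP=> v; apply/lfunP=> x; rewrite cocycle_arrE da.
    by rewrite [phi _]phip GFE.
  move=> [i j] qp; apply/lfunP=> v; apply/lfunP=> x; rewrite cocycle_arrE da.
  by rewrite phiq 1?eq_sym // !zero_lfunE mul0mx.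
Qed.

Definition euler_form : 'M[int]_m :=
  \matrix_(i, j) ((i == j)%:Z * (\dim {: sp_div S i})%:Z - (\dim {: sp_arr S i j})%:Z).

Lemma euler_formP X Y : ((dimvec X)^T *m euler_form *m dimvec Y) 0 0 =
  (homdim X Y)%:Z - (extdim X Y)%:Z.
Proof.
have := hom_ext_div X Y; rewrite sdim_div_linear sdim_div_cocycle.
set A := (\sum_(p : 'I_m * 'I_m) _)%N; set B := (\sum_(i : 'I_m) _)%N.
move=> /(congr1 Posz); rewrite !PoszD => E.
have -> : (homdim X Y)%:Z - (extdim X Y)%:Z = B%:Z - A%:Z.
  by apply/eqP; rewrite subr_eq addrAC eq_sym subr_eq E addrC.
have -> : A%:Z = \sum_i \sum_j dimvec X i 0 * (\dim {: sp_arr S i j})%:Z * dimvec Y j 0.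
  rewrite /A (big_morph Posz PoszD erefl) pair_bigA.
  by apply: eq_bigr => p _; rewrite !vertex_rankE !PoszM.
have -> : B%:Z = \sum_i \sum_j dimvec X i 0 * ((i == j)%:Z * (\dim {: sp_div S i})%:Z) * dimvec Y j 0.
  rewrite /B (big_morph Posz PoszD erefl); apply: eq_bigr => i _.
  rewrite (bigD1 i) //= eqxx mul1r big1 ?addr0 ?vertex_rankE => [|j /negPf ji].
    by rewrite !PoszM mulrA; congr (_ * _); rewrite mulrC.
  by rewrite eq_sym ji mul0r mulr0 mul0r.
rewrite -sumrB mxE; under eq_bigr do rewrite mxE mulr_suml.
rewrite exchange_big; apply: eq_bigr => i _; rewrite -sumrB; apply: eq_bigr => j _.
by rewrite !mxE mulrBr mulrBl.
Qed.

(** [euler_form] satisfies the defining condition of [euler_mx], so the choice succeeds, and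
    whichever matrix it returns has the property. *)
Lemma eulerP X Y : euler T (dimvec X) (dimvec Y) = (homdim X Y)%:Z - (extdim X Y)%:Z.
Proof.
rewrite /euler /euler_mx; case: xgetP => [b _ ->//|nb].
by case: (nb euler_form); apply: euler_formP.
Qed.

End EulerFormula.

(** * Vertex simples *)

Section Schur.
Variables (k : fieldType) (A : falgType k).
Implicit Types X Y M : fdmod A.

Lemma schur M (f : 'M[k]_(mdim M)) :
  simple_mod M -> @is_hom _ _ M M f -> f <> 0 -> f \in unitmx.
Proof.
move=> [_ Ms] fH f0; have [K0|KT] := Ms _ (stable_ker fH (@stableT _ _ M)).
  rewrite -unitmx_tr -row_free_unit -kermx_eq0; apply/eqP/row_matrixP => i.
  have : [set u | setT u /\ f *m u = 0] (row i (kermx f^T))^T.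
    split=> //; apply: trmx_inj; rewrite trmx_mul trmxK trmx0.
    by apply/sub_kermxP; apply: row_sub.
  by rewrite K0 => /= /(congr1 trmx); rewrite trmxK trmx0 => ->; rewrite row0.
case: f0; apply: mulmx_ext => x; rewrite mul0mx.
by have : [set: 'cV[k]_(mdim M)] x by []; rewrite -KT => -[].
Qed.

Lemma hom_invmx M (f : 'M[k]_(mdim M)) :
  @is_hom _ _ M M f -> f \in unitmx -> @is_hom _ _ M M (invmx f).
Proof.
move=> fH fU a; apply: (can_inj (mulKmx fU)).
by rewrite mulKVmx // mulmxA fH -mulmxA mulmxV // mulmx1.
Qed.

Lemma simple_endV M (f : 'M[k]_(mdim M)) : simple_mod M -> @is_hom _ _ M M f -> f <> 0 ->
  exists2 g, @is_hom _ _ M M g & g *m f = 1%:M /\ f *m g = 1%:M.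
Proof.
move=> Ms fH f0; have fU := schur Ms fH f0; exists (invmx f).
  exact: hom_invmx.
by rewrite mulVmx // mulmxV.
Qed.

(** End Y is a division ring by Schur's lemma, and it acts on cocycles preserving coboundaries, so
    [rank_overE] applies. *)
Lemma extdim_leftE X Y : simple_mod Y ->
  (homdim Y Y * extdim_left X Y)%N = extdim X Y.
Proof.
move=> Ys; apply/eqP; rewrite -(eqn_add2r (sdim (@ext_coboundary k A X Y))) extdimE.
apply/eqP; rewrite homdimE; pose act (f : 'M[k]_(mdim Y)) (d : 'Hom(A, 'M[k]_(mdim Y, mdim X))) :=
   linfun (fun a => f *m d a) : 'Hom(A, 'M[k]_(mdim Y, mdim X)).
have actE f d a : act f d a = f *m d a.
  have fL : linear (fun a => f *m d a).
    by move=> c b b'; rewrite linearP mulmxDr -scalemxAr.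
  exact: (lfunE (HB.pack_for {linear A -> 'M[k]_(mdim Y, mdim X)} (fun a => f *m d a)
    (GRing.isLinear.Build k _ _ _ _ fL))).
apply: (@rank_overE k _ _ _ act).
- exact: lin_closed_hom.
- exact: lin_closed_cocycle.
- move=> d c f g; apply/lfunP=> a; rewrite add_lfunE scale_lfunE !actE.
  by rewrite mulmxDl -scalemxAl.
- move=> f c d e; apply/lfunP=> a; rewrite !(add_lfunE, scale_lfunE, actE).
  by rewrite mulmxDr -scalemxAr.
- move=> f d fH dZ a b; rewrite !actE dZ mulmxDr !mulmxA; congr (_ *m _ + _).
  exact: fH.
- move=> f g fH gH; exists (f *m g); first exact: (@hom_mul _ _ Y Y Y).
  by move=> d _; apply/lfunP=> a; rewrite !actE mulmxA.
- exists 1%:M; first exact: hom_id.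
  by move=> d _; apply/lfunP=> a; rewrite actE mul1mx.
- move=> f fH /(simple_endV Ys fH)[g gH [gf _]]; exists g => // d _.
  by apply/lfunP=> a; rewrite !actE mulmxA gf mul1mx.
- split; [exact: lin_closed_coboundary|exact: coboundary_cocycle|].
  move=> f d fH [h hE]; exists (f *m h) => a.
  by rewrite actE hE mulmxBr !mulmxA fH.
Qed.

Lemma extdim_rightE X Y : simple_mod X ->
  (homdim X X * extdim_right X Y)%N = extdim X Y.
Proof.
move=> Xs; apply/eqP; rewrite -(eqn_add2r (sdim (@ext_coboundary k A X Y))) extdimE.
apply/eqP; rewrite homdimE; pose act (f : 'M[k]_(mdim X)) (d : 'Hom(A, 'M[k]_(mdim Y, mdim X))) :=
   linfun (fun a => d a *m f) : 'Hom(A, 'M[k]_(mdim Y, mdim X)).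
have actE f d a : act f d a = d a *m f.
  have fL : linear (fun a => d a *m f).
    by move=> c b b'; rewrite linearP mulmxDl -scalemxAl.
  exact: (lfunE (HB.pack_for {linear A -> 'M[k]_(mdim Y, mdim X)} (fun a => d a *m f)
    (GRing.isLinear.Build k _ _ _ _ fL))).
apply: (@rank_overE k _ _ _ act).
- exact: lin_closed_hom.
- exact: lin_closed_cocycle.
- move=> d c f g; apply/lfunP=> a; rewrite add_lfunE scale_lfunE !actE.
  by rewrite mulmxDr -scalemxAr.
- move=> f c d e; apply/lfunP=> a; rewrite !(add_lfunE, scale_lfunE, actE).
  by rewrite mulmxDl -scalemxAl.
- move=> f d fH dZ a b; rewrite !actE dZ mulmxDl -!mulmxA; congr (_ + _ *m _).
  by rewrite fH.
(* The product is reversed because the endomorphisms of X act on the right. *)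
- move=> f g fH gH; exists (g *m f); first exact: (@hom_mul _ _ X X X).
  by move=> d _; apply/lfunP=> a; rewrite !actE mulmxA.
- exists 1%:M; first exact: hom_id.
  by move=> d _; apply/lfunP=> a; rewrite actE mulmx1.
- move=> f fH /(simple_endV Xs fH)[g gH [_ fg]]; exists g => // d _.
  by apply/lfunP=> a; rewrite !actE -mulmxA fg mulmx1.
- split; [exact: lin_closed_coboundary|exact: coboundary_cocycle|].
  move=> f d fH [h hE]; exists (h *m f) => a.
  by rewrite actE hE mulmxBl -!mulmxA fH.
Qed.

End Schur.

Section VertexSimple.
Variables (k : finFieldType) (m : nat) (Qt : valued_quiver m) (S : species k m).
Hypotheses (acQ : acyclic Qt) (S_Qt : species_of Qt S).
Variable T : tensor_algebra S.
Implicit Types M : fdmod T.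

Let arr_rel i j := (0 < arrows Qt i j)%N.

(** Take j in P from which the fewest vertices can be reached. An arrow from j to l in P would make
    l reach strictly fewer, as a path from l back to j would close a cycle. *)
Lemma acyclic_sink (P : pred 'I_m) i : P i ->
  exists2 j, P j & forall l, P l -> ~~ arr_rel j l.
Proof.
move=> Pi; case: (arg_minnP (fun j => #|connect arr_rel j|) Pi) => j Pj jmin.
exists j => // l Pl; apply/negP => jl.
have := jmin l Pl; rewrite leqNgt => /negP; apply; apply: proper_card.
apply/properP; split.
  by apply/fintype.subsetP=> x; rewrite !inE; apply: connect_trans; apply: connect1.
exists j; first exact: connect0.
apply/negP => /connectP[p pP pj].
have /negP := acQ (isT : l :: p != [::]); apply.
by rewrite /= rcons_path pP -pj.
Qed.

Lemma arr0 i j (x : sp_arr S i j) : ~~ arr_rel i j -> x = 0.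
Proof.
rewrite /arr_rel -eqn0Ngt => /eqP a0; case: S_Qt => _ /(_ i j).
rewrite a0 mul0n => /eqP; rewrite dimv_eq0 => /eqP E.
by have := memvf x; rewrite E memv0 => /eqP.
Qed.

Lemma mact_arr M i j (x : sp_arr S i j) :
  mact M (sm_arr (ta_map T) i j x) =
  @dact _ _ _ _ M j 1 *m mact M (sm_arr (ta_map T) i j x) *m @dact _ _ _ _ M i 1.
Proof. by rewrite -[in LHS](sp_l1 x) -[in LHS](sp_r1 (sp_l 1 x)) sm_r sm_l !mactM. Qed.

Lemma stable_generators M (U : set 'cV[k]_(mdim M)) : lin_closed U ->
  (forall i a u, U u -> U (@dact _ _ _ _ M i a *m u)) ->
  (forall i j x u, U u -> U (mact M (sm_arr (ta_map T) i j x) *m u)) -> stable U.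
Proof.
move=> Uc Ud Ua; split; [by case: Uc|by move=> x y; apply: lin_closedD|].
move=> a; apply: (@tensor_algebra_generated _ _ _ T
  [set a | forall u, U u -> U (mact M a *m u)]) => /=.
- split=> [u _|c x y xU yU u Uu]; first by rewrite linear0 mul0mx; case: Uc.
  rewrite mactD mactZ mulmxDl -scalemxAl; case: Uc => _; apply; auto.
- by move=> u; rewrite mact1 mul1mx.
- by move=> x y xU yU u Uu; rewrite mactM -mulmxA; auto.
- by move=> i x u; apply: Ud.
- by move=> i j x u; apply: Ua.
Qed.

(** Let j be a sink among the vertices where M does not vanish. Then e_j M is a nonzero submodule,
    so it is M; this forces j = i and kills all arrows. *)
Lemma vertex_simpleE i M : vertex_simple i M ->
  @dact _ _ _ _ M i 1 = 1%:M /\ forall j l x, mact M (sm_arr (ta_map T) j l x) = 0.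
Proof.
move=> [[_ Ms] ei0]; pose P j := @dact _ _ _ _ M j 1 != 0.
have Pi : P i by apply/eqP.
have [j Pj jsink] := acyclic_sink Pi.
(* An arrow starting away from j kills e_j M. One starting at j either ends where M is nonzero,
   which the choice of j excludes, or ends where M vanishes. *)
have arr_eq0 i' l x : mact M (sm_arr (ta_map T) i' l x) *m @dact _ _ _ _ M j 1 = 0.
  have [i'j|i'j] := eqVneq i' j; last by rewrite mact_arr -!mulmxA dact_orth // !mulmx0.
  subst i'; have [Pl|nPl] := boolP (P l); first by rewrite (arr0 x (jsink l Pl)) !linear0 mul0mx.
  by rewrite mact_arr (eqP (negbNE nPl)) !mul0mx.
pose U := @vertex_part _ _ _ _ M j setT.
have Uc : lin_closed U by apply/lin_closed_comp/lin_closedT.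
have Us : stable U.
  apply: stable_generators => // [l a u [v _ <-]|i' l x _ [v _ <-]].
    have [E|lj] := eqVneq l j; first by subst l; apply: comp_dact.
    by rewrite mulmxA dact_orth // mul0mx; case: Uc.
  by rewrite mulmxA arr_eq0 mul0mx; case: Uc.
have [U0|UT] := Ms U Us.
  case/eqP: Pj; apply: mulmx_ext => v; rewrite mul0mx.
  have : U (@dact _ _ _ _ M j 1 *m v) by exists v.
  by rewrite U0.
have ej : @dact _ _ _ _ M j 1 = 1%:M.
  apply: mulmx_ext => v; rewrite mul1mx; apply: comp_id.
  by rewrite -/U UT.
have ij : i = j.
  apply/eqP/negPn/negP => ij; case: ei0; rewrite -/(dact M 1) -[LHS]mulmx1 -ej.
  exact: dact_orth.
by subst j; split=> // i' l x; rewrite -[LHS]mulmx1 -ej arr_eq0.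
Qed.

(** Since arrows act by zero, D_i v is a submodule for every v; for v nonzero it is all of M, and a
    |-> a v is injective on the division algebra D_i. Hence M has dimension d_i. *)
Lemma drank_vertex_simple i M j : vertex_simple i M -> vertex_rank M j = (j == i).
Proof.
move=> Mi; have [e1 arr_eq0] := vertex_simpleE Mi; have [[Mn Ms] _] := Mi.
apply/eqP; rewrite -(eqn_pmul2l (sp_div_gt0 S j)) -sdim_comp; apply/eqP.
have [->|ji] := eqVneq j i; last first.
  rewrite muln0 -[RHS](sdim0 'cV[k]_(mdim M)); congr sdim; apply/seteqP.
  split=> [_ [v _ <-]|_ ->]; last by exists 0 => //; rewrite mulmx0.
  by rewrite -[v]mul1mx -e1 mulmxA dact_orth // mul0mx.
(* An arbitrary nonzero vector, available because M is nonzero. *)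
pose v : 'cV[k]_(mdim M) := const_mx 1.
have v0 : v != 0.
  apply/eqP => /colP/(_ (Ordinal Mn)); rewrite !mxE => /eqP.
  by rewrite oner_eq0.
pose f (a : sp_div S i) := dact M a *m v.
have fL : linear f by apply: dactl_linear.
have Us : @stable _ _ M (f @` setT).
  have Uc := lin_closed_im fL (lin_closedT _).
  apply: stable_generators => // [l a _ [b _ <-]|l l' x _ [b _ <-]].
    have [E|li] := eqVneq l i; last first.
      by rewrite mulmxA dact_orth // mul0mx; case: Uc.
    by subst l; exists (a * b) => //; rewrite /f dactM mulmxA.
  by rewrite arr_eq0 mul0mx; case: Uc.
have fI a : setT a -> f a = 0 -> a = 0.
  move=> _ fa; apply/eqP/negPn/negP => /sp_divP aU; case/eqP: v0.
  by rewrite -[v]mul1mx -e1 -(mulVr aU) dactM -mulmxA [_ *m v]fa mulmx0.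
have [U0|UT] := Ms _ Us.
  case/eqP: v0; have : (f @` setT) (f 1) by exists 1.
  by rewrite U0 /f e1 mul1mx.
rewrite muln1 -sdimT -(sdim_inj fL (lin_closedT _) fI) UT; congr sdim.
by apply/seteqP; split=> // u _; exists u; rewrite // e1 mul1mx.
Qed.

Variable s : 'I_m -> fdmod T.
Hypothesis s_simple : forall i, vertex_simple i (s i).

Lemma dimvec_vertex_simple i : dimvec (s i) = delta_mx i 0.
Proof.
apply/colP=> j; rewrite vertex_rankE (drank_vertex_simple j (s_simple i)) mxE eqxx andbT.
by case: (j == i).
Qed.

Lemma euler_mx_simple i j : euler_mx T i j = (homdim (s i) (s j))%:Z - (extdim (s i) (s j))%:Z.
Proof.
rewrite -eulerP /euler !dimvec_vertex_simple trmx_delta.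
by rewrite -rowE -colE !mxE.
Qed.

(** Hom lies in [div_linear], whose dimension is d_i or 0. For i = j there is no loop at i, so every
    derivation is inner, Ext vanishes, and [hom_ext_div] turns the bound into an equality. *)
Lemma homdim_simple i j : homdim (s i) (s j) = (if i == j then \dim {: sp_div S i} else 0)%N.
Proof.
have sE : sdim (@div_linear _ _ _ T (s i) (s j)) = (if i == j then \dim {: sp_div S i} else 0)%N.
  rewrite sdim_div_linear (bigD1 i) //= big1 => [|l /negPf li].
    rewrite !(drank_vertex_simple _ (s_simple _)) eqxx mul1n addn0.
    by case: eqP => _; rewrite ?muln1 ?muln0.
  by rewrite (drank_vertex_simple _ (s_simple i)) li mul0n muln0.
have le : (homdim (s i) (s j) <= sdim (@div_linear _ _ _ T (s i) (s j)))%N.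
  rewrite homdimE; apply: sdim_le => [||f fH l a]; last exact: fH.
    exact: lin_closed_hom.
  exact: lin_closed_div_linear.
have [ij|ij] := eqVneq i j; last first.
  by apply/eqP; rewrite -leqn0; move: le; rewrite sE (negPf ij).
subst j; have cE : sdim (@div_cocycle _ _ _ T (s i) (s i)) = 0%N.
  rewrite sdim_div_cocycle big1 // => -[l l'] _ /=.
  rewrite !(drank_vertex_simple _ (s_simple _)).
  have [->|] := eqVneq l i; last by rewrite !mul0n.
  have [->|] := eqVneq l' i; last by rewrite muln0.
  case: S_Qt => _ ->; suff -> : arrows Qt i i = 0%N by [].
  by apply/eqP; rewrite eqn0Ngt; have := acQ (isT : [:: i] != [::]); rewrite /= andbT.
have c0 := sdim_eq0 (lin_closed_div_cocycle (s i) (s i)) cE.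
have e0 : extdim (s i) (s i) = 0%N.
  apply: extdim_eq0 => d dZ; have [h hE] := cocycle_inner_on_div dZ.
  suff -> : d = inner_derivation h by exists h => a; rewrite innerE.
  apply/eqP; rewrite -subr_eq0; apply/eqP.
  have : @div_cocycle _ _ _ T (s i) (s i) (d - inner_derivation h).
    split; first apply: (lin_closedB (lin_closed_cocycle _ _)) => //.
      by apply: coboundary_cocycle; exists h => a; rewrite innerE.
    by move=> l a; rewrite add_lfunE opp_lfunE hE subrr.
  by rewrite c0.
have := hom_ext_div (s i) (s i); rewrite cE e0 addn0 sE => ->.
by rewrite eqxx.
Qed.

Definition valuation_mx : 'M[int]_m := diag_mx (\row_i (valuation Qt i)%:Z).

Lemma mul_valuation_mx n (A : 'M[int]_(m, n)) i j : (valuation_mx *m A) i j = (valuation Qt i)%:Z * A i j.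
Proof. by rewrite mul_diag_mx !mxE. Qed.

(** The (i, j) entry is hom - ext on the simples, and ext(S_i, S_j) = d_i r'_ij because End S_i has
    dimension d_i. *)
Lemma euler_mxR' : euler_mx T = valuation_mx *m (1%:M - R'mx s).
Proof.
apply/matrixP=> i j; rewrite mul_valuation_mx euler_mx_simple !mxE mulrBr.
case: S_Qt => dE _; rewrite -dE homdim_simple; congr (_ - _).
  by case: eqP => _; rewrite ?mulr1 ?mulr0.
rewrite -(extdim_rightE _ (s_simple i).1) PoszM homdim_simple eqxx.
by [].
Qed.

Lemma euler_mxR : (euler_mx T)^T = valuation_mx *m (1%:M - Rmx s).
Proof.
apply/matrixP=> i j; rewrite mul_valuation_mx mxE euler_mx_simple !mxE mulrBr.
case: S_Qt => dE _; rewrite -dE homdim_simple; congr (_ - _).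
  by rewrite eq_sym; case: eqP => [->|_]; rewrite ?mulr1 ?mulr0.
rewrite -(extdim_leftE _ (s_simple i).1) PoszM homdim_simple eqxx.
by [].
Qed.

End VertexSimple.

(** * Nakayama duality *)

(** A pairing without left kernel embeds Z into the dual of Z', realised here as the row of values
    on a basis of Z'. *)
Lemma sdim_pairing_le (k : fieldType) (V V' : vectType k) (beta : V -> V' -> k^o)
    (Z : set V) (Z' : set V') :
  (forall v', linear (beta^~ v')) -> (forall v, linear (beta v)) ->
  lin_closed Z -> lin_closed Z' ->
  (forall v, Z v -> (forall v', Z' v' -> beta v v' = 0) -> v = 0) ->
  (sdim Z <= sdim Z')%N.
Proof.
move=> bl br Zc Zc' nd; pose U := vspace_of_set Z'.
pose f v : 'rV[k]_(\dim U) := \row_j beta v (vbasis U)`_j.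
have fL : linear f by move=> c v w; apply/rowP=> j; rewrite !mxE bl.
have -> : sdim Z' = sdim [set: 'rV[k]_(\dim U)].
  by rewrite sdimT dimvf /dim /= mul1n.
apply: (sdim_im_le fL) => // v Zv fv; apply: nd => // v' /(vspP _ Zc') v'U.
have [B BE] := linearP_lfun (br v).
rewrite -BE (coord_vbasis v'U) linear_sum big1 // => j _.
rewrite linearZ /= BE; have /rowP/(_ j) := fv; rewrite !mxE => ->.
by rewrite scaler0.
Qed.

Section Nakayama.
Variables (k : fieldType) (A : falgType k).
Implicit Types X : fdmod A.
Variable P : fdmod A.
Hypothesis Pproj : projective P.

(** The epimorphism from the free module A^n to P given by the coordinate vectors splits, and the
    coordinates of a section are the forms phi_l. *)
Lemma dual_basis : exists phi : 'I_(mdim P) -> 'Hom('cV[k]_(mdim P), A),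
  (forall l, phi l \in hom_reg P) /\
  forall x, x = \sum_l mact P (phi l x) *m delta_mx l 0.
Proof.
set n := mdim P.
pose V : vectType k := {ffun 'I_n -> A}.
pose rho (a : A) (f : V) : V := [ffun l => a * f l].
have [|||| N [c [c' [cL cL' cK cK' cA]]]] := @vect_module _ A V rho.
- by move=> v b a a'; apply/ffunP=> l; rewrite !ffunE mulrDl -scalerAl.
- by move=> a b u v; apply/ffunP=> l; rewrite !ffunE mulrDr -scalerAr.
- by move=> v; apply/ffunP=> l; rewrite !ffunE mul1r.
- by move=> a b v; apply/ffunP=> l; rewrite !ffunE mulrA.
pose g0 (f : V) : 'cV[k]_n := \sum_l mact P (f l) *m delta_mx l 0.
have g0L : linear g0.
  move=> b u v; rewrite /g0 scaler_sumr -big_split; apply: eq_bigr => l _.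
  by rewrite !ffunE mactD mactZ mulmxDl -scalemxAl.
have [g gE] : exists g : 'M_(n, mdim N), forall y, g *m y = g0 (c' y).
  by apply: lin_mulmx_col => b x y; rewrite cL' g0L.
have cA' a y : c' (mact N a *m y) = rho a (c' y).
  by apply: (can_inj cK); rewrite cA !cK'.
have g_epic : epic g.
  split; first apply/is_homP=> a y.
    rewrite !gE cA' /g0 mulmx_sumr; apply: eq_bigr => l _.
    by rewrite ffunE mactM mulmxA.
  move=> x; exists (c [ffun l => (x l 0)%:A]); rewrite gE cK.
  rewrite [RHS]matrix_sum_delta; apply: eq_bigr => l _.
  by rewrite ffunE mactZ mact1 big_ord1 -scalemxAl mul1mx.
have [L LH gL] := Pproj g_epic (hom_id P).
have phiL l : linear (fun x => c' (L *m x) l).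
  by move=> b x y; rewrite mulmxDr -scalemxAr cL' !ffunE.
have /choice[phi phiE] l := linearP_lfun (phiL l).
exists phi; split=> [l|x].
  apply/hom_regP=> a x; rewrite !phiE.
  by move/is_homP: LH => ->; rewrite cA' ffunE.
rewrite -[LHS]mul1mx -gL -mulmxA gE; apply: eq_bigr => l _.
by rewrite phiE.
Qed.

Local Notation b := (vbasis (hom_reg P)).

Lemma vbasis_hom_reg (i : 'I_(\dim (hom_reg P))) : b`_i \in hom_reg P.
Proof. by apply/vbasis_mem/mem_nth; rewrite size_tuple. Qed.

Lemma homdim_nakayama X : homdim P X = homdim X (nakayama P).
Proof.
have [phi [phiH phiE]] := dual_basis.
pose C : 'M[k]_(mdim P, \dim (hom_reg P)) := \matrix_(l, i) coord b i (phi l).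
(* As x = sum_l phi_l(x) delta_l on P, the pairing of Hom(X, nu P) with Hom(P, X)
   given by sum_l <g f delta_l, phi_l> = tr (C g f) is perfect. *)
pose beta (g : 'M[k]_(\dim (hom_reg P), mdim X)) (f : 'M[k]_(mdim X, mdim P)) : k^o :=
  \tr (C *m g *m f).
have betal f : linear (beta^~ f).
  by move=> c g g'; rewrite /beta mulmxDr mulmxDl -scalemxAr -scalemxAl linearP.
have betar g : linear (beta g).
  by move=> c f f'; rewrite /beta mulmxDr -scalemxAr linearP.
have rowC l i : C l i = coord b i (phi l) by rewrite mxE.
have phib l : phi l = \sum_i C l i *: b`_i.
  by rewrite [LHS](coord_vbasis (phiH l)); apply: eq_bigr => i _; rewrite rowC.
(* The dual basis property in Hom_A(P, A): f is the sum of the phi_l times the values f(delta_l), by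
   right multiplication. *)
have phiK f : f \in hom_reg P -> \sum_l (amulr (f (delta_mx l 0)) \o phi l)%VF = f.
  move=> /hom_regP fH; apply/lfunP=> x; rewrite sum_lfunE [in RHS](phiE x) linear_sum.
  by apply: eq_bigr => l _; rewrite comp_lfunE lfunE /= fH.
rewrite !homdimE; apply/eqP; rewrite eqn_leq; apply/andP; split.
  apply: (@sdim_pairing_le _ _ _ (fun f g => beta g f)) => //; try exact: lin_closed_hom.
  move=> f /= fH fg; apply/matrixP=> u l0; rewrite mxE.
  (* The test map sends x to the form phi |-> u-th coordinate of phi(delta_l0) x on Hom_A(P, A).
     Pairing it with f yields the entry (u, l0) of f. *)
  pose g : 'M[k]_(\dim (hom_reg P), mdim X) :=
    \matrix_(i, t) mact X (b`_i (delta_mx l0 0)) u t.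
  have gH : @is_hom _ _ X (nakayama P) g.
    move=> a; apply/matrixP=> i t; rewrite !mxE /=.
    transitivity (mact X ((amulr a \o b`_i)%VF (delta_mx l0 0)) u t).
      rewrite comp_lfunE lfunE /= mactM mxE; apply: eq_bigr => j _.
      by rewrite mxE.
    rewrite {1}(coord_vbasis (hom_regM a (vbasis_hom_reg i))).
    rewrite sum_lfunE linear_sum summxE; apply: eq_bigr => j _.
    by rewrite scale_lfunE linearZ !mxE.
  rewrite -(fg g gH) /beta /mxtrace.
  transitivity ((f *m \sum_l (mact P (phi l (delta_mx l0 0)) *m (delta_mx l 0 : 'cV[k]_(mdim P)))) u 0).
    by rewrite -phiE -colE mxE.
  rewrite mulmx_sumr summxE; apply: eq_bigr => l _.
  rewrite mulmxA fH -(mulmxA (mact X _)) -colE [LHS]mxE [RHS]mxE.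
  apply: eq_bigr => t _; rewrite !mxE; congr (_ * _).
  rewrite phib sum_lfunE linear_sum summxE; apply: eq_bigr => i _.
  by rewrite scale_lfunE linearZ !mxE.
apply: (@sdim_pairing_le _ _ _ beta) => //; try exact: lin_closed_hom.
move=> g /= gH gf; apply: mulmx_ext => x; rewrite mul0mx; apply/colP=> i; rewrite [RHS]mxE.
have bH := vbasis_hom_reg i; have /hom_regP bH' := bH.
(* The test map p |-> b_i(p) x from P to X; its pairing with g is the i-th coordinate of g x. *)
have fL : linear (fun p => mact X (b`_i p) *m x).
  by move=> c p p'; rewrite linearP mactD mactZ mulmxDl -scalemxAl.
have [f fE] := lin_mulmx_col fL.
have fH : @is_hom _ _ P X f.
  by apply/is_homP=> a p; rewrite !fE bH' mactM mulmxA.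
rewrite -(gf f fH) /beta /mxtrace.
have nuE l t : row l C *m nu_act P t = \row_u coord b u (amulr t \o phi l)%VF.
  apply/rowP=> u; rewrite !mxE [in RHS]phib.
  rewrite (big_morph _ (comp_lfunDr (amulr t)) (comp_lfun0r _ _)) linear_sum.
  by apply: eq_bigr => j _; rewrite !mxE -comp_lfunZr linearZ.
transitivity (\sum_l (row l C *m nu_act P (b`_i (delta_mx l 0)) *m (g *m x)) 0 0); last first.
  apply: eq_bigr => l _; rewrite -mulmxA.
  have -> : nu_act P (b`_i (delta_mx l 0)) *m (g *m x) = g *m f *m delta_mx l 0.
    by rewrite -mulmxA fE mulmxA -[nu_act _ _]/(mact (nakayama P) _) -gH -mulmxA.
  rewrite -colE -[in RHS]mulmxA [LHS]mxE [RHS]mxE.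
  by apply: eq_bigr => j _; rewrite !mxE.
under eq_bigr do rewrite nuE.
rewrite -summxE -mulmx_suml.
have -> : \sum_l \row_u coord b u (amulr (b`_i (delta_mx l 0)) \o phi l)%VF = delta_mx 0 i.
  apply/rowP=> u; rewrite summxE; under eq_bigr do rewrite mxE.
  rewrite -linear_sum /= phiK // coord_free ?(basis_free (vbasisP _)) // mxE.
  by rewrite eqxx eq_sym.
by rewrite -rowE [RHS]mxE.
Qed.

Lemma homdim_isor X Y Z : @iso _ A Y Z -> homdim X Y = homdim X Z.
Proof.
suff le Y' Z' : @iso _ A Y' Z' -> (homdim X Y' <= homdim X Z')%N.
  move=> YZ; apply/eqP; rewrite eqn_leq le //= le //.
  by case: YZ => f [g [fH gH gf fg]]; exists g, f.
case=> f [g [fH gH gf _]]; rewrite !homdimE.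
apply: (sdim_im_le (@mulmx_linear _ _ _ f _)).
- exact: lin_closed_hom.
- exact: lin_closed_hom.
- by move=> h _ /(congr1 (mulmx g)); rewrite mulmxA gf mul1mx mulmx0.
- by move=> h hH; apply: hom_mul.
Qed.

End Nakayama.

(** * Kernels, cokernels and counting of morphisms *)

Section Isomorphism.
Variables (k : fieldType) (A : algType k).
Implicit Types X Y Z M N : fdmod A.

Lemma monic_factor X Y M (h : 'M[k]_(mdim M, mdim X)) (i : 'M[k]_(mdim M, mdim Y)) :
  is_hom h -> Defs.monic i -> (forall x : 'cV_(mdim X), exists y, i *m y = h *m x) ->
  exists2 f, @is_hom _ A X Y f & i *m f = h.
Proof.
move=> /is_homP hH [/is_homP iH iI] /choice[f0 fE].
have fL : linear f0.
  by move=> c x y; apply: iI; rewrite mulmxDr -scalemxAr !fE mulmxDr -scalemxAr.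
have [f fE'] := lin_mulmx_col fL; exists f.
  by apply/is_homP=> a x; apply: iI; rewrite !fE' iH !fE hH.
by apply: mulmx_ext => x; rewrite -mulmxA fE' fE.
Qed.

Lemma epic_factor X Y M (h : 'M[k]_(mdim Y, mdim M)) (p : 'M[k]_(mdim X, mdim M)) :
  is_hom h -> epic p -> (forall z : 'cV_(mdim M), p *m z = 0 -> h *m z = 0) ->
  exists2 f, @is_hom _ A X Y f & f *m p = h.
Proof.
(* [sec] is a section of p as a map of sets only; h composed with it is linear because h is constant
   on the fibres of p. *)
move=> /is_homP hH [/is_homP pH /choice[sec secE]] ph.
have hE (z z' : 'cV_(mdim M)) : p *m z = p *m z' -> h *m z = h *m z'.
  move=> E; apply/eqP; rewrite -subr_eq0 -mulmxBr; apply/eqP; apply: ph.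
  by rewrite mulmxBr E subrr.
have fL : linear (fun x => h *m sec x).
  move=> c x y; rewrite scalemxAr -mulmxDr; apply: hE.
  by rewrite secE mulmxDr -scalemxAr !secE.
have [f fE] := lin_mulmx_col fL.
have fp (z : 'cV_(mdim M)) : f *m (p *m z) = h *m z by rewrite fE; apply: hE; rewrite secE.
exists f; last by apply: mulmx_ext => z; rewrite -mulmxA fp.
by apply/is_homP=> a x; rewrite -[x]secE -pH !fp hH.
Qed.

Lemma monic_cancel X M (i : 'M[k]_(mdim M, mdim X)) n (f g : 'M[k]_(mdim X, n)) :
  Defs.monic i -> i *m f = i *m g -> f = g.
Proof.
move=> [_ iI] E; apply: mulmx_ext => x; apply: iI.
by rewrite !mulmxA E.
Qed.

Lemma epic_cancel X M (p : 'M[k]_(mdim X, mdim M)) n (f g : 'M[k]_(n, mdim X)) :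
  epic p -> f *m p = g *m p -> f = g.
Proof.
move=> [_ ps] E; apply: mulmx_ext => x; have [z <-] := ps x.
by rewrite !mulmxA E.
Qed.

Lemma iso_refl X : iso X X.
Proof.
by exists 1%:M, 1%:M; split; rewrite ?mulmx1 //; apply: hom_id.
Qed.

Lemma iso_sym X Y : iso X Y -> iso Y X.
Proof. by case=> f [g [fH gH gf fg]]; exists g, f. Qed.

Lemma iso_trans X Y Z : iso X Y -> iso Y Z -> iso X Z.
Proof.
case=> f [g [fH gH gf fg]] [f' [g' [fH' gH' gf' fg']]].
exists (f' *m f), (g *m g'); split; try exact: hom_mul.
  by rewrite mulmxA -(mulmxA g) gf' mulmx1.
by rewrite mulmxA -(mulmxA f') fg mulmx1.
Qed.

Lemma isorep_iso X : iso X (isorep X).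
Proof.
by rewrite /isorep; case: xgetP => [Y _ //|/(_ X)[]]; apply: iso_refl.
Qed.

Lemma eq_isorep X Y : iso X Y -> isorep X = isorep Y.
Proof.
move=> XY; rewrite /isorep.
have <- : [set Z | iso X Z] = [set Z | iso Y Z].
  apply/seteqP; split=> Z /= XZ; last exact: iso_trans XZ.
  exact: iso_trans (iso_sym XY) XZ.
(* The two choices run over the same set but with the defaults X and Y; as the set is nonempty, the
   defaults do not intervene. *)
rewrite /xget; case: pselect => // -[]; exists X; apply/asboolP.
exact: iso_refl.
Qed.

Lemma isorep_class X : iso_classes A (isorep X).
Proof. by rewrite /iso_classes /=; apply/esym/eq_isorep/isorep_iso. Qed.

Lemma iso_class_eq X Y : iso_classes A X -> iso_classes A Y -> iso X Y -> X = Y.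
Proof. by move=> Xc Yc /eq_isorep; rewrite [isorep X]Xc [isorep Y]Yc. Qed.

Lemma iso_dim X Y : iso X Y -> mdim X = mdim Y.
Proof.
have le a b (u : 'M[k]_(b, a)) (v : 'M_(a, b)) : v *m u = 1%:M -> (a <= b)%N.
  move=> vu; have := mxrank1 k a; rewrite -vu => <-.
  exact: leq_trans (mxrankM_maxr _ _) (rank_leq_row _).
case=> f [g [_ _ gf fg]]; apply/eqP.
by rewrite eqn_leq (le _ _ f g) // (le _ _ g f).
Qed.

Section KernelCokernel.
Variables (M N : fdmod A) (f : 'M[k]_(mdim N, mdim M)).

Lemma ker_iso_isor X Y : ker_iso f X -> iso X Y -> ker_iso f Y.
Proof.
case=> i [iH iI] iE [u [v [uH vH vu uv]]]; exists (i *m v).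
  split; first exact: (hom_mul iH).
  move=> x y /=; rewrite -!mulmxA => /iI /(congr1 (mulmx u)).
  by rewrite !mulmxA uv !mul1mx.
move=> x; rewrite iE; split=> -[y <-]; first by exists (u *m y); rewrite !mulmxA -(mulmxA i) vu mulmx1.
by exists (v *m y); rewrite mulmxA.
Qed.

Lemma coker_iso_isor X Y : coker_iso f X -> iso X Y -> coker_iso f Y.
Proof.
case=> p [pH ps] pE [u [v [uH vH vu uv]]]; exists (u *m p).
  split; first exact: (hom_mul uH).
  by move=> y; have [z zE] := ps (v *m y); exists z; rewrite -mulmxA zE mulmxA uv mul1mx.
move=> y; rewrite -pE -mulmxA; split=> [|->]; last by rewrite mulmx0.
by move=> /(congr1 (mulmx v)); rewrite mulmxA vu mul1mx mulmx0.
Qed.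

Lemma ker_iso_uniq X Y : ker_iso f X -> ker_iso f Y -> iso X Y.
Proof.
case=> i im iE [j jm jE].
have [|u uH uE] := monic_factor im.1 jm.
  by move=> x; apply/jE/iE; exists x.
have [|v vH vE] := monic_factor jm.1 im.
  by move=> x; apply/iE/jE; exists x.
exists u, v; split=> //.
  by apply: (monic_cancel im); rewrite mulmxA vE uE mulmx1.
by apply: (monic_cancel jm); rewrite mulmxA uE vE mulmx1.
Qed.

Lemma coker_iso_uniq X Y : coker_iso f X -> coker_iso f Y -> iso X Y.
Proof.
case=> p pe pE [r re rE].
have [|u uH uE] := epic_factor re.1 pe.
  by move=> x /pE/rE.
have [|v vH vE] := epic_factor pe.1 re.
  by move=> x /rE/pE.
exists u, v; split=> //.
  by apply: (epic_cancel pe); rewrite -mulmxA uE vE mul1mx.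
by apply: (epic_cancel re); rewrite -mulmxA vE uE mul1mx.
Qed.

Hypothesis fH : is_hom f.

Lemma ker_coker_exist : exists XY : fdmod A * fdmod A,
  [/\ ker_iso f XY.1, coker_iso f XY.2, iso_classes A XY.1 & iso_classes A XY.2].
Proof.
have [X [i [im iE]]] := submodule_exists (stable_ker fH (@stableT _ _ M)).
have [Y [p [pe pE]]] := quotient_exists (stable_im fH (@stableT _ _ M)).
exists (isorep X, isorep Y); split; try exact: isorep_class.
  apply: ker_iso_isor (isorep_iso X); exists i => // x.
  by rewrite -iE; split=> [|[]].
apply: coker_iso_isor (isorep_iso Y); exists p => // y.
by rewrite -pE; split=> [[x _ <-]|[x <-]]; exists x.
Qed.

(** A submodule isomorphic to M has full dimension. In [sum_shift], excluding the class of P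
    therefore removes exactly the zero map. *)
Lemma ker_iso_source X : ker_iso f X -> iso X M <-> f = 0.
Proof.
move=> kX; case: (kX) => i im iE; split=> [XM|f0]; last first.
  apply: ker_iso_uniq kX _; exists 1%:M.
    by split; [apply: hom_id|move=> x y; rewrite !mul1mx].
  move=> x; rewrite f0 mul0mx; split=> // _; exists x.
  by rewrite mul1mx.
have iT : (fun x : 'cV_(mdim X) => i *m x) @` setT = setT.
  apply: sdim_eq => //; first exact: (lin_closed_im (@mulmx_linear _ _ _ i 1)).
  rewrite (sdim_inj (@mulmx_linear _ _ _ i 1)) //.
    by rewrite !sdimT !dimvf /dim /= !muln1 (iso_dim XM).
  by move=> x _; rewrite -[X in _ = X -> _](mulmx0 _ i) => /im.2.
apply: mulmx_ext => x; rewrite mul0mx.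
have : [set: 'cV[k]_(mdim M)] x by [].
by rewrite -iT => -[y _ <-]; apply/iE; exists y.
Qed.

(** By dimension, a quotient isomorphic to N has zero kernel; excluding the class of I in
    [sum_unshift] removes exactly the zero map. *)
Lemma coker_iso_target Y : coker_iso f Y -> iso Y N <-> f = 0.
Proof.
move=> cY; case: (cY) => p pe pE; split=> [YN|f0]; last first.
  apply: coker_iso_uniq cY _; exists 1%:M.
    by split; [apply: hom_id|move=> y; exists y; rewrite mul1mx].
  move=> y; rewrite f0 mul1mx; split=> [->|[x]]; last by rewrite mul0mx.
  by exists 0; rewrite mul0mx.
have := sdim_ker_im (@mulmx_linear _ _ _ p 1) (lin_closedT _).
have -> : (fun x : 'cV_(mdim N) => p *m x) @` setT = setT.
  by apply/seteqP; split=> // y _; have [x <-] := pe.2 y; exists x.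
rewrite !sdimT !dimvf /dim /= !muln1 => E.
have /sdim_eq0 K0 : sdim [set v : 'cV_(mdim N) | setT v /\ p *m v = 0] = 0%N.
  by apply/eqP; rewrite -(eqn_add2r (mdim Y)) E add0n (iso_dim YN).
apply: mulmx_ext => x; rewrite mul0mx.
have : [set v : 'cV_(mdim N) | setT v /\ p *m v = 0] (f *m x).
  by split=> //; apply/pE; exists x.
rewrite K0 //; apply: lin_closed_ker => //; exact: mulmx_linear.
Qed.

End KernelCokernel.
End Isomorphism.

(** * Numbers of morphisms into a submodule and out of a quotient *)

Section Counting.
Variable k : finFieldType.

Lemma card_lin_closed a b (Z : set 'M[k]_(a, b)) : lin_closed Z ->
  #|[pred f | `[< Z f >]]| = (#|k| ^ sdim Z)%N.
Proof.
move=> Zc; rewrite /sdim -card_vspace; apply: eq_card => f.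
by rewrite inE; apply/asboolP/idP => /(vspP _ Zc).
Qed.

Variable A : falgType k.
Implicit Types P M I : fdmod A.

Lemma card_hom_into P M N (i : 'M[k]_(mdim M, mdim N)) (U : set 'cV[k]_(mdim M)) :
  Defs.monic i -> (forall x, U x <-> exists y, i *m y = x) ->
  #|[pred f : 'M[k]_(mdim M, mdim P) | `[< is_hom f /\ forall x : 'cV_(mdim P), U (f *m x) >]]| =
  (#|k| ^ homdim P N)%N.
Proof.
move=> im iU; pose Z := (fun g : 'M[k]_(mdim N, mdim P) => i *m g) @` [set g | is_hom g].
have -> : homdim P N = sdim Z.
  rewrite homdimE (sdim_inj (@mulmx_linear _ _ _ i _)) //; first exact: lin_closed_hom.
  by move=> g _; rewrite -[X in _ = X -> _](mulmx0 _ i) => /(monic_cancel im).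
rewrite -card_lin_closed; last first.
  by apply: lin_closed_im (lin_closed_hom _ _); apply: mulmx_linear.
apply: eq_card => f; rewrite !inE; congr asbool; apply/propext; split.
  case=> fH fU; have [|g gH gE] := monic_factor fH im; last by exists g.
  by move=> x; apply/iU.
case=> g gH <-; split; first exact: (hom_mul im.1).
by move=> x; apply/iU; exists (g *m x); rewrite mulmxA.
Qed.

Lemma card_hom_from M I N (p : 'M[k]_(mdim N, mdim M)) (U : set 'cV[k]_(mdim M)) :
  epic p -> (forall x, U x <-> p *m x = 0) ->
  #|[pred f : 'M[k]_(mdim I, mdim M) | `[< is_hom f /\ forall x : 'cV_(mdim M), U x -> f *m x = 0 >]]| =
  (#|k| ^ homdim N I)%N.
Proof.
move=> pe pU; pose Z := (fun g : 'M[k]_(mdim I, mdim N) => g *m p) @` [set g | is_hom g].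
have pL : linear (fun g : 'M[k]_(mdim I, mdim N) => g *m p).
  by move=> c g h; rewrite mulmxDl -scalemxAl.
have -> : homdim N I = sdim Z.
  rewrite homdimE (sdim_inj pL) //; first exact: lin_closed_hom.
  by move=> g _; rewrite -[X in _ = X -> _](mul0mx _ p) => /(epic_cancel pe).
rewrite -card_lin_closed; last exact: lin_closed_im (lin_closed_hom _ _).
apply: eq_card => f; rewrite !inE; congr asbool; apply/propext; split.
  case=> fH fU; have [|g gH gE] := epic_factor fH pe; last by exists g.
  by move=> x /pU/fU.
case=> g gH <-; split; first exact: (hom_mul gH pe.1).
by move=> x /pU px; rewrite -mulmxA px mulmx0.
Qed.

End Counting.

(** * The cluster character as a sum over submodules *)

(** Values outside the image of h have multiplicity 0, so the sum over the possibly infinite A is a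
    finite one over that image, regrouped by fibres. It is used to split Grassmannians into
    submodules and multiplicities into morphisms. *)
Lemma fsbig_fiber (J : finType) (K : choiceType) (V : nmodType) (P : pred J)
    (h : J -> K) (A : set K) (n : K -> nat) (F : K -> V) :
  (forall e, A e -> n e = #|[pred j | P j && (h j == e)]|) ->
  \sum_(e \in A) F e *+ n e = \sum_(j | P j && `[< A (h j) >]) F (h j).
Proof.
move=> nE; pose Q j := P j && `[< A (h j) >].
pose r := undup [seq h j | j <- enum Q].
have rP e : e \in r -> A e.
  by rewrite mem_undup => /mapP[j]; rewrite mem_enum => /andP[_ /asboolP Ah] ->.
rewrite (fsbigE r) ?undup_uniq //; last first.
- move=> e Ae er; rewrite nE // (_ : #|_| = 0%N) ?mulr0n //.
  apply: eq_card0 => j; rewrite !inE; apply/negP => /andP[Pj /eqP hj].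
  case/negP: er; rewrite mem_undup -hj; apply: map_f; rewrite mem_enum.
  by rewrite unfold_in Pj /= hj; apply/asboolP.
rewrite big_seq_cond [RHS](eq_bigr (fun j => \sum_(e <- r | e == h j) F e)); last first.
  move=> j Qj; rewrite -big_filter filter_pred1_uniq ?undup_uniq ?big_seq1 //.
  by rewrite mem_undup; apply: map_f; rewrite mem_enum.
rewrite (exchange_big_dep (fun e => true)) //= [RHS]big_seq; apply: eq_big => [e|e /andP[er _]].
  by case er: (e \in r) => //=; apply/mem_set/rP.
rewrite sumr_const (nE e (rP e er)); congr (_ *+ _); apply: eq_card => j.
rewrite !inE /in_mem /= /Q [e == _]eq_sym.
case: (eqVneq (h j) e) => [hj|]; rewrite ?andbF // hj !andbT.
have -> : `[< A e >] by apply/asboolP/rP.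
by rewrite andbT.
Qed.

Section LaurentPowers.
Variable k : finFieldType.

Lemma vpow_card n : (#|k| ^ n)%N%:R = vpow k (2 * n%:Z).
Proof.
have val_nat a : laurent_val (a%:R : laurent k) = a%:R.
  by elim: a => // a IHa; rewrite !mulrS -IHa.
apply/val_inj; rewrite /= val_nat natrX -exprz_exp.
by rewrite -[vroot k ^ 2]/(vroot k ^+ 2) sqrtCK.
Qed.

End LaurentPowers.

Section Sums.
Variables (k : finFieldType) (m : nat) (S : species k m) (T : tensor_algebra S).
Variables (s : 'I_m -> fdmod T) (L : 'M[int]_m).
Implicit Types (M N X Y P I F G : fdmod T).
Local Notation O := (zero_mod T).

Definition submod M (U : {set 'cV[k]_(mdim M)}) : bool :=
  `[< @stable _ _ M [set u | u \in U] >].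

Definition dimvec_set M (U : {set 'cV[k]_(mdim M)}) : 'cV[int]_m := @dimvec_sub _ _ _ T M [set u | u \in U].

(** The contribution of one submodule of dimension vector e to the character. It depends on the
    modules only through their dimension vectors, which makes terms for different modules
    comparable. *)
Definition qcc_term (i m0 p e : 'cV[int]_m) : qtorus k L :=
  vpow k (euler T (p - e) (m0 - e - i)) *:
      qX k L (rstar s (p - e) - lstar s (m0 - e - i)).

Lemma qcc_sum I M P : qcc s L I M P =
  \sum_(U : {set 'cV[k]_(mdim M)} | submod U) qcc_term (dimvec I) (dimvec M) (dimvec P) (@dimvec_set M U).
Proof.
rewrite /qcc; under eq_fsbigr.
  move=> e _; rewrite mulrC -scalerA scaler_nat -/(qcc_term _ _ _ e); over.
rewrite (@fsbig_fiber _ _ _ (@submod M) (@dimvec_set M)) => [|e _].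
  by apply: eq_bigl => U; rewrite [X in _ && X](_ : _ = true) ?andbT //; apply/asboolP.
apply: eq_card => U; rewrite !inE; apply/asboolP/andP=> [[Us Ue]|[/asboolP Us /eqP Ue]] //.
by split; [apply/asboolP|apply/eqP].
Qed.

Lemma ker_iso_dimvec M N (f : 'M[k]_(mdim N, mdim M)) X : is_hom f -> ker_iso f X ->
  dimvec M = dimvec X + @dimvec_sub _ _ _ T N ((fun x => f *m x) @` setT).
Proof.
move=> fH [i im iE]; rewrite [LHS](dimvec_exact fH (@stableT _ _ M)); congr (_ + _).
rewrite -[dimvec X](dimvec_monic im (@stableT _ _ X)); congr dimvec_sub.
by apply/seteqP; split=> [x [_ /iE[y <-]]|_ [y _ <-]]; [exists y|split=> //; apply/iE; exists y].
Qed.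

Lemma coker_iso_dimvec M N (f : 'M[k]_(mdim N, mdim M)) Y : is_hom f -> coker_iso f Y ->
  dimvec N = @dimvec_sub _ _ _ T N ((fun x => f *m x) @` setT) + dimvec Y.
Proof.
move=> fH [p [pH ps] pE]; rewrite [LHS](dimvec_exact pH (@stableT _ _ N)).
congr (_ + _); congr dimvec_sub.
  by apply/seteqP; split=> [x [_ /pE[y <-]]|_ [y _ <-]]; [exists y|split=> //; apply/pE; exists y].
by apply/seteqP; split=> // y _; have [z <-] := ps y; exists z.
Qed.

(** Preimages identify the submodules of coker f with the submodules of M containing im f. This adds
    the dimension vector r of im f to e; since P and M exceed X and F by the same r, the differences
    in [qcc_term] are unchanged. *)
Lemma qcc_ker_coker P M (f : 'M[k]_(mdim M, mdim P)) X F :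
  is_hom f -> ker_iso f X -> coker_iso f F ->
  qcc s L O F X = \sum_(U : {set 'cV[k]_(mdim M)} |
      submod U && [forall x : 'cV_(mdim P), f *m x \in U])
    qcc_term 0 (dimvec M) (dimvec P) (@dimvec_set M U).
Proof.
move=> fH kX cF; have pX := ker_iso_dimvec fH kX; have mF := coker_iso_dimvec fH cF.
set r := dimvec_sub _ in pX mF; have [p [pH ps] pE] := cF.
rewrite qcc_sum dimvec_zero_mod.
pose h (V : {set 'cV[k]_(mdim F)}) : {set 'cV[k]_(mdim M)} := finset (fun u => p *m u \in V).
pose h' (U : {set 'cV[k]_(mdim M)}) : {set 'cV[k]_(mdim F)} := [set p *m u | u in U]%SET.
have hK V : h' (h V) = V.
  apply/setP=> y; apply/imsetP/idP => [[u]|yV].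
    by rewrite inE => uV ->.
  by have [u uE] := ps y; exists u; rewrite ?inE uE.
rewrite [RHS](reindex_onto h h'); last first.
  move=> U /andP[/asboolP[U0 UD Ua] /forallP fU]; apply/setP=> u; rewrite inE.
  apply/imsetP/idP => [[v vU /eqP]|uU]; last by exists u.
  rewrite -subr_eq0 -mulmxBr => /eqP /pE[x xE]; rewrite -[u](subrK v).
  by apply: UD => //=; rewrite -xE.
have sh V : [set u | u \in h V] = [set u | p *m u \in V] :> set 'cV[k]_(mdim M).
  by apply/seteqP; split=> u /=; rewrite inE.
apply: eq_big => [V|V /asboolP Vs].
  rewrite hK eqxx andbT; apply/idP/andP=> [/asboolP Vs|[/asboolP hVs _]].
    split; first by apply/asboolP; rewrite sh; apply: (stable_preim pH Vs).
    apply/forallP=> x; rewrite inE; have -> : p *m (f *m x) = 0 by apply/pE; exists x.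
    by case: Vs.
  apply/asboolP; have -> : [set y | y \in V] = (fun u => p *m u) @` [set u | u \in h V].
    apply/seteqP; split=> [y yV|_ [u /= uV <-]]; last by rewrite inE in uV.
    by have [u uE] := ps y; exists u; rewrite //= inE uE.
  exact: stable_im.
have -> : dimvec_set (h V) = r + dimvec_set V.
  rewrite /dimvec_set sh (dimvec_exact pH (stable_preim pH Vs)); congr (_ + _); congr dimvec_sub.
    apply/seteqP; split=> [u [_ /pE[x <-]]|_ [x _ <-]]; first by exists x.
    have px : p *m (f *m x) = 0 by apply/pE; exists x.
    by split=> //=; rewrite px; case: Vs.
  apply/seteqP; split=> [_ [u /= uV <-]|y yV] //.
  by have [u uE] := ps y; exists u => //=; rewrite uE.
have Ex : dimvec P - (r + dimvec_set V) = dimvec X - dimvec_set V by rewrite pX opprD addrA addrK.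
have Ef : dimvec M - (r + dimvec_set V) = dimvec F - dimvec_set V.
  by rewrite mF opprD addrACA subrr add0r.
by rewrite /qcc_term Ex Ef.
Qed.

(** Submodules of ker g are submodules of M killed by g, with the same e. The dimension vector of im
    g separates M from G and I from I', and cancels in m - e - i. *)
Lemma qcc_coker_ker M I (g : 'M[k]_(mdim I, mdim M)) G I' :
  is_hom g -> ker_iso g G -> coker_iso g I' ->
  qcc s L I' G O = \sum_(U : {set 'cV[k]_(mdim M)} |
      submod U && [forall x in U, g *m x == 0])
    qcc_term (dimvec I) (dimvec M) 0 (@dimvec_set M U).
Proof.
move=> gH kG cI; have mG := ker_iso_dimvec gH kG; have iI := coker_iso_dimvec gH cI.
set r := dimvec_sub _ in mG iI; have [i im iE] := kG.
rewrite qcc_sum dimvec_zero_mod.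
pose h (V : {set 'cV[k]_(mdim G)}) : {set 'cV[k]_(mdim M)} := [set i *m u | u in V]%SET.
pose h' (U : {set 'cV[k]_(mdim M)}) : {set 'cV[k]_(mdim G)} := finset (fun u => i *m u \in U).
have hK V : h' (h V) = V.
  apply/setP=> y; rewrite inE; apply/imsetP/idP => [[u uV /im.2 ->]//|yV].
  by exists y.
rewrite [RHS](reindex_onto h h'); last first.
  move=> U /andP[_ /'forall_implyP gU]; apply/setP=> u.
  apply/imsetP/idP => [[v]|uU]; first by rewrite inE => vU ->.
  by have /eqP/iE[y yE] := gU u uU; exists y; rewrite ?inE yE.
have sh V : [set u | u \in h V] = (fun u => i *m u) @` [set u | u \in V].
  by apply/seteqP; split=> u /=; [case/imsetP=> v vV ->; exists v|case=> v vV <-; apply/imsetP; exists v].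
apply: eq_big => [V|V /asboolP Vs].
  rewrite hK eqxx andbT; apply/idP/andP=> [/asboolP Vs|[/asboolP hVs _]].
    split; first by apply/asboolP; rewrite sh; apply: (stable_im im.1 Vs).
    apply/'forall_implyP=> _ /imsetP[v vV ->]; apply/eqP/iE.
    by exists v.
  apply/asboolP; have -> : [set y | y \in V] = [set y | i *m y \in h V].
    apply/seteqP; split=> y /=; first by move=> yV; apply/imsetP; exists y.
    by case/imsetP=> v vV /im.2 ->.
  exact: (stable_preim im.1 hVs).
have -> : dimvec_set (h V) = dimvec_set V by rewrite /dimvec_set sh dimvec_monic.
have E : dimvec M - dimvec_set V - dimvec I = dimvec G - dimvec_set V - dimvec I'.
  by rewrite mG iI opprD addrA [dimvec G + r - _]addrAC addrK.
by rewrite /qcc_term E.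
Qed.

End Sums.

(** * The two right-hand sums as sums over submodules of M *)

Section ShiftSums.
Variables (k : finFieldType) (m : nat) (S : species k m) (T : tensor_algebra S).
Variables (s : 'I_m -> fdmod T) (L : 'M[int]_m).
Implicit Types (M N X Y P I F G : fdmod T).
Local Notation O := (zero_mod T).

Lemma ker_coker_choice M N : exists KC : 'M[k]_(mdim N, mdim M) -> fdmod T * fdmod T,
  forall f, is_hom f -> [/\ ker_iso f (KC f).1, coker_iso f (KC f).2,
    iso_classes T (KC f).1 & iso_classes T (KC f).2].
Proof.
suff /choice[KC KCP] : forall f : 'M[k]_(mdim N, mdim M), exists XY : fdmod T * fdmod T,
    is_hom f -> [/\ ker_iso f XY.1, coker_iso f XY.2,
      iso_classes T XY.1 & iso_classes T XY.2] by exists KC.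
move=> f; have [fH|nfH] := pselect (is_hom f); last by exists (O, O).
by have [XY ?] := ker_coker_exist fH; exists XY.
Qed.

Lemma hom_ker_cokerE M N (f : 'M[k]_(mdim N, mdim M)) X Y X' Y' :
  is_hom f -> ker_iso f X -> coker_iso f Y ->
  iso_classes T X -> iso_classes T Y -> iso_classes T X' -> iso_classes T Y' ->
  (ker_iso f X' /\ coker_iso f Y') <-> (X = X' /\ Y = Y').
Proof.
move=> fH kX cY Xc Yc Xc' Yc'; split=> [[kX' cY']|[<- <-]] //.
split; apply: iso_class_eq => //; first exact: ker_iso_uniq kX kX'.
exact: coker_iso_uniq cY cY'.
Qed.

Definition hom_sub P M (U : {set 'cV[k]_(mdim M)}) : pred 'M[k]_(mdim M, mdim P) :=
  fun f => `[< is_hom f >] && [forall x : 'cV_(mdim P), f *m x \in U].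

Arguments hom_sub P {M} U _.

Definition hom_quo M I (U : {set 'cV[k]_(mdim M)}) : pred 'M[k]_(mdim I, mdim M) :=
  fun g => `[< is_hom g >] && [forall x in U, g *m x == 0].

Arguments hom_quo {M} I U _.

Lemma card_pred_nonzero (V : finZmodType) (H : pred V) : H 0 ->
  #|[pred f | H f && (f != 0)]| = #|H|.-1.
Proof.
move=> H0; rewrite (cardD1 0 H) (_ : 0 \in H) //=; apply: eq_card => f.
by rewrite !inE andbC.
Qed.

(** A pair of classes (F, P') counted with multiplicity is a single f, through its cokernel and
    kernel; the predecessor in the multiplicity accounts for f = 0. *)
Lemma sum_shift_homs P M : sum_shift s L P M =
  \sum_(U : {set 'cV[k]_(mdim M)} | submod U)
    qcc_term s L 0 (dimvec M) (dimvec P) (dimvec_set U) *+ #|hom_sub P U|.-1.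
Proof.
have [KC KCP] := ker_coker_choice P M.
pose h f := ((KC f).2, (KC f).1).
rewrite /sum_shift; under eq_fsbigr do rewrite scaler_nat.
rewrite (@fsbig_fiber _ _ _ (fun f => `[< is_hom f >]) h); last first.
  move=> [F X] [/= Fc [Xc _]]; apply: eq_card => f; rewrite !inE.
  apply/asboolP/andP => [[fH kX cF]|[/asboolP fH /eqP[<- <-]]].
    split; first exact/asboolP.
    have [kX' cF' Xc' Fc'] := KCP f fH.
    by have [<- <-] := (hom_ker_cokerE fH kX' cF' Xc' Fc' Xc Fc).1 (conj kX cF).
  by have [] := KCP f fH.
(* The sum over nonzero f of the terms of submodules containing im f, ready for the exchange of
   summations. *)
transitivity (\sum_(f : 'M[k]_(mdim M, mdim P) | `[< is_hom f >] && (f != 0))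
  \sum_(U : {set 'cV[k]_(mdim M)} | submod U && [forall x : 'cV_(mdim P), f *m x \in U])
    qcc_term s L 0 (dimvec M) (dimvec P) (dimvec_set U)).
  apply: eq_big => [f|f /andP[/asboolP fH _]]; last first.
    by have [kX cF _ _] := KCP f fH; apply: qcc_ker_coker fH kX cF.
  have [/asboolP fH|//] := boolP `[< is_hom f >]; rewrite /=.
  have [kX cF Xc Fc] := KCP f fH.
  apply/asboolP/negP => [[/= _ [_ nX]] /eqP f0|f0]; first by apply: nX; apply/(ker_iso_source kX).
  by split=> //=; split=> // /(ker_iso_source kX)/eqP.
rewrite (exchange_big_dep (@submod _ _ _ T M)) /=; last by move=> f U _ /andP[].
apply: eq_bigr => U /asboolP Us; rewrite sumr_const; congr (_ *+ _).
rewrite -card_pred_nonzero; last first.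
  apply/andP; split; first by apply/asboolP; case: (lin_closed_hom P M).
  by apply/forallP=> x; rewrite mul0mx; case: Us.
apply: eq_card => f; rewrite !inE /hom_sub; have -> : submod U by apply/asboolP.
by rewrite /= andbAC.
Qed.

Lemma sum_unshift_homs M I : sum_unshift s L M I =
  \sum_(U : {set 'cV[k]_(mdim M)} | submod U)
    qcc_term s L (dimvec I) (dimvec M) 0 (dimvec_set U) *+ #|hom_quo I U|.-1.
Proof.
have [KC KCP] := ker_coker_choice M I.
rewrite /sum_unshift; under eq_fsbigr do rewrite scaler_nat.
rewrite (@fsbig_fiber _ _ _ (fun f => `[< is_hom f >]) KC); last first.
  move=> [X F] [/= Xc [Fc _]]; apply: eq_card => f; rewrite !inE.
  apply/asboolP/andP => [[fH kX cF]|[/asboolP fH /eqP E]].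
    split; first exact/asboolP.
    have [kX' cF' Xc' Fc'] := KCP f fH.
    have [<- <-] := (hom_ker_cokerE fH kX' cF' Xc' Fc' Xc Fc).1 (conj kX cF).
    by rewrite -surjective_pairing.
  by have [] := KCP f fH; rewrite E.
transitivity (\sum_(f : 'M[k]_(mdim I, mdim M) | `[< is_hom f >] && (f != 0))
  \sum_(U : {set 'cV[k]_(mdim M)} | submod U && [forall x in U, f *m x == 0])
    qcc_term s L (dimvec I) (dimvec M) 0 (dimvec_set U)).
  apply: eq_big => [f|f /andP[/asboolP fH _]]; last first.
    by have [kX cF _ _] := KCP f fH; apply: qcc_coker_ker fH kX cF.
  have [/asboolP fH|//] := boolP `[< is_hom f >]; rewrite /=.
  have [kX cF Xc Fc] := KCP f fH.
  apply/asboolP/negP => [[/= _ [_ nX]] /eqP f0|f0]; first by apply: nX; apply/(coker_iso_target cF).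
  by split=> //=; split=> // /(coker_iso_target cF)/eqP.
rewrite (exchange_big_dep (@submod _ _ _ T M)) /=; last by move=> f U _ /andP[].
apply: eq_bigr => U /asboolP Us; rewrite sumr_const; congr (_ *+ _).
rewrite -card_pred_nonzero; last first.
  apply/andP; split; first by apply/asboolP; case: (lin_closed_hom M I).
  by apply/'forall_implyP=> x _; rewrite mul0mx.
apply: eq_card => f; rewrite !inE /hom_quo; have -> : submod U by apply/asboolP.
by rewrite /= andbAC.
Qed.

(** Realise U as a module N: the maps from P into U form Hom(P, N), whose dimension is the Euler
    form since Ext^1(P, N) = 0. *)
Lemma card_hom_sub P M (U : {set 'cV[k]_(mdim M)}) : projective P -> submod U ->
  #|hom_sub P U|%:R = vpow k (2 * euler T (dimvec P) (dimvec_set U)).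
Proof.
move=> Pproj /asboolP Us; have [N [i [im iE]]] := submodule_exists Us.
have -> : dimvec_set U = dimvec N.
  rewrite /dimvec -(dimvec_monic im (@stableT _ _ N)); congr dimvec_sub.
  by apply/seteqP; split=> [x /iE[y <-]|_ [y _ <-]]; [exists y|apply/iE; exists y].
rewrite eulerP (extdim_proj _ Pproj) subr0 -vpow_card -(card_hom_into P im iE).
congr (_ %:R); apply: eq_card => f; rewrite !inE unfold_in.
by apply/andP/asboolP=> [[/asboolP fH /forallP fU]|[fH fU]] //; split;
  [apply/asboolP|apply/forallP].
Qed.

(** The maps killing U form Hom(M/U, I), whose dimension is the Euler form since Ext^1(M/U, I) =
    0. *)
Lemma card_hom_quo M I (U : {set 'cV[k]_(mdim M)}) : injective_mod I -> submod U ->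
  #|hom_quo I U|%:R = vpow k (2 * euler T (dimvec M - dimvec_set U) (dimvec I)).
Proof.
move=> Iinj /asboolP Us; have [N [p [pe pE]]] := quotient_exists Us.
have -> : dimvec M - dimvec_set U = dimvec N.
  apply/eqP; rewrite subr_eq; apply/eqP; rewrite [LHS](dimvec_exact pe.1 (@stableT _ _ M)) addrC.
  congr (_ + _); congr dimvec_sub.
    by apply/seteqP; split=> // y _; have [x <-] := pe.2 y; exists x.
  by apply/seteqP; split=> [x [_ /pE]|x /pE].
rewrite eulerP (extdim_inj _ Iinj) subr0 -vpow_card -(card_hom_from I pe pE).
congr (_ %:R); apply: eq_card => f; rewrite !inE unfold_in.
apply/andP/asboolP=> [[/asboolP fH /'forall_implyP fU]|[fH fU]] //; split.
- by [].
- by move=> x /fU/eqP.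
- exact/asboolP.
- by apply/'forall_implyP=> x /fU/eqP.
Qed.

Lemma sum_shiftE P M : projective P -> sum_shift s L P M =
  \sum_(U : {set 'cV[k]_(mdim M)} | submod U)
    (vpow k (2 * euler T (dimvec P) (dimvec_set U)) - 1) *:
      qcc_term s L 0 (dimvec M) (dimvec P) (dimvec_set U).
Proof.
move=> Pproj; rewrite sum_shift_homs; apply: eq_bigr => U Us.
rewrite -card_hom_sub // -scaler_nat -subn1 natrB //.
apply/card_gt0P; exists 0; rewrite unfold_in; apply/andP; split.
  by apply/asboolP; case: (lin_closed_hom P M).
by apply/forallP=> x; rewrite mul0mx; case/asboolP: Us.
Qed.

Lemma sum_unshiftE M I : injective_mod I -> sum_unshift s L M I =
  \sum_(U : {set 'cV[k]_(mdim M)} | submod U)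
    (vpow k (2 * euler T (dimvec M - dimvec_set U) (dimvec I)) - 1) *:
      qcc_term s L (dimvec I) (dimvec M) 0 (dimvec_set U).
Proof.
move=> Iinj; rewrite sum_unshift_homs; apply: eq_bigr => U Us.
rewrite -card_hom_quo // -scaler_nat -subn1 natrB //.
apply/card_gt0P; exists 0; rewrite unfold_in; apply/andP; split.
  by apply/asboolP; case: (lin_closed_hom M I).
by apply/'forall_implyP=> x _; rewrite mul0mx.
Qed.

Lemma eulerDl x y z : euler T (x + y) z = euler T x z + euler T y z.
Proof. by rewrite /euler linearD /= !mulmxDl mxE. Qed.

Lemma eulerDr x y z : euler T z (x + y) = euler T z x + euler T z y.
Proof. by rewrite /euler mulmxDr mxE. Qed.

Lemma eulerNl x z : euler T (- x) z = - euler T x z.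
Proof. by rewrite /euler linearN /= !mulNmx mxE. Qed.

Lemma eulerNr x z : euler T z (- x) = - euler T z x.
Proof. by rewrite /euler mulmxN mxE. Qed.

Lemma qcc_module M o : dimvec O = o -> qcc s L O M O =
  \sum_(U : {set 'cV[k]_(mdim M)} | submod U) qcc_term s L o (dimvec M) o (dimvec_set U).
Proof. by move=> <-; rewrite qcc_sum. Qed.

Lemma qcc_zero I P i p : dimvec I = i -> dimvec P = p ->
  qcc s L I O P = qcc_term s L i 0 p 0.
Proof.
move=> <- <-; have all0 (x y : 'cV[k]_(mdim O)) : x = y by apply/colP; case.
rewrite qcc_sum dimvec_zero_mod (big_pred1 (finset predT)) => [|U].
  congr qcc_term; rewrite -[RHS](dimvec_zero_mod T); congr dimvec_sub.
  by apply/seteqP; split=> x //= _; rewrite inE.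
apply/asboolP/eqP => [[U0 _ _]|->]; last by split=> *; rewrite /= inE.
by apply/setP=> x; rewrite inE (all0 x 0).
Qed.

End ShiftSums.

(** * The compatible pair *)

Lemma vpow_identity_shift (k : finFieldType) (a b c l : int) :
  (vpow k (2 * a) - 1) * (vpow k (l + b - a) * vpow k (- c)) =
  vpow k l * ((vpow k (2 * b) - 1) * vpow k (a - b - c) +
     vpow k (- a) * ((vpow k (2 * (a - b)) - 1) * vpow k (b - c))).
Proof.
rewrite !mulrBl !mul1r !(mulrBr, mulrDr) -!vpowD.
have -> : 2 * a + (l + b - a - c) = l + (2 * b + (a - b - c)) by ring.
have -> : l + b - a - c = l + (- a + (b - c)) by ring.
have -> : l + (- a + (2 * a - 2 * b + (b - c))) = l + (a - b - c) by ring.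
by rewrite [RHS]addrA subrK.
Qed.

Lemma vpow_identity_unshift (k : finFieldType) (a b c l : int) :
  (vpow k (2 * a) - 1) * (vpow k (l - b) * vpow k (- c)) =
  vpow k l * (vpow k (- a) * ((vpow k (2 * b) - 1) * vpow k (a - b - c)) +
     (vpow k (2 * (a - b)) - 1) * vpow k (b - c)).
Proof.
rewrite !mulrBl !mul1r !(mulrBr, mulrDr) -!vpowD.
have -> : l + (- a + (2 * b + (a - b - c))) = l + (b - c) by ring.
have -> : l + (- a + (a - b - c)) = l - b - c by ring.
have -> : l + (2 * a - 2 * b + (b - c)) = 2 * a + (l - b - c) by ring.
by rewrite [RHS]addrC [RHS]addrA subrK.
Qed.

Lemma scalerDl_combine (R : nzRingType) (V : lmodType R) (x : V) (a b c d : R) :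
  a = b * (c + d) -> a *: x = b *: (c *: x + d *: x).
Proof. by move=> ->; rewrite -scalerDl scalerA. Qed.

Lemma lamNr m (L : 'M[int]_m) a c : lam L c (- a) = - lam L c a.
Proof. by rewrite /lam mulmxN mxE. Qed.

Lemma lam_skew m (L : 'M[int]_m) : L^T = - L -> forall a c, lam L a c = - lam L c a.
Proof.
move=> LT a c; have -> : lam L a c = (a^T *m L *m c)^T 0 0 by rewrite mxE.
by rewrite !trmx_mul trmxK LT mulNmx mulmxN mulmxA mxE.
Qed.

Section CompatiblePair.
Variables (k : finFieldType) (m : nat) (Qt : valued_quiver m) (S : species k m).
Hypotheses (acQ : acyclic Qt) (S_Qt : species_of Qt S).
Variables (T : tensor_algebra S) (s : 'I_m -> fdmod T) (L : 'M[int]_m).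
Hypotheses (s_simple : forall i, vertex_simple i (s i)) (L_skew : L^T = - L).
Hypothesis L_compat : L *m (- (R'mx s - Rmx s)) = valuation_mx Qt.

Local Notation exchange_mx := (R'mx s - Rmx s).

Lemma rstarB x y : rstar s (x - y) = rstar s x - rstar s y.
Proof. exact: mulmxBr. Qed.

Lemma lstarB x y : lstar s (x - y) = lstar s x - lstar s y.
Proof. exact: mulmxBr. Qed.

Lemma rstar_lstar x : rstar s x = lstar s x + exchange_mx *m x.
Proof.
rewrite /rstar /lstar -mulmxDl; congr (_ *m _).
by rewrite [RHS]addrA subrK.
Qed.

(** Compatibility reads Lambda B = - D, and transposing b^T = D E' gives E'^T D = b; so x^T E'^T
    Lambda B y = - x^T b y. *)
Lemma lam_rstar x y : lam L (rstar s x) (exchange_mx *m y) = - euler T x y.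
Proof.
have LB : L *m exchange_mx = - valuation_mx Qt by rewrite -L_compat mulmxN opprK.
have dT : (valuation_mx Qt)^T = valuation_mx Qt by rewrite tr_diag_mx.
rewrite /lam mulmxA -(mulmxA _ L) LB mulmxN mulNmx mxE; congr (- _).
have E : (1%:M - Rmx s)^T *m valuation_mx Qt = euler_mx T.
  by rewrite -[X in _ *m X]dT -trmx_mul -(euler_mxR acQ S_Qt s_simple) trmxK.
by rewrite /rstar trmx_mul -(mulmxA x^T) E.
Qed.

Variables (i p : 'cV[int]_m).
Hypothesis serre : forall j, euler T p (dimvec (s j)) = euler T (dimvec (s j)) i.

(** The dimension vectors of the simples are the unit vectors, so the duality against them is an
    equality of vectors and holds for every x. *)
Lemma serre_dual x : euler T p x = euler T x i.
Proof.
have E : (p^T *m euler_mx T)^T = euler_mx T *m i.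
  apply/colP=> j; have := serre j; rewrite /euler !(dimvec_vertex_simple acQ S_Qt s_simple).
  by rewrite -colE trmx_delta -!mulmxA -rowE !mxE => ->.
rewrite /euler; have -> : (p^T *m euler_mx T *m x) 0 0 = (p^T *m euler_mx T *m x)^T 0 0.
  by rewrite [RHS]mxE.
by rewrite trmx_mul E mulmxA.
Qed.

(** Multiplied by D the two sides are b^T p and b i, equal by [serre_dual]; D is injective because
    the valuations are positive. *)
Lemma rstar_eq_lstar : rstar s p = lstar s i.
Proof.
have inj (x y : 'cV[int]_m) : valuation_mx Qt *m x = valuation_mx Qt *m y -> x = y.
  move=> /colP xy; apply/colP=> j; have := xy j; rewrite !mul_valuation_mx; apply: mulfI.
  by rewrite eqz_nat -lt0n valuation_gt0.
apply: inj; rewrite /rstar /lstar !mulmxA.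
rewrite -(euler_mxR acQ S_Qt s_simple) -(euler_mxR' acQ S_Qt s_simple).
apply/colP=> j; have := serre_dual (delta_mx j 0); rewrite /euler -colE trmx_delta.
by rewrite -mulmxA -rowE !mxE => <-; apply: eq_bigr => l _; rewrite !mxE mulrC.
Qed.

Variables (mm u : 'cV[int]_m).

Lemma lam_shift_exponent :
  lam L (rstar s p) (rstar s (- u) - lstar s (mm - u)) =
  lam L (rstar s mm) (rstar s p) + euler T p u - euler T p mm.
Proof.
have rN : rstar s (- u) = - rstar s u by rewrite /rstar mulmxN.
have -> : rstar s (- u) - lstar s (mm - u) = exchange_mx *m (mm - u) - rstar s mm.
  have := rstar_lstar (mm - u); rewrite rstarB rN => /eqP.
  rewrite addrC -subr_eq => /eqP <-.
  suff E (V : zmodType) (a b c : V) : - b - (- b + a - c) = c - a by apply: E.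
  by rewrite -addrA opprD opprK addrA addNr add0r opprB.
rewrite lamDr lam_rstar lamNr eulerDr eulerNr.
by rewrite (lam_skew L_skew (rstar s p)) opprK opprB addrC addrA.
Qed.

Lemma lam_unshift_exponent :
  lam L (rstar s (- u) - lstar s (mm - u)) (lstar s i) =
  lam L (rstar s i) (rstar s mm) - euler T p u.
Proof.
rewrite (rstar_lstar i) -rstar_eq_lstar (lamDl L (rstar s p)) (lam_skew L_skew _ (rstar s p)).
rewrite lam_shift_exponent (lam_skew L_skew (exchange_mx *m i)) lam_rstar -serre_dual.
rewrite (lam_skew L_skew (rstar s p)).
move: (lam L _ _) (euler T p u) (euler T p mm) => x y z.
by ring.
Qed.

(** All three monomials are X to the power (p - u)^* - ^*(m - u), the one with i by
    [rstar_eq_lstar]. Only the scalars remain, and they satisfy [vpow_identity_shift]. *)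
Lemma shift_term :
  (vpow k (2 * euler T p mm) - 1) *: (qcc_term s L 0 0 p 0 * qcc_term s L 0 mm 0 u) =
  vpow k (lam L (rstar s mm) (rstar s p)) *:
    ((vpow k (2 * euler T p u) - 1) *: qcc_term s L 0 mm p u +
     vpow k (- euler T mm i) *:
       ((vpow k (2 * euler T (mm - u) i) - 1) *: qcc_term s L i mm 0 u)).
Proof.
have e0 x : euler T x 0 = 0 by rewrite /euler mulmx0 mxE.
have lst0 : lstar s 0 = 0 by rewrite /lstar mulmx0.
rewrite /qcc_term !subr0 !sub0r e0 vpow0 scale1r lst0 subr0.
rewrite -scalerAr qXM !scalerA -!serre_dual.
have -> : rstar s p + (rstar s (- u) - lstar s (mm - u)) =
    rstar s (p - u) - lstar s (mm - u) by rewrite addrA -mulmxDr.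
have -> : rstar s (- u) - lstar s (mm - u - i) = rstar s (p - u) - lstar s (mm - u).
  by rewrite lstarB opprB -rstar_eq_lstar addrA -mulmxDr [- u + p]addrC.
apply: scalerDl_combine.
rewrite lam_shift_exponent.
have -> : euler T (p - u) (mm - u) = euler T p mm - euler T p u - euler T u (mm - u).
  by rewrite eulerDl eulerNl eulerDr eulerNr.
have -> : euler T (- u) (mm - u - i) = euler T p u - euler T u (mm - u).
  by rewrite eulerDr !eulerNl eulerNr opprK -serre_dual addrC.
have -> : euler T (- u) (mm - u) = - euler T u (mm - u) by rewrite eulerNl.
have -> : euler T p (mm - u) = euler T p mm - euler T p u by rewrite eulerDr eulerNr.
rewrite -!mulrA [vpow k (- euler T u _) * _]mulrC; exact: vpow_identity_shift.
Qed.

(** The monomial is again the same on both sides; in the product, the exponent ^*i of I[-1] plays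
    the part of p^*. *)
Lemma unshift_term :
  (vpow k (2 * euler T mm i) - 1) *: (qcc_term s L 0 mm 0 u * qcc_term s L i 0 0 0) =
  vpow k (lam L (rstar s i) (rstar s mm)) *:
    (vpow k (- euler T p mm) *:
       ((vpow k (2 * euler T p u) - 1) *: qcc_term s L 0 mm p u) +
     (vpow k (2 * euler T (mm - u) i) - 1) *: qcc_term s L i mm 0 u).
Proof.
have e0 x : euler T 0 x = 0 by rewrite /euler trmx0 !mul0mx mxE.
have rst0 : rstar s 0 = 0 by rewrite /rstar mulmx0.
have lstN : lstar s (- i) = - lstar s i by rewrite /lstar mulmxN.
rewrite /qcc_term !subr0 !sub0r e0 vpow0 scale1r rst0 lstN sub0r opprK.
rewrite -scalerAl qXM !scalerA -!serre_dual.
have -> : rstar s (- u) - lstar s (mm - u) + lstar s i =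
    rstar s (p - u) - lstar s (mm - u).
  by rewrite -rstar_eq_lstar addrC addrA -mulmxDr.
have -> : rstar s (- u) - lstar s (mm - u - i) = rstar s (p - u) - lstar s (mm - u).
  by rewrite lstarB opprB -rstar_eq_lstar addrA -mulmxDr [- u + p]addrC.
apply: scalerDl_combine.
rewrite lam_unshift_exponent.
have -> : euler T (p - u) (mm - u) = euler T p mm - euler T p u - euler T u (mm - u).
  by rewrite eulerDl eulerNl eulerDr eulerNr.
have -> : euler T (- u) (mm - u - i) = euler T p u - euler T u (mm - u).
  by rewrite eulerDr !eulerNl eulerNr opprK -serre_dual addrC.
have -> : euler T (- u) (mm - u) = - euler T u (mm - u) by rewrite eulerNl.
have -> : euler T p (mm - u) = euler T p mm - euler T p u by rewrite eulerDr eulerNr.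
rewrite -!mulrA [vpow k (- euler T u _) * _]mulrC; exact: vpow_identity_unshift.
Qed.

End CompatiblePair.

Theorem theorem5p7 (k : finFieldType) (n m : nat) (le_nm : (n <= m)%N)
    (Q : valued_quiver n) (Qt : valued_quiver m)
    (acyclicQ : acyclic Q) (acyclicQt : acyclic Qt)
    (QQt : attached le_nm Q Qt)
    (S : species k m) (S_Qt : species_of Qt S) (T : tensor_algebra S)
    (s : 'I_m -> fdmod T) (s_simple : forall i, vertex_simple i (s i))
    (L : 'M[int]_m) (L_skew : L^T = - L)
    (L_compat : L *m (- (R'mx s - Rmx s)) =
                diag_mx (\row_i (valuation Qt i)%:Z))
    (M I P : fdmod T) (I_inj : injective_mod I) (P_proj : projective P)
    (nuP : iso (nakayama P) I) :
  let mm := dimvec M in let ii := dimvec I in let pp := dimvec P in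
  let X := qcc s L in let O := zero_mod T in
  (vpow k (2 * euler T pp mm) - 1) *: (X O O P * X O M O) =
    vpow k (lam L (rstar s mm) (rstar s pp)) *:
      (sum_shift s L P M +
       vpow k (- euler T mm ii) *: sum_unshift s L M I)
  /\
  (vpow k (2 * euler T mm ii) - 1) *: (X O M O * X I O O) =
    vpow k (lam L (rstar s ii) (rstar s mm)) *:
      (vpow k (- euler T pp mm) *: sum_shift s L P M +
       sum_unshift s L M I).
Proof.
move=> mm ii pp X O.
(* Ext vanishes on both sides, by projectivity of P and injectivity of I, so the equality is that of
   hom(P, S_j) and hom(S_j, nu P). *)
have serre j : euler T pp (dimvec (s j)) = euler T (dimvec (s j)) ii.
  rewrite !eulerP extdim_proj // extdim_inj // homdim_nakayama //.
  by rewrite (homdim_isor _ nuP).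
have dO : dimvec O = 0 := dimvec_zero_mod T.
have XP : X O O P = qcc_term s L 0 0 pp 0 := qcc_zero s L dO (erefl pp).
have XI : X I O O = qcc_term s L ii 0 0 0 := qcc_zero s L (erefl ii) dO.
have XM : X O M O = \sum_(U : {set 'cV[k]_(mdim M)} | submod U) qcc_term s L 0 mm 0 (dimvec_set U).
  exact: (qcc_module s L M dO).
rewrite XP XI XM (sum_shiftE s L M P_proj) (sum_unshiftE s L M I_inj).
split.
  rewrite mulr_sumr !scaler_sumr -big_split scaler_sumr; apply: eq_bigr => U _.
  exact: (shift_term acyclicQt S_Qt s_simple L_skew L_compat serre).
rewrite mulr_suml !scaler_sumr -big_split scaler_sumr; apply: eq_bigr => U _.
exact: (unshift_term acyclicQt S_Qt s_simple L_skew L_compat serre).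
Qed.
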